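(* Let $v$ be a flow on a connected compact surface $S$. The following are equivalent: (1) The flow $v$ is recurrent. (2) There are no non-closed proper orbits. (3) Each orbit is closed or locally dense. (4) The orbit class space $S/\hat{v}$ is $T_{1/2}$. (5) The orbit space $S/v$ is $S_{1/2}$.
   Context: A surface is a two-dimensional paracompact manifold, possibly with boundary. A flow on a topological space $X$ is a continuous action $v\colon \mathbb{R}\times X\to X$; write $v_t=v(t,\cdot)$ and $O(x)=\{v_t(x)\mid t\in\mathbb{R}\}$. Let $\omega(x)=\bigcap_{n\in\mathbb{R}}\overline{\{v_t(x)\mid t>n\}}$ and $\alpha(x)=\bigcap_{n\in\mathbb{R}}\overline{\{v_t(x)\mid t<n\}}$. A point $x$ is singular if $v_t(x)=x$ for all $t$, periodic if it is not singular and $v_T(x)=x$ for some $T>0$, and closed if it is singular or periodic; an orbit is closed if it consists of closed points. A point $x$ is recurrent if $x\in\omega(x)\cup\alpha(x)$; the flow is recurrent if every point is recurrent. An orbit is proper if it is embedded, and locally dense if its closure has nonempty interior. The orbit space $S/v$ is the quotient of $S$ by the relation $x\sim y$ iff $O(x)=O(y)$; the orbit class space $S/\hat v$ is the quotient of $S$ by $x\approx y$ iff $\overline{O(x)}=\overline{O(y)}$ (it is the Kolmogorov ($T_0$) quotient of $S/v$). A topological space is $T_{1/2}$ if every singleton is closed or open; it is $S_{1/2}$ if its Kolmogorov quotient (identifying points with the same closure) is $T_{1/2}$. *)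

(* Defs.v *)
From HB Require Import structures.
From mathcomp Require Import all_boot all_order all_algebra.
From mathcomp Require Import all_classical all_reals all_analysis.
Import numFieldNormedType.Exports.
Set Implicit Arguments. Unset Strict Implicit. Unset Printing Implicit Defensive.
Import Order.TTheory GRing.Theory Num.Theory.
Local Open Scope classical_set_scope.
Local Open Scope ring_scope.

Definition half_plane (R : realType) : set (R * R) := [set p | 0 <= p.2].

Definition has_chart (R : realType) (S : topologicalType) (x : S) : Prop :=
  exists (U : set S) (W : set (R * R)) (f : S -> R * R) (g : R * R -> S),
    [/\ open U, U x, open W,
        f @` U `<=` W `&` @half_plane R & g @` (W `&` @half_plane R) `<=` U] /\
    [/\ (forall y, U y -> g (f y) = y),
        (forall p, (W `&` @half_plane R) p -> f (g p) = p),
        {within U, continuous f} &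
        {within W `&` @half_plane R, continuous g}].

(* a surface: Hausdorff, locally homeomorphic to open subsets of the closed
   half-plane.  (Paracompactness is automatic in the compact case used here.) *)
Definition surface (R : realType) (S : topologicalType) : Prop :=
  hausdorff_space S /\ forall x : S, has_chart R x.

Definition flow (R : realType) (S : topologicalType) (v : R -> S -> S) : Prop :=
  [/\ continuous (fun p : R * S => v p.1 p.2),
      (forall x, v 0 x = x) &
      (forall s t x, v (s + t) x = v s (v t x))].

Section FlowNotions.
Context (R : realType) (S : topologicalType) (v : R -> S -> S).

Definition orbit (x : S) : set S := [set v t x | t in [set: R]].

Definition omega_limit (x : S) : set S :=
  \bigcap_(n in [set: R]) closure [set v t x | t in [set t | n < t]].
Definition alpha_limit (x : S) : set S :=
  \bigcap_(n in [set: R]) closure [set v t x | t in [set t | t < n]].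

Definition singular_pt (x : S) : Prop := forall t, v t x = x.
Definition periodic_pt (x : S) : Prop :=
  ~ singular_pt x /\ exists T : R, 0 < T /\ v T x = x.
Definition closed_pt (x : S) : Prop := singular_pt x \/ periodic_pt x.
Definition closed_orbit (x : S) : Prop := forall y, orbit x y -> closed_pt y.

Definition recurrent_pt (x : S) : Prop := (omega_limit x `|` alpha_limit x) x.
Definition recurrent_flow : Prop := forall x : S, recurrent_pt x.

(* O(x) is embedded: the orbit map t |-> v t x, taken modulo its fibres,
   is a homeomorphism onto O(x) with the subspace topology. *)
Definition proper_orbit (x : S) : Prop :=
  forall (t0 e : R), 0 < e -> exists2 W : set S, nbhs (v t0 x) W &
    forall t, W (v t x) -> exists s, v s x = v t x /\ `|s - t0| < e.

Definition locally_dense (x : S) : Prop := interior (closure (orbit x)) !=set0.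

End FlowNotions.

Record space := Space { pts : Type; opens : set (set pts) }.

Definition sp_closure (X : space) (A : set (pts X)) : set (pts X) :=
  [set x | forall U, @opens X U -> U x -> U `&` A !=set0].
Definition sp_closed (X : space) (A : set (pts X)) : Prop :=
  @opens X (~` A).

Definition quotient_space (X : space) (Rel : pts X -> pts X -> Prop) : space :=
  @Space {A : set (pts X) | exists x, A = Rel x}
    (fun U => @opens X [set y | exists2 A, U A & proj1_sig A y]).

Definition kolmogorov (X : space) : space :=
  quotient_space (fun x y : pts X => sp_closure [set x] = sp_closure [set y]).

Definition T_half (X : space) : Prop :=
  forall p : pts X, sp_closed [set p] \/ @opens X [set p].
Definition S_half (X : space) : Prop := T_half (kolmogorov X).

Definition top_space (T : topologicalType) : space := @Space T open.

Definition orbit_space (R : realType) (S : topologicalType) (v : R -> S -> S) :=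
  quotient_space (X := top_space S) (fun x y => orbit v x = orbit v y).
Definition orbit_class_space (R : realType) (S : topologicalType)
    (v : R -> S -> S) :=
  quotient_space (X := top_space S)
    (fun x y => closure (orbit v x) = closure (orbit v y)).

(* Main.v *)
(* A recurrent orbit that is neither closed nor locally dense would have a
   nowhere dense closure K. Cross sections of a continuous flow on a surface are
   linearly ordered connected sets (Eilenberg's criterion, the order being a
   winding parity computed in a chart). If all points are recurrent, every gap of
   K in a section contains a closed curve made of an orbit arc and a piece of the
   gap; it misses K, and meets exactly once a small segment of the section joining
   two points of the orbit. Taking such segments smaller and smaller gives
   infinitely many curves whose dual classes in H^1(S; Z/2) are pairwise distinct,
   since they are separated by closed curves made of an orbit arc in K and one of
   these segments; but H^1(S; Z/2) is finite as S is compact. Classes in H^1 are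
   represented by torsors described by local potentials. Near a periodic orbit the
   return map is monotone, which traps every nearby non-closed orbit; hence the
   orbit class of a non-closed recurrent orbit is open. *)

Require Import Defs.
From HB Require Import structures.
From mathcomp Require Import all_boot all_order all_algebra.
From mathcomp Require Import all_classical all_reals all_analysis.
From mathcomp Require Import lra.
Import numFieldNormedType.Exports.
Set Implicit Arguments. Unset Strict Implicit. Unset Printing Implicit Defensive.
Import Order.TTheory GRing.Theory Num.Theory.
Local Open Scope classical_set_scope.
Local Open Scope ring_scope.
(* [orbit] is shadowed by the one of fingraph. *)
Local Notation orbit := Defs.orbit.

(** * Torsors and potentials *)

(** A merely continuous flow gives sections that are not known to be arcs. Every argument about a
    section therefore uses only its connectedness, its order and the closedness of its segments, and
    connectedness is always used in the form: a locally constant boolean function is constant.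
    Coefficients are Z/2 because [S] need not be orientable and a return map may exchange the two
    sides of a section. For the same reason a periodic orbit is followed twice: the square of the
    return map preserves sides. The two time directions are treated together through [returns]: the
    orbit comes back near its starting point at times of arbitrarily large absolute value. This is
    equivalent to recurrence and is invariant under reversal of time. The converse implications
    share one observation. A point that does not return has an embedded, aperiodic orbit that is
    locally closed, not closed, and not a neighbourhood of its points; it equals its orbit class.
    Each of (2) to (5) forbids such an orbit. Conditions (4) and (5) both pull back to [S] as: every
    orbit class is closed or open. *)

Lemma connected_locally_constant (T : topologicalType) (C : set T) (f : T -> bool) :
  connected C -> (forall x, C x -> \forall y \near x, C y -> f y = f x) ->
  forall x y, C x -> C y -> f x = f y.
Proof.
move=> cC lf x y Cx Cy.
pose P (b : bool) : set T := interior [set w | C w -> f w = b].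
have oP b : open (P b) by exact: open_interior.
have PE z b : C z -> P b z <-> f z = b.
  move=> Cz; split; first by move/nbhs_singleton; exact.
  by move=> <-; exact: lf.
have : C `&` P (f x) = C.
  apply: cC; first by exists x; split => //; apply/PE.
  - by exists (P (f x)).
  - exists (~` P (~~ f x)); first exact/open_closedC.
    apply/seteqP; split => z [Cz Pz]; split => //.
      by move/(PE _ _ Cz) => fz; move/(PE _ _ Cz) : Pz; rewrite fz; case: (f x).
    apply/PE => //; apply: contra_notP Pz => /eqP fz; apply/PE => //.
    by move: fz; case: (f z); case: (f x).
move=> e; have : (C `&` P (f x)) y by rewrite e.
by case=> _ /(PE _ _ Cy) ->.
Qed.

Lemma locally_constant_connected (T : topologicalType) (C : set T) :
  (forall f : T -> bool, (forall x, C x -> \forall y \near x, C y -> f y = f x) ->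
     forall x y, C x -> C y -> f x = f y) -> connected C.
Proof.
move=> h B [b Bb] [Q oQ BQ] [D cD BD]; apply/seteqP; split; first by rewrite BQ => z [].
have Cb : C b by move: Bb; rewrite BQ => -[].
move=> z Cz; apply/asboolP; rewrite -(h (fun w => `[< B w >]) _ b z Cb Cz) ?asboolT//.
move=> x Cx.
have [Bx|nBx] := pselect (B x).
  have : Q x by move: Bx; rewrite BQ => -[].
  move=> /(conj oQ)/open_nbhs_nbhs; apply: filterS => y Qy Cy.
  by rewrite !asboolT// BQ.
have : (~` D) x by move=> Dx; apply: nBx; rewrite BD.
move=> /(conj (closed_openC cD))/open_nbhs_nbhs; apply: filterS => y nDy Cy.
by rewrite !asboolF// BD => -[].
Qed.

(** Compactness in its near-covering form, applied to the filter of finite lists ordered by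
    inclusion. *)
Lemma finite_subcover (T : topologicalType) (N : T -> set T) :
  compact [set: T] -> (forall x, nbhs x (N x)) ->
  exists s : seq T, forall x, exists2 y, y \in s & N y x.
Proof.
move=> /compact_near_coveringP cT Nx.
pose F : set_system (seq T) :=
  filter_from [set: seq T] (fun s => [set s' | {subset s <= s'}]).
have FF : Filter F.
  apply: filter_from_filter; first by exists nil.
  move=> s s' _ _; exists (s ++ s') => // s'' /= h; split => x xs; apply: h.
    by rewrite mem_cat xs.
  by rewrite mem_cat xs orbT.
have [] := cT _ F (fun s x => exists2 y, y \in s & N y x) FF.
  move=> x _; exists (N x, [set s | {subset [:: x] <= s}]).
    by split => //=; exists [:: x].
  by move=> [x' s] /= [Nx' h]; exists x => //; apply: h; rewrite inE.
by move=> s _ /(_ s (fun _ h => h)) h; exists s => x; exact: h.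
Qed.

Definition convex_subset (R : realType) (V : normedModType R) (A : set V) :=
  forall a b (t : R), A a -> A b -> 0 <= t <= 1 -> A (a + t *: (b - a)).

(* A Z/2-torsor on A, given by local potentials: [c.1] is the domain of the
   potential [c.2], and two potentials differ by a locally constant function. *)
Definition torsor_on (T : topologicalType) (A : set T)
    (F : set (set T * (T -> bool))) : Prop :=
  (forall a, A a -> exists c, [/\ F c, c.1 a & \forall b \near a, A b -> c.1 b]) /\
  (forall c c' a, F c -> F c' -> A a -> c.1 a -> c'.1 a ->
     \forall b \near a, A b -> c.2 b (+) c'.2 b = c.2 a (+) c'.2 a).

Definition potential_on (T : topologicalType) (A : set T)
    (F : set (set T * (T -> bool))) (phi : T -> bool) : Prop :=
  forall c a, F c -> A a -> c.1 a ->
    \forall b \near a, A b -> phi b (+) c.2 b = phi a (+) c.2 a.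

Section Torsors.
Variable R : realType.

Lemma segment_image_connected (V : normedModType R) (a b : V) :
  connected [set a + t *: (b - a) | t in `[0%R : R, 1%R]].
Proof.
apply: connected_continuous_connected; first exact: segment_connected.
apply: continuous_subspaceT => t; apply: cvgD; first exact: cvg_cst.
by apply: cvgZr_tmp; exact: cvg_id.
Qed.

Lemma convex_locally_constant (V : normedModType R) (A : set V) (f : V -> bool) :
  convex_subset A -> (forall x, A x -> \forall y \near x, A y -> f y = f x) ->
  forall x y, A x -> A y -> f x = f y.
Proof.
move=> cA lf x y Ax Ay.
have sA : [set x + t *: (y - x) | t in `[0%R : R, 1%R]] `<=` A.
  by move=> _ [t /= t01 <-]; apply: cA => //; move: t01; rewrite in_itv.
apply: (connected_locally_constant (@segment_image_connected _ x y) (f := f)).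
- move=> z /sA Az; have := lf _ Az.
  by apply: filterS => w h /sA; exact: h.
- by exists 0; rewrite /= ?in_itv /= ?lexx ?ler01// scale0r addr0.
- by exists 1; rewrite /= ?in_itv /= ?lexx ?ler01// scale1r addrC subrK.
Qed.

Lemma sub_convex_comb (V : normedModType R) (c a b : V) (t : R) :
  c - (a + t *: (b - a)) = (1 - t) *: (c - a) + t *: (c - b).
Proof.
have -> : c - b = (c - a) - (b - a) by rewrite opprB addrA subrK.
by rewrite scalerBl scale1r (scalerBr t (c - a)) addrA subrK opprD addrA.
Qed.

Lemma convex_connected (V : normedModType R) (A : set V) :
  convex_subset A -> connected A.
Proof.
move=> vA; apply: locally_constant_connected => f lf.
exact: (convex_locally_constant vA lf).
Qed.

Lemma convex_subset_ball (V : normedModType R) (A : set V) (c : V) (r : R) :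
  convex_subset A -> convex_subset (A `&` [set b | `|c - b| < r]).
Proof.
move=> cA a b t [Aa /= ar] [Ab /= br] /andP[t0 t1]; split; first by apply: cA => //; apply/andP.
rewrite sub_convex_comb (le_lt_trans (ler_normD _ _))// !normrZ !ger0_norm ?subr_ge0//.
move: `|c - a| `|c - b| ar br => x y xr yr.
have [xy|yx] := leP x y.
  by apply: le_lt_trans yr; have := ler_wpM2l t0 xy; have := ler_wpM2l (_ : 0 <= 1 - t) xy; rewrite subr_ge0 => /(_ t1); lra.
by apply: le_lt_trans xr; have := ler_wpM2l t0 (ltW yx); lra.
Qed.

(** The near-covering form of compactness again, now with the filter of radii tending to 0 from
    above. A radius [r] valid at [a] leaves every radius below [r / 2] valid at points within
    [r / 2] of [a]. *)
Lemma lebesgue_number (V : normedModType R) (A : set V) (F : set (set V)) :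
  compact A ->
  (forall a, A a -> exists2 N, F N & \forall b \near a, A b -> N b) ->
  exists r : R, 0 < r /\ forall a, A a -> exists2 N, F N &
    forall b, A b -> `|a - b| < r -> N b.
Proof.
move=> cA loc; pose P r a := exists2 N, F N & forall b, A b -> `|a - b| < r -> N b.
have H := (iffLR (compact_near_coveringP A) cA) R (0^'+) P _.
have /H h : forall x : V, A x -> \forall x' \near x & r \near 0^'+, P r x'.
  move=> a Aa; have [N FN /nbhs_ballP[r /= r0 h]] := loc a Aa.
  exists (ball a (r / 2), [set e | e < r / 2]) => /=.
    split; first by apply: nbhsx_ballx; rewrite divr_gt0.
    by apply: nbhs_right_lt; rewrite divr_gt0.
  move=> [a' e] /=; rewrite -ball_normE /= => -[aa' er]; exists N => // b Ab a'b.
  apply: h => //; rewrite -ball_normE /=.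
  by rewrite (le_lt_trans (ler_distD a' _ _))//; lra.
have [r rh r0] : exists2 r : R, A `<=` P r & 0 < r.
  have : \forall r \near (0:R)^'+, A `<=` P r /\ 0 < r.
    by apply: filterI => //; exact: nbhs_right_gt.
  by move=> /filter_ex[r []]; exists r.
by exists r; split.
Qed.

(** A convex set is simply connected. The potential at [b] is the transport along the segment from
    [a0] to [b], cut into short steps; moving [b] a little produces a ladder of small squares, and
    transport around each square is trivial. *)
Lemma convex_torsor_potential (V : normedModType R) (A : set V) a0 F :
  compact A -> convex_subset A -> A a0 -> torsor_on A F ->
  exists phi, potential_on A F phi.
Proof.
move=> cA vA Aa0 [Fcov Fcomp].
have [||l [l0 lF]] := @lebesgue_number V A (fst @` F) => //.
  by move=> a /Fcov[c [Fc _ cb]]; exists c.1 => //; exists c.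
have lF' a : exists c, A a -> F c /\ forall b, A b -> `|a - b| < l -> c.1 b.
  have [Aa|nAa] := pselect (A a); last by exists (set0, fun=> true).
  by have [_ [c Fc <-] h] := lF a Aa; exists c.
have [ch chP] := choice lF'.
(* Transport from [a] to [b], read in the chart chosen at [a]. By [rho_eq] the choice of chart does
   not matter: the common domain of two chosen balls is convex, so their potentials differ there by
   a constant. *)
pose rho a b := (ch a).2 a (+) (ch a).2 b.
have rho_eq a b x y : A a -> A b -> A x -> A y -> `|a - x| < l -> `|b - x| < l ->
    `|a - y| < l -> `|b - y| < l ->
    (ch a).2 x (+) (ch a).2 y = (ch b).2 x (+) (ch b).2 y.
  move=> Aa Ab Ax Ay ax bx ay by_.
  have vB : convex_subset ((A `&` [set z | `|a - z| < l]) `&` [set z | `|b - z| < l]).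
    by do 2! apply: convex_subset_ball.
  have h : (ch a).2 x (+) (ch b).2 x = (ch a).2 y (+) (ch b).2 y.
    apply: (convex_locally_constant (f := fun z => (ch a).2 z (+) (ch b).2 z) vB) => //.
    move=> z [[Az /= az] bz]; have [Fa ha] := chP _ Aa; have [Fb hb] := chP _ Ab.
    have := Fcomp _ _ z Fa Fb Az (ha _ Az az) (hb _ Az bz).
    by apply: filterS => w h [[Aw _] _]; exact: h.
  by move: h; case: ((ch a).2 x); case: ((ch a).2 y); case: ((ch b).2 x); case: ((ch b).2 y).
have cocycle a b c : A a -> A b -> A c -> `|a - b| < l -> `|a - c| < l -> `|b - c| < l ->
    rho a b (+) rho b c = rho a c.
  move=> Aa Ab Ac ab ac bc; rewrite /rho.
  rewrite (@rho_eq b a b c)// ?subrr ?normr0//.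
  by case: ((ch a).2 a); case: ((ch a).2 b); case: ((ch a).2 c).
have rhoaa a : rho a a = false by rewrite /rho; case: (_.2 _).
have square a b a' b' : A a -> A b -> A a' -> A b' -> `|a - b| < l -> `|a - a'| < l ->
    `|a - b'| < l -> `|b - b'| < l -> `|a' - b'| < l ->
    rho a b (+) rho a' b' = rho a a' (+) rho b b'.
  move=> Aa Ab Aa' Ab' ab aa' ab' bb' a'b'.
  have := cocycle a b b' Aa Ab Ab' ab ab' bb'; have := cocycle a a' b' Aa Aa' Ab' aa' ab' a'b'.
  move=> <-; by case: (rho a b); case: (rho a' b'); case: (rho a a'); case: (rho b b').
have [M M0 AM] : exists2 M : R, 0 < M & forall a, A a -> `|a - a0| <= M.
  have [M [Mr h]] := compact_bounded cA.
  exists (`|M| + 1 + `|a0|); first by rewrite ltr_wpDr// ltr_pwDr.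
  move=> a Aa; rewrite (le_trans (ler_normB _ _))// lerD2r; apply: h => //.
  by rewrite (le_lt_trans (ler_norm _))// ltrDl.
(* Steps shorter than [l / 2], so that the diagonals of the squares compared in [phiE] are still
   shorter than [l]. *)
have [n nM] : exists n : nat, M / n.+1%:R < l / 2.
  exists (Num.bound (M / (l / 2))); rewrite ltr_pdivrMr// mulrC -ltr_pdivrMr ?divr_gt0//.
  have /archi_boundP h : 0 <= M / (l / 2) by rewrite !divr_ge0// ltW.
  by rewrite (lt_le_trans h)// ler_nat.
pose p b (k : nat) : V := a0 + (k%:R / n.+1%:R) *: (b - a0).
have pA b k : A b -> (k <= n.+1)%N -> A (p b k).
  move=> Ab kn; apply: vA => //; rewrite divr_ge0//= ler_pdivrMr// mul1r ler_nat//.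
have pS b k : A b -> `|p b k - p b k.+1| < l / 2.
  move=> Ab; rewrite /p opprD addrACA subrr add0r -scalerBl -mulrBl normrZ.
  rewrite -natr1 opprD addrA subrr sub0r mulN1r normrN gtr0_norm ?invr_gt0//.
  by rewrite (le_lt_trans _ nM)// mulrC ler_pM2r ?invr_gt0//; exact: AM.
have pd b b' k : (k <= n.+1)%N -> `|p b k - p b' k| <= `|b - b'|.
  move=> kn; rewrite /p opprD addrACA subrr add0r -scalerBr opprB addrA subrK normrZ.
  rewrite ger0_norm ?divr_ge0// ler_piMl// ler_pdivrMr// mul1r ler_nat//.
pose phi b := \big[addb/false]_(k < n.+1) rho (p b k) (p b k.+1).
have phiE b b' : A b -> A b' -> `|b - b'| < l / 2 -> phi b (+) phi b' = rho b b'.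
  move=> Ab Ab' bb'.
  have H k : (k <= n.+1)%N -> (\big[addb/false]_(i < k) rho (p b i) (p b i.+1)) (+)
      (\big[addb/false]_(i < k) rho (p b' i) (p b' i.+1)) = rho (p b k) (p b' k).
    elim: k => [_|k IH kn]; first by rewrite !big_ord0 /p mul0r !scale0r addr0 rhoaa.
    rewrite !big_ord_recr/= addbACA IH ?(ltnW kn)//.
    have l2 : l / 2 < l by rewrite ltr_pdivrMr// ltr_pMr// ltr1n.
    have bS x : A x -> `|p x k - p x k.+1| < l by move=> Ax; exact: lt_trans (pS _ _ Ax) l2.
    have bd i : (i <= n.+1)%N -> `|p b i - p b' i| < l.
      by move=> ik; rewrite (le_lt_trans (pd _ _ _ ik))// (lt_trans bb').
    have bSd : `|p b k - p b' k.+1| < l.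
      rewrite (le_lt_trans (ler_distD (p b k.+1) _ _))// [ltRHS](splitr l).
      by rewrite ltrD// ?pS// (le_lt_trans (pd _ _ _ _)).
    have kn' := ltnW kn.
    rewrite (square _ _ _ _ (pA _ _ Ab kn') (pA _ _ Ab kn) (pA _ _ Ab' kn') (pA _ _ Ab' kn)
      (bS _ Ab) (bd _ kn') bSd (bd _ kn) (bS _ Ab')).
    by rewrite addbA addbb addFb.
  by rewrite /phi H// /p divff ?pnatr_eq0// !scale1r !(addrC a0) !subrK.
exists phi => c a Fc Aa ca; have [Fa ha] := chP _ Aa.
have aa : (ch a).1 a by apply: ha => //; rewrite subrr normr0.
have := Fcomp _ _ a Fc Fa Aa ca aa.
have : \forall b \near a, `|a - b| < l / 2.
  by apply: cvgr_dist_lt; rewrite ?divr_gt0//; exact: cvg_id.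
apply: filterS2 => b ab h Ab; move: (h Ab) (phiE _ _ Aa Ab ab); rewrite /rho.
by case: (phi a); case: (phi b); case: (c.2 a); case: (c.2 b); case: ((ch a).2 a); case: ((ch a).2 b).
Qed.

End Torsors.

Lemma within_continuousP (T U : topologicalType) (A : set T) (f : T -> U) :
  {within A, continuous f} <->
  (forall x N, A x -> nbhs (f x) N -> \forall y \near x, A y -> N (f y)).
Proof.
split; first by move=> /subspace_continuousP h x N Ax Nx; exact: (h x Ax N Nx).
by move=> h; apply/subspace_continuousP => x Ax N Nx; exact: h.
Qed.

(** * Charts and finiteness *)

Section Charts.
Variables (R : realType) (S : topologicalType).

(** In the max norm of [R * R] this is a square cut by the half-plane: compact as a product of
    intervals met with a closed set, and convex, which is what [convex_torsor_potential] asks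
    for. *)
Definition half_disc (c : R * R) (r : R) : set (R * R) :=
  [set p | 0 <= p.2 /\ `|c - p| <= r].

Lemma half_disc_convex c r : convex_subset (half_disc c r).
Proof.
move=> a b t [a2 ar] [b2 br] /andP[t0 t1]; split => /=.
  have -> : a.2 + t * (b.2 - a.2) = (1 - t) * a.2 + t * b.2 by lra.
  by rewrite addr_ge0// mulr_ge0// subr_ge0.
rewrite sub_convex_comb (le_trans (ler_normD _ _))// !normrZ !ger0_norm ?subr_ge0//.
have := ler_wpM2l t0 br; have := ler_wpM2l (_ : 0 <= 1 - t) ar.
by rewrite subr_ge0 => /(_ t1); lra.
Qed.

Lemma normB_pair_le (c p : R * R) (r : R) :
  (`|c - p| <= r) = (`|c.1 - p.1| <= r) && (`|c.2 - p.2| <= r).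
Proof. by rewrite /Num.norm/= ge_max. Qed.

Lemma half_disc_compact c r : compact (half_disc c r).
Proof.
have -> : half_disc c r = (`[c.1 - r, c.1 + r] `*` `[c.2 - r, c.2 + r])
    `&` [set p | 0 <= p.2].
  apply/seteqP; split => p; rewrite /half_disc /= normB_pair_le !ler_distl !in_itv /=.
    by move=> [p2 /andP[/andP[? ?] /andP[? ?]]]; split => //; split; apply/andP; split; lra.
  by move=> [[/andP[? ?] /andP[? ?]] p2]; split => //; apply/andP; split; apply/andP; split; lra.
apply: compact_closedI; first by apply: compact_setX; exact: segment_compact.
apply: (@preimage_closed _ _ (snd : R * R -> R) [set x | 0 <= x]); last exact: closed_ge.
by move=> p _; exact: cvg_snd.
Qed.

Record disc_chart (x : S) (f : S -> R * R) (g : R * R -> S) (r : R) : Prop := DiscChart {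
  dc_r : 0 < r;
  dc_ge0 : 0 <= (f x).2;
  dc_gx : g (f x) = x;
  dc_fg : forall p, half_disc (f x) r p -> f (g p) = p;
  dc_g : forall p N, half_disc (f x) r p -> nbhs (g p) N ->
           \forall q \near p, half_disc (f x) r q -> N (g q);
  dc_open : forall r', r' <= r -> open [set y | exists p, [/\ 0 <= p.2, `|f x - p| < r' & g p = y]];
  dc_f : forall y, (exists p, [/\ 0 <= p.2, `|f x - p| < r & g p = y]) -> f @ y --> f y }.

Lemma disc_chart_exists (x : S) : has_chart R x -> exists f g r, disc_chart x f g r.
Proof.
move=> [U [W [f [g [[oU Ux oW fUW gWU] [gf fg cf cg]]]]]].
have [Wfx fx2] : (W `&` @half_plane R) (f x) by apply: fUW; exists x.
have /nbhs_ballP[r' /= r'0 rW] : nbhs (f x) W by exact: open_nbhs_nbhs.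
pose r := r' / 2; have r0 : 0 < r by rewrite divr_gt0.
have HW p : half_disc (f x) r p -> (W `&` @half_plane R) p.
  move=> [p2 pr]; split => //; apply: rW; rewrite -ball_normE /=.
  by rewrite (le_lt_trans pr)// /r; lra.
have cfU y : U y -> f @ y --> f y.
  move=> Uy N Ny; have := iffLR (within_continuousP _ _) cf y N Uy Ny.
  by apply: filterS2 (open_nbhs_nbhs (conj oU Uy)) => z Uz; exact.
exists f, g, r; split => //.
- exact: gf.
- by move=> p /HW; exact: fg.
- move=> p N Hp Np; have := iffLR (within_continuousP _ _) cg p N (HW _ Hp) Np.
  by apply: filterS => q h /HW; exact: h.
- move=> s sr; rewrite openE => y /= [p [p2 ps py]].
  have Wp : (W `&` @half_plane R) p by apply: HW; split => //; rewrite ltW// (lt_le_trans ps).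
  have Uy : U y by rewrite -py; apply: gWU; exists p.
  have fy : f y = p by rewrite -py fg.
  have : \forall z \near y, U z /\ `|f x - f z| < s.
    apply: filterI; first exact: open_nbhs_nbhs.
    have : \forall q \near f y, `|f x - q| < s.
      have : open_nbhs (f y) [set q | `|f x - q| < s].
        split; last by rewrite /= fy.
        have -> : [set q | `|f x - q| < s] = ball (f x) s by rewrite -ball_normE.
        exact: ball_open.
      exact: open_nbhs_nbhs.
    by move/(cfU _ Uy).
  apply: filterS => z [Uz fz]; exists (f z); split => //; last exact: gf.
  by have [] : (W `&` @half_plane R) (f z) by apply: fUW; exists z.
- move=> y [p [p2 ps py]]; apply: cfU; rewrite -py; apply: gWU; exists p => //.
  by apply: HW; split => //; exact: ltW.
Qed.

Definition chart_disc (f : S -> R * R) (g : R * R -> S) x r : set S :=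
  [set y | exists p, [/\ 0 <= p.2, `|f x - p| < r & g p = y]].

Variables (x : S) (f : S -> R * R) (g : R * R -> S) (r : R).
Hypothesis dc : disc_chart x f g r.

Lemma chart_discP y r' : r' <= r -> chart_disc f g x r' y ->
  [/\ g (f y) = y, half_disc (f x) r (f y) & `|f x - f y| < r'].
Proof.
move=> rr [p [p2 pr <-]].
have Hp : half_disc (f x) r p by split => //; rewrite ltW// (lt_le_trans pr).
by rewrite (dc_fg dc Hp).
Qed.

Lemma chart_disc_center r' : 0 < r' -> chart_disc f g x r' x.
Proof. by move=> r0; exists (f x); split; [exact: (dc_ge0 dc)|rewrite subrr normr0|exact: (dc_gx dc)]. Qed.

Lemma chart_disc_connected r' : r' <= r -> connected (chart_disc f g x r').
Proof.
move=> rr.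
have -> : chart_disc f g x r' = g @` [set p | 0 <= p.2 /\ `|f x - p| < r'].
  apply/seteqP; split => y; first by move=> [p [? ? ?]]; exists p.
  by move=> [p [? ?] ?]; exists p.
apply: connected_continuous_connected.
  apply: convex_connected; apply: (@convex_subset_ball _ _ [set p : R * R | 0 <= p.2]).
  move=> a b t /= a2 b2 /andP[t0 t1].
  have -> : a.2 + t * (b.2 - a.2) = (1 - t) * a.2 + t * b.2 by lra.
  by rewrite addr_ge0// mulr_ge0// subr_ge0.
apply/within_continuousP => p N [p2 pr] Np.
have Hp q : 0 <= q.2 /\ `|f x - q| < r' -> half_disc (f x) r q.
  by move=> [q2 qr]; split => //; rewrite ltW// (lt_le_trans qr).
have := dc_g dc (Hp _ (conj p2 pr)) Np.
by apply: filterS => q h /Hp; exact: h.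
Qed.

Lemma chart_disc_small N : nbhs x N -> exists2 r', 0 < r' <= r & chart_disc f g x r' `<=` N.
Proof.
move=> Nx; have r0 := dc_r dc.
have Hx : half_disc (f x) r (f x) by split; [exact: (dc_ge0 dc)|rewrite subrr normr0 ltW].
have := dc_g dc Hx; rewrite (dc_gx dc) => /(_ _ Nx)/nbhs_ballP[e /= e0 h].
exists (Num.min e r); first by rewrite lt_min e0 r0 ge_min lexx orbT.
move=> y [p [p2 + <-]]; rewrite lt_min => /andP[pe pr]; apply: h; last by split => //; exact: ltW.
by rewrite -ball_normE.
Qed.

End Charts.

Lemma surface_locally_connected (R : realType) (S : topologicalType) (x : S) N :
  surface R S -> nbhs x N ->
  exists C, [/\ open C, C x, connected C & C `<=` N].
Proof.
move=> [_ /(_ x)/disc_chart_exists[f [g [r dc]]]] Nx.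
have [r' /andP[r'0 rr] h] := chart_disc_small dc Nx.
exists (chart_disc f g x r'); split => //; first exact: dc_open dc _ rr.
  exact: (chart_disc_center dc).
exact: chart_disc_connected dc _ rr.
Qed.

(** * Finiteness of the first cohomology of a compact surface *)

Section Finiteness.
Variables (R : realType) (S : topologicalType).
Hypotheses (hS : surface R S) (hcpt : compact [set: S]).

(** The torsor is pulled back along [g] to the half-disc, where a potential exists by convexity, and
    this potential is carried back by [f]. *)
Lemma chart_potential (x : S) f g (r : R) F : disc_chart x f g r ->
  torsor_on setT F -> exists phi, potential_on (chart_disc f g x r) F phi.
Proof.
move=> dc [Fcov Fcomp].
pose G : set (set (R * R) * (R * R -> bool)) := [set (g @^-1` c.1, c.2 \o g) | c in F].
have r0 := dc_r dc.
have Hx : half_disc (f x) r (f x) by split; [exact: (dc_ge0 dc)|rewrite subrr normr0 ltW].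
have [||phi phiP] := convex_torsor_potential (half_disc_compact (c := f x) (r := r)) _ Hx (F := G).
- exact: half_disc_convex.
- split.
    move=> a Ha; have [c [Fc ca cb]] := Fcov (g a) Logic.I.
    exists (g @^-1` c.1, c.2 \o g); split => //; first by exists c.
    have : nbhs (g a) c.1 by apply: filterS cb => b; exact.
    exact: (dc_g dc Ha).
  move=> _ _ a [c Fc <-] [c' Fc' <-] Ha /= ca c'a.
  have cb := Fcomp c c' (g a) Fc Fc' Logic.I ca c'a.
  have {}cb : \forall b \near g a, c.2 b (+) c'.2 b = c.2 (g a) (+) c'.2 (g a).
    by apply: filterS cb => b; exact.
  exact: (dc_g dc Ha cb).
exists (phi \o f) => c a Fc Da ca /=.
have [ga Ha _] := chart_discP dc (lexx r) Da.
have : potential_on (half_disc (f x) r) G phi by [].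
move=> /(_ (g @^-1` c.1, c.2 \o g) (f a)) /=; rewrite ga => h.
have {}h : \forall b \near f a, half_disc (f x) r b ->
    phi b (+) c.2 (g b) = phi (f a) (+) c.2 a by apply: h => //; exists c.
have {}h : \forall b \near a, half_disc (f x) r (f b) ->
    phi (f b) (+) c.2 (g (f b)) = phi (f a) (+) c.2 a := dc_f dc Da h.
apply: filterS h => b h Db.
have [gb Hb _] := chart_discP dc (lexx r) Db.
by rewrite -h// gb.
Qed.

Lemma infinite_pigeonhole (T : finType) (h : nat -> T) :
  exists k l, (k < l)%N /\ h k = h l.
Proof.
have : ~ injective (fun i : 'I_#|T|.+1 => h i).
  by move=> /leq_card; rewrite card_ord ltnn.
move=> /existsNP[i /existsNP[j /not_implyP[hij ij]]].
have [lij|lji|/val_inj//] := ltngtP i j; first by exists i, j.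
by exists j, i.
Qed.

(* This is finiteness of H^1(S; Z/2): the torsors F k and F l are isomorphic. *)
Lemma torsor_finiteness (F : nat -> set (set S * (S -> bool))) :
  (forall n, torsor_on setT (F n)) ->
  exists k l Phi, (k < l)%N /\ forall c c' a, F k c -> F l c' -> c.1 a -> c'.1 a ->
    \forall b \near a, Phi b (+) c.2 b (+) c'.2 b = Phi a (+) c.2 a (+) c'.2 a.
Proof.
move=> torF; have [hT hch] := hS.
have /choice[f /choice[g /choice[r dc]]] : forall x : S, exists f g r, disc_chart x f g (r : R).
  by move=> x; exact: disc_chart_exists.
pose D x := chart_disc (f x) (g x) x (r x).
pose D' x := chart_disc (f x) (g x) x (r x / 2).
have r20 x : 0 < r x / 2 by rewrite divr_gt0// (dc_r (dc x)).
have r2r x : r x / 2 <= r x by have := dc_r (dc x); lra.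
have oD x : open (D x) by exact: (dc_open (dc x)).
have oD' x : open (D' x) by exact: (dc_open (dc x)).
have clD' x : closure (D' x) `<=` D x.
  have cK : compact (g x @` half_disc (f x x) (r x / 2)).
    apply: continuous_compact; last exact: half_disc_compact.
    apply/within_continuousP => p N Hp Np.
    have HH q : half_disc (f x x) (r x / 2) q -> half_disc (f x x) (r x) q.
      by move=> [q2 qr]; split => //; rewrite (le_trans qr).
    have := dc_g (dc x) (HH _ Hp) Np.
    by apply: filterS => q h /HH; exact: h.
  have /closure_subset : D' x `<=` g x @` half_disc (f x x) (r x / 2).
    by move=> y [p [p2 pr <-]]; exists p => //; split => //; exact: ltW.
  rewrite -(iffLR (closure_id _) (compact_closed hT cK)) => h y /h[p [p2 pr] <-].
  exists p; split => //; rewrite (le_lt_trans pr)//; have := dc_r (dc x); lra.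
have [s sP] := finite_subcover hcpt (N := D') (fun x =>
  open_nbhs_nbhs (conj (oD' x) (chart_disc_center (dc x) (r20 x)))).
(* For each listed disc, [Q] lies inside the large disc or misses the small one. The discs relevant
   on [Q] thus contain all of [Q], and differences of their potentials are constant on the connected
   set [Q]. *)
have /choice[q qP] : forall y, exists Q, [/\ open Q, Q y, connected Q &
    forall x, x \in s -> Q `<=` D x \/ Q `&` D' x = set0].
  move=> y.
  have : nbhs y [set z | forall x, x \in s -> (D x y -> D x z) /\
      (~ closure (D' x) y -> ~ D' x z)].
    elim: s {sP} => [|x s IH]; first by apply: filterE => z x; rewrite in_nil.
    have H1 : nbhs y [set z | D x y -> D x z].
      have [Dxy|nDxy] := pselect (D x y); last by apply: filterE => z.
      by have := open_nbhs_nbhs (conj (oD x) Dxy); apply: filterS => z Dz.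
    have H2 : nbhs y [set z | ~ closure (D' x) y -> ~ D' x z].
      have [cy|ncy] := pselect (closure (D' x) y); first by apply: filterE => z.
      have : open_nbhs y (~` closure (D' x)).
        by split => //; apply: closed_openC; exact: closed_closure.
      move/open_nbhs_nbhs; apply: filterS => z nz _ D'z; apply: nz.
      exact: subset_closure.
    apply: filterS3 IH H1 H2 => z IH H1 H2 x'; rewrite in_cons => /orP[/eqP->//|x's].
    exact: IH.
  move=> /(surface_locally_connected hS)[Q [oQ Qy cQ QN]]; exists Q; split => // x xs.
  have [Dxy|nDxy] := pselect (D x y); first by left => z /QN/(_ x xs)[+ _]; exact.
  right; apply/seteqP; split => // z [/QN/(_ x xs)[_ h] D'z].
  by apply: h => // /clD'.
have [t tP] := finite_subcover hcpt (N := q) (fun y =>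
  let: And4 oq qy _ _ := qP y in open_nbhs_nbhs (conj oq qy)).
have /choice[phi phiP] : forall nx : nat * S, exists phi, potential_on (D nx.2) (F nx.1) phi.
  by move=> [n x]; apply: chart_potential (dc x) (torF n).
have phiphi n x x' y : (D x `&` D x') y ->
    \forall z \near y, phi (n, x) z (+) phi (n, x') z = phi (n, x) y (+) phi (n, x') y.
  move=> [Dy D'y]; have [c [Fc cy _]] := (torF n).1 y Logic.I.
  have := phiP (n, x) c y Fc Dy cy; have := phiP (n, x') c y Fc D'y cy.
  have := open_nbhs_nbhs (conj (oD x) Dy); have := open_nbhs_nbhs (conj (oD x') D'y).
  move=> n1 n2 n3 n4; near=> z.
  have Dz : D x z by near: z.
  have D'z : D x' z by near: z.
  have : phi (n, x) z (+) c.2 z = phi (n, x) y (+) c.2 y.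
    by move: Dz; near: z.
  have : phi (n, x') z (+) c.2 z = phi (n, x') y (+) c.2 y.
    by move: D'z; near: z.
  by case: (phi (n, x) z); case: (phi (n, x') z); case: (phi (n, x) y);
    case: (phi (n, x') y); case: (c.2 z); case: (c.2 y).
(* The transition cocycle of [F n] between the discs, sampled at the finitely many points of [t]:
   only finitely many tables exist. Entries at points outside one of the two discs are arbitrary
   bits, and are never consulted below. *)
pose kappa n : {ffun seq_sub t * (seq_sub s * seq_sub s) -> bool} :=
  [ffun u => phi (n, ssval u.2.1) (ssval u.1) (+) phi (n, ssval u.2.2) (ssval u.1)].
have [k [l [kl kE]]] := infinite_pigeonhole kappa.
have {}kE y x x' : y \in t -> x \in s -> x' \in s ->
    phi (k, x) y (+) phi (k, x') y = phi (l, x) y (+) phi (l, x') y.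
  move=> yt xs x's; move/ffunP: kE => /(_ (SeqSub yt, (SeqSub xs, SeqSub x's))).
  by rewrite !ffunE.
have /choice[i iP] : forall y, exists x, x \in s /\ D' x y.
  by move=> y; have [x xs Dx] := sP y; exists x.
(* The isomorphism is the difference of the two potentials in a disc around [y]. Equality of the two
   tables makes it independent of the disc on each [q y], as [PhiE] states. *)
pose Phi y := phi (k, i y) y (+) phi (l, i y) y.
have qconst n y x x' z : q y `<=` D x -> q y `<=` D x' -> q y z ->
    phi (n, x) z (+) phi (n, x') z = phi (n, x) y (+) phi (n, x') y.
  move=> qx qx' qz; have [oq qy cq _] := qP y.
  apply: (connected_locally_constant (f := fun z => phi (n, x) z (+) phi (n, x') z) cq) => //.
  move=> w qw; have : (D x `&` D x') w by split; [exact: qx|exact: qx'].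
  by move=> /(phiphi n); apply: filterS => u ->.
exists k, l, Phi; split => // c c' a Fc Fc' ca c'a.
have [y yt qya] := tP a; have [oq qy cq qD] := qP y.
have isub z : q y z -> q y `<=` D (i z).
  move=> qz; have [iz D'z] := iP z; have [//|q0] := qD _ iz.
  by have : (q y `&` D' (i z)) z by []; rewrite q0.
have PhiE z : q y z -> Phi z = phi (k, i a) z (+) phi (l, i a) z.
  move=> qz; rewrite /Phi.
  have ek := qconst k y (i z) (i a) z (isub _ qz) (isub _ qya) qz.
  have el := qconst l y (i z) (i a) z (isub _ qz) (isub _ qya) qz.
  have := kE y (i z) (i a) yt (iP z).1 (iP a).1; rewrite -ek -el.
  by case: (phi (k, i z) z); case: (phi (k, i a) z); case: (phi (l, i z) z); case: (phi (l, i a) z).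
have Da : D (i a) a by exact: (isub a qya).
have n1 := phiP (k, i a) c a Fc Da ca; have n2 := phiP (l, i a) c' a Fc' Da c'a.
have n3 := open_nbhs_nbhs (conj oq qya); near=> z.
have qz : q y z by near: z.
rewrite (PhiE _ qz) (PhiE _ qya).
have Dz : D (i a) z by exact: (isub a qya).
have : phi (k, i a) z (+) c.2 z = phi (k, i a) a (+) c.2 a by move: Dz; near: z.
have : phi (l, i a) z (+) c'.2 z = phi (l, i a) a (+) c'.2 a by move: Dz; near: z.
move: (phi (k, i a) z) (phi (l, i a) z) (phi (k, i a) a) (phi (l, i a) a).
by move: (c.2 z) (c'.2 z) (c.2 a) (c'.2 a); do 8! case.
Unshelve. all: by end_near. Qed.

End Finiteness.

(** * Local sections *)

Lemma antiderivative_exists (R : realType) (phi : R -> R) (M : R) : continuous phi ->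
  exists A : R -> R, forall t, - M < t < M -> is_derive t 1 A (phi t).
Proof.
move=> cphi.
pose A x := (\int[lebesgue_measure]_(t in `[- M, x]) phi t)%R.
exists A => t /andP[Mt tM].
have h := @continuous_FTC1_closed R phi (- M) t M tM _ Mt (cphi t).
have [|d1 d2] := h.
  apply: continuous_compact_integrable; first exact: segment_compact.
  exact: continuous_subspaceT.
apply: DeriveDef => //.
by rewrite -d2 derive1E.
Qed.

Lemma MVT_derive (R : realType) (f df : R -> R) (a b : R) : a <= b ->
  (forall x, a <= x <= b -> is_derive x 1 f (df x)) ->
  exists2 c, a <= c <= b & f b - f a = df c * (b - a).
Proof.
move=> ab h.
have [||c] := @MVT_segment R f df a b ab.
- by move=> x; rewrite in_itv /= => /andP[ax xb]; apply: h; rewrite !ltW.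
- apply: derivable_within_continuous => x; rewrite in_itv /= => xab.
  by have [] := h x xab.
by rewrite in_itv => cab ->; exists c.
Qed.

Section FlowBasics.
Variables (R : realType) (S : topologicalType) (v : R -> S -> S).
Hypothesis hv : flow v.

Lemma flow0 x : v 0 x = x. Proof. by case: hv. Qed.
Lemma flowD s t x : v (s + t) x = v s (v t x). Proof. by case: hv. Qed.
Lemma flowK t x : v (- t) (v t x) = x. Proof. by rewrite -flowD addNr flow0. Qed.
Lemma flowNK t x : v t (v (- t) x) = x. Proof. by rewrite -flowD subrr flow0. Qed.

Lemma flow_near2 t (x : S) (N : set S) : nbhs (v t x) N -> \forall s \near t & y \near x, N (v s y).
Proof.
have [cv _ _] := hv => Nx; have /(_ N Nx) := cv (t, x).
by move=> [[A B] /= [At Bx] h]; exists (A, B).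
Qed.

Lemma flow_near t (x : S) (N : set S) : nbhs (v t x) N -> \forall y \near x, N (v t y).
Proof.
move=> /flow_near2[[A B] /= [At Bx] h]; apply: filterS Bx => y By.
by apply: (h (t, y)); split => //; exact: nbhs_singleton.
Qed.

Lemma flow_near_time t (x : S) (N : set S) : nbhs (v t x) N -> \forall s \near t, N (v s x).
Proof.
move=> /flow_near2[[A B] /= [At Bx] h]; apply: filterS At => s As.
by apply: (h (s, x)); split => //; exact: nbhs_singleton.
Qed.

Lemma flow_tube (K : set R) (x : S) (N : R -> set S) : compact K ->
  (forall t, K t -> \forall s \near t & y \near x, N s y) ->
  \forall y \near x, forall t, K t -> N t y.
Proof.
move=> /compact_near_coveringP cK h.
have FF : Filter (nbhs x) by exact: nbhs_filter.
have := cK S (nbhs x) (fun y t => N t y) FF h.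
by apply: (@filterS _ (nbhs x)) => y hy t; exact: hy.
Qed.

Lemma flow_preimage_nbhs t (x : S) (N : set S) : nbhs x N -> nbhs (v t x) [set y | N (v (- t) y)].
Proof. by rewrite -{1}(flowK t x) => /flow_near. Qed.

Lemma open_flow_image t U : open U -> open [set v t y | y in U].
Proof.
move=> oU; rewrite openE => _ [y Uy <-].
have /(flow_preimage_nbhs t) := open_nbhs_nbhs (conj oU Uy).
by apply: filterS => z Uz; exists (v (- t) z) => //; rewrite flowNK.
Qed.

Lemma singular_ptPn x : ~ singular_pt v x -> exists2 T, 0 < T & v T x <> x.
Proof.
move=> /existsNP[t vt]; have [t0|t0|t0] := ltgtP t 0.
- exists (- t); first by rewrite oppr_gt0.
  by move=> e; apply: vt; rewrite -{1}e flowNK.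
- by exists t.
- by rewrite t0 flow0 in vt.
Qed.

End FlowBasics.

Section MonotoneFunction.
Variables (R : realType) (S : topologicalType) (v : R -> S -> S).
Hypotheses (hv : flow v) (hT : hausdorff_space S) (hcpt : compact [set: S]).

(* The average of a function over a piece of orbit of length T increases along
   the flow wherever the function is larger at v T y than at y. *)
Lemma monotone_along_flow x : ~ singular_pt v x ->
  exists F : S -> R, continuous F /\
  exists2 d : R, 0 < d & \forall y \near x, forall s t, - d <= s -> s < t -> t <= d ->
    F (v s y) < F (v t y).
Proof.
move=> /(singular_ptPn hv)[T T0 vT].
have [g [cg gx gT]] : exists g : S -> R, [/\ continuous g, g x = 0 & g (v T x) = 1].
  have c1 y : closed [set y : S] by apply: accessible_closed_set1; exact: hausdorff_accessible.
  have d1 : [set x] `&` [set v T x] = set0 by apply/seteqP; split => // y [/= -> /esym].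
  have := @normal_uniform_separator S (compact_normal hT hcpt) _ _ (c1 x) (c1 (v T x)) d1.
  move=> /(@uniform_separatorP _ R)[g [cg _ g0 g1]]; exists g; split => //.
    by apply: g0; exists x.
  by apply: g1; exists (v T x).
have cphi y : continuous (fun s => g (v s y)).
  move=> s N /(cg _); exact: (flow_near_time hv).
(* Times in [[0, T]] shifted by less than 1 are used below; [T + 2] leaves room for them. *)
have /choice[A AP] := fun y => antiderivative_exists (T + 2) (cphi y).
have dAs y t s : - (T + 2) < s + t < T + 2 ->
    is_derive s 1 (A y \o shift t) (g (v (s + t) y)).
  move=> h; rewrite -[g _]mulr1; apply: is_derive1_comp; first exact: AP.
  exact: is_derive_shift.
pose F (y : S) : R := A y T - A y 0.
(* Both sides are the integral of [g] over the piece of orbit from time [t] to time [T + t]: the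
   antiderivative at [v t y] and the shifted one at [y] have the same derivative. *)
have FE (y : S) (t : R) : -1 < t < 1 -> F (v t y) = A y (T + t) - A y t.
  move=> /andP[t1 t2].
  have [||c _] := @MVT_derive R (A (v t y) - (A y \o shift t)) (fun=> 0) 0 T.
  - exact: ltW.
  - move=> s /andP[s0 sT].
    have d1 : is_derive s 1 (A (v t y)) (g (v s (v t y))) by apply: AP; lra.
    have d2 : is_derive s 1 (A y \o shift t) (g (v (s + t) y)) by apply: dAs; lra.
    by have := is_deriveB d1 d2; rewrite (flowD hv) subrr.
  have E s : (A (v t y) - (A y \o shift t)) s = A (v t y) s - A y (s + t) by [].
  by rewrite mul0r !E add0r /F; lra.
exists F; split.
  move=> y0; apply/cvgrPdist_lt => e e0.
  have eT : 0 < e / (T + 1) by rewrite divr_gt0// addr_gt0.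
  have : \forall y \near y0, forall s, `[0, T]%classic s ->
      `|g (v s y0) - g (v s y)| < e / (T + 1).
    apply: flow_tube; first exact: segment_compact.
    move=> t _.
    have : nbhs (v t y0) [set z | `|g (v t y0) - g z| < e / (T + 1) / 2].
      by have /cvgrPdist_lt := cg (v t y0); apply; rewrite divr_gt0.
    move=> /[dup]/(flow_near2 hv)[[A1 B1] /= [A1t B1x] h1] /(flow_near_time hv) h2.
    exists (A1 `&` [set s | `|g (v t y0) - g (v s y0)| < e / (T + 1) / 2], B1) => /=.
      by split => //; exact: filterI.
    move=> [s y] /= [[A1s h3] B1y]; have h4 := h1 (s, y) (conj A1s B1y).
    rewrite (le_lt_trans (ler_distD (g (v t y0)) _ _))// [ltRHS]splitr ltrD//.
    by rewrite distrC.
  apply: filterS => y hy.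
  have [||c /andP[c0 cT]] := @MVT_derive R (A y0 - A y) (fun s => g (v s y0) - g (v s y)) 0 T.
  - exact: ltW.
  - by move=> s /andP[s0 sT]; apply: is_deriveB; apply: AP; lra.
  rewrite subr0 => hc.
  have -> : F y0 - F y = (A y0 - A y) T - (A y0 - A y) 0.
    have E s : (A y0 - A y) s = A y0 s - A y s by [].
    by rewrite !E /F; lra.
  rewrite hc normrM (gtr0_norm T0).
  apply: (@le_lt_trans _ _ (e / (T + 1) * T)).
    by rewrite ler_pM2r// ltW// hy//= in_itv /= c0.
  by rewrite mulrAC ltr_pdivrMr ?addr_gt0// ltr_pM2l// ltrDl.
have : \forall s \near (0 : R) & y \near x, g (v s y) < 1 / 2.
  apply: (@flow_near2 _ _ _ hv 0 x [set z | g z < 1 / 2]).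
  rewrite (flow0 hv); have /cvgrPdist_lt /(_ (1 / 2) ltac:(lra)) := cg x.
  by apply: filterS => z; rewrite gx ltr_norml /=; lra.
move=> [[A1 B1] /= [A1t B1x] h1].
have : \forall s \near T & y \near x, 1 / 2 < g (v s y).
  apply: (@flow_near2 _ _ _ hv T x [set z | 1 / 2 < g z]).
  have /cvgrPdist_lt /(_ (1 / 2) ltac:(lra)) := cg (v T x).
  by apply: filterS => z; rewrite gT ltr_norml /=; lra.
move=> [[A2 B2] /= [A2t B2x] h2].
move: A1t A2t => /nbhs_ballP[r1 /= r10 hr1] /nbhs_ballP[r2 /= r20 hr2].
pose d := Num.min (1 / 2) (Num.min (r1 / 2) (r2 / 2)).
have [d0 [d1 [dr1 dr2]]] : 0 < d /\ d < 1 /\ d < r1 /\ d < r2.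
  rewrite /d !lt_min !gt_min; split; first by rewrite !divr_gt0.
  by split; [|split]; apply/orP; [left|right; apply/orP; left|right; apply/orP; right]; lra.
exists d => //; apply: filterS2 B1x B2x => y B1y B2y s t ds st td.
have [||c /andP[cs ct]] := @MVT_derive R ((A y \o shift T) - A y)
  (fun s => g (v (s + T) y) - g (v s y)) s t.
- exact: ltW.
- move=> r /andP[rs rt]; apply: is_deriveB; first by apply: dAs; lra.
  by apply: AP; lra.
have e1 r : s <= r <= t -> F (v r y) = ((A y \o shift T) - A y) r.
  by move=> hr; rewrite FE ?[T + r]addrC; last lra.
rewrite -!e1 ?lexx ?(ltW st)// => hc.
rewrite -subr_gt0 hc mulr_gt0 ?subr_gt0//.
have : g (v c y) < 1 / 2.
  by apply: (h1 (c, y)); split => //; apply: hr1; rewrite -ball_normE /= sub0r normrN ltr_norml; lra.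
have : 1 / 2 < g (v (c + T) y).
  apply: (h2 (c + T, y)); split => //; apply: hr2; rewrite -ball_normE /= opprD addrCA subrr addr0.
  by rewrite normrN ltr_norml; lra.
by lra.
Qed.

End MonotoneFunction.

(** * Local sections as level sets *)

Section LocalSections.
Variables (R : realType) (S : topologicalType) (v : R -> S -> S).
Hypotheses (hv : flow v) (hS : surface R S) (hcpt : compact [set: S]).
Let hT : hausdorff_space S := hS.1.

Definition flow_box (Z U : set S) (e : R) : set S :=
  [set b | exists u t, [/\ Z u, U u, `|t| < e & v t u = b]].

(** [ls_open], stated for all open [U] and all small heights, says that the coordinates of the flow
    box (point of the section, time) are continuous. *)
Record local_section (x : S) (Z : set S) (d : R) : Prop := LocalSection {
  ls_x : Z x;
  ls_connected : connected Z;
  ls_d : 0 < d;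
  ls_inj : forall u w t, Z u -> Z w -> `|t| < 2 * d -> v t w = u -> t = 0;
  ls_open : forall U e, open U -> 0 < e <= d -> open (flow_box Z U e) }.

Lemma closure_sub_open (x : S) (N : set S) : nbhs x N ->
  exists C, [/\ open C, C x, connected C & closure C `<=` N].
Proof.
move=> Nx.
have [V Vx VN] := compact_regular hT hcpt (@filterT _ (nbhs x) _) Nx.
have [C [oC Cx cC CV]] := surface_locally_connected hS Vx.
by exists C; split => //; apply: subset_trans VN; exact: closure_subset.
Qed.

(** The section is the image of a connected neighbourhood of [x] pushed along the flow onto the
    level of [F] through [x]. The height [d] comes before [M] because the chart conditions later put
    into [M] involve [d]. The nested pair serves to order limit points: they leave [Z1] but stay in
    [Z2]. *)
Lemma local_section_exists x (e0 : R) : ~ singular_pt v x -> 0 < e0 ->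
  exists2 d, 0 < d <= e0 & forall M : set S, nbhs x M -> exists Z1 Z2,
    [/\ local_section x Z1 d, local_section x Z2 d, Z1 `<=` Z2, Z2 `<=` M & closure Z1 `<=` Z2].
Proof.
move=> nsx e00.
have [F [cF [d1 d10 Fmon]]] := monotone_along_flow hv hT hcpt nsx.
(* A hitting time below [d] added to a time below [2 * d] stays within [d1], where [F] increases
   along the flow. *)
pose d := Num.min (d1 / 4) e0.
have d0 : 0 < d by rewrite lt_min e00 divr_gt0.
have dd1 : 4 * d <= d1.
  have : d <= d1 / 4 by rewrite ge_min lexx.
  by lra.
exists d; first by rewrite d0 ge_min lexx orbT.
move=> M Mx; pose c := F x.
have [e [e1 ed Me]] : exists e, [/\ 0 < e, e <= d &
    \forall y \near x, forall t, `|t| <= e -> M (v t y)].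
  have : nbhs (v 0 x) M by rewrite (flow0 hv).
  move=> /(flow_near2 hv)[[A B] /= [/nbhs_ballP[r /= r0 hr] Bx] h].
  exists (Num.min d (r / 2)); split; first by rewrite lt_min d0 divr_gt0.
    by rewrite ge_min lexx.
  apply: filterS Bx => y By t; rewrite le_min => /andP[_ tr].
  by apply: (h (t, y)); split => //; apply: hr; rewrite -ball_normE /= sub0r normrN; lra.
have Fe : \forall y \near x, F (v (- e) y) < c < F (v e y).
  have [h1 h2] : F (v (- e) x) < c /\ c < F (v e x).
    have := nbhs_singleton Fmon; rewrite /c => h; split.
      by rewrite -{2}(flow0 hv x); apply: h; lra.
    by rewrite -{1}(flow0 hv x); apply: h; lra.
  have n1 : \forall y \near x, F (v (- e) y) < c.
    apply: (@flow_near _ _ _ hv (- e) x [set z | F z < c]).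
    by have /cvgr_lt := cF (v (- e) x); apply.
  have n2 : \forall y \near x, c < F (v e y).
    apply: (@flow_near _ _ _ hv e x [set z | c < F z]).
    by have /cvgr_gt := cF (v e x); apply.
  by apply: filterS2 n1 n2 => y -> ->.
have [C2 [oC2 C2x cC2 C2N]] := surface_locally_connected hS (filterI Fmon (filterI Me Fe)).
have /choice[tau tauP] : forall y, exists t, C2 y -> `|t| < e /\ F (v t y) = c.
  move=> y; have [Cy|nCy] := pselect (C2 y); last by exists 0.
  have [h1 [h2 /andP[h3 h4]]] := C2N y Cy.
  have [|||t] := @IVT R (fun t => F (v t y)) (- e) e c.
  - by lra.
  - apply: continuous_subspaceT => t N /(cF _); exact: (flow_near_time hv).
  - by rewrite ge_min le_max (ltW h3) (ltW h4) orbT.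
  rewrite in_itv /= => /andP[t1 t2] Ft; exists t => _; split => //.
  rewrite ltr_norml !lt_neqAle t1 t2 !andbT; apply/andP; split; apply/eqP.
    by move=> te; rewrite -te in Ft; lra.
  by move=> te; rewrite te in Ft; lra.
have tau_uniq y s t : C2 y -> `|s| <= d1 -> `|t| <= d1 -> F (v s y) = F (v t y) -> s = t.
  move=> /C2N[h _]; rewrite !ler_norml => /andP[s1 s2] /andP[t1 t2] E.
  have [st|ts|//] := ltgtP s t.
    by have := h s t s1 st t2; rewrite E ltxx.
  by have := h t s t1 ts s2; rewrite E ltxx.
(* [F] is below [c] just before the hitting time and above it just after. Both inequalities persist
   at nearby points and enclose their hitting times. *)
have tau_cont y : C2 y -> tau @ y --> tau y.
  move=> Cy; apply/cvgrPdist_lt => r r0.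
  have [te Ft] := tauP y Cy; move: te; rewrite ltr_norml => /andP[te1 te2].
  pose q := Num.min r d; have q0 : 0 < q by rewrite lt_min r0.
  have qr : q <= r by rewrite ge_min lexx.
  have qd : q <= d by rewrite ge_min lexx orbT.
  have [mon _] := C2N y Cy.
  have n1 : \forall z \near y, F (v (tau y - q) z) < c.
    apply: (@flow_near _ _ _ hv _ y [set z | F z < c]).
    have /cvgr_lt := cF (v (tau y - q) y); apply.
    by rewrite -Ft; apply: mon; lra.
  have n2 : \forall z \near y, c < F (v (tau y + q) z).
    apply: (@flow_near _ _ _ hv _ y [set z | c < F z]).
    have /cvgr_gt := cF (v (tau y + q) y); apply.
    by rewrite -Ft; apply: mon; lra.
  have n3 := open_nbhs_nbhs (conj oC2 Cy).
  apply: filterS3 n1 n2 n3 => z z1 z2 Cz.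
  have [tez Ftz] := tauP z Cz; move: tez; rewrite ltr_norml => /andP[tez1 tez2].
  have [monz _] := C2N z Cz.
  have a1 : tau y - q < tau z.
    rewrite ltNge le_eqVlt; apply/negP => /orP[/eqP E|L].
      by rewrite E in Ftz; lra.
    by have := monz _ _ _ L _; rewrite Ftz => /(_ ltac:(lra) ltac:(lra)); lra.
  have a2 : tau z < tau y + q.
    rewrite ltNge le_eqVlt; apply/negP => /orP[/eqP E|L].
      by rewrite -E in Ftz; lra.
    by have := monz _ _ _ L _; rewrite Ftz => /(_ ltac:(lra) ltac:(lra)); lra.
  by rewrite ltr_norml; lra.
pose pi y := v (tau y) y.
have pi_cont y : C2 y -> pi @ y --> pi y.
  move=> Cy N /(flow_near2 hv)[[A B] /= [At By] h].
  have h' : \forall z \near y, A (tau z) := tau_cont y Cy A At.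
  by apply: filterS2 By h' => z Bz Az; exact: (h (tau z, z)).
have taux : tau x = 0.
  have [te Ft] := tauP x C2x; apply: (tau_uniq x) => //; rewrite ?normr0 ?(ltW d10)//.
    by rewrite ltW// (lt_le_trans te)//; lra.
  by rewrite Ft (flow0 hv).
have sec (C : set S) : open C -> connected C -> C x -> C `<=` C2 -> local_section x (pi @` C) d.
  move=> oC cC Cx CC2; split => //.
  - by exists x => //; rewrite /pi taux (flow0 hv).
  - apply: connected_continuous_connected => //; apply/within_continuousP => y N Cy Ny.
    have h : \forall z \near y, N (pi z) := pi_cont y (CC2 _ Cy) N Ny.
    by apply: filterS h => z Nz _.
  - move=> _ _ t [m Cm <-] [n Cn <-] td E.
    have [te Ft] := tauP n (CC2 _ Cn); have [tem Ftm] := tauP m (CC2 _ Cm).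
    have : t + tau n = tau n.
      apply: (tau_uniq n (t + tau n)); [exact: CC2| | |].
      - by rewrite (le_trans (ler_normD _ _))//; lra.
      - by lra.
      - by rewrite (flowD hv) -/(pi n) E Ft.
    by lra.
  - move=> U r oU /andP[r0 rd]; rewrite openE => _ [_ [t [[n Cn <-] Un tr <-]]].
    pose q := t + tau n.
    have Cn2 := CC2 _ Cn.
    have n1 : \forall n' \near n, C n' by exact: open_nbhs_nbhs.
    have n2 : \forall n' \near n, U (pi n').
      by have /(pi_cont n Cn2) := open_nbhs_nbhs (conj oU Un).
    have n3 : \forall n' \near n, `|q - tau n'| < r.
      have /cvgrPdist_lt /(_ (r - `|t|)) := tau_cont n Cn2.
      rewrite subr_gt0 => /(_ tr); rewrite /= => h.
      apply: filterS h => n' h; rewrite /q -addrA (le_lt_trans (ler_normD _ _))//; lra.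
    have n5 : \forall n' \near n, C n' /\ U (pi n') /\ `|q - tau n'| < r.
      by apply: filterI => //; exact: filterI.
    have n4 := flow_preimage_nbhs hv q n5.
    have bE : v t (pi n) = v q n by rewrite /pi -(flowD hv).
    have sub : [set b | C (v (- q) b) /\ U (pi (v (- q) b)) /\
        `|q - tau (v (- q) b)| < r] `<=` flow_box (pi @` C) U r.
      move=> b [b1 [b2 b3]].
      exists (pi (v (- q) b)), (q - tau (v (- q) b)); split; [|exact: b2|exact: b3|]; first by exists (v (- q) b).
      by rewrite /pi -!(flowD hv) subrK subrr (flow0 hv).
    by rewrite bE; exact: (filterS sub n4).
have [C1 [oC1 C1x cC1 C12]] := closure_sub_open (open_nbhs_nbhs (conj oC2 C2x)).
have C12' : C1 `<=` C2 := subset_trans (@subset_closure _ C1) C12.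
exists (pi @` C1), (pi @` C2); split.
- exact: sec.
- exact: sec.
- by move=> _ [y Cy <-]; exists y => //; exact: C12'.
- move=> _ [y Cy <-]; have [_ [h _]] := C2N y Cy; apply: h.
  by have [/ltW] := tauP y Cy.
- have cK : compact (pi @` closure C1).
    apply: continuous_compact.
      apply/within_continuousP => y N Cy Ny.
      have h : \forall z \near y, N (pi z) := pi_cont y (C12 _ Cy) N Ny.
      by apply: filterS h => z Nz _.
    by apply: (subclosed_compact _ hcpt) => //; exact: closed_closure.
  apply: (@subset_trans _ (pi @` closure C1)); last by move=> _ [y Cy <-]; exists y => //; exact: C12.
  rewrite [X in _ `<=` X](iffLR (closure_id _) (compact_closed hT cK)).
  by apply: closure_subset => _ [y Cy <-]; exists y => //; exact: subset_closure.
Qed.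

End LocalSections.

(** * The order of a section *)

Section Crossing.
Variable R : realType.

(* The pullback, along (l, m), of the double cover of the punctured plane,
   trivialised off the ray l = 0 < m. *)
Definition crossing (T : Type) (l m : T -> R) : set (set T * (T -> bool)) :=
  [set c | c = ([set a | 0 < m a], fun a => 0 < l a) \/
           c = ([set a | l a != 0 \/ m a < 0], fun=> false)].

Lemma crossing_torsor (T : topologicalType) (A : set T) (l m : T -> R) :
  {within A, continuous l} -> {within A, continuous m} ->
  (forall a, A a -> l a != 0 \/ m a != 0) -> torsor_on A (crossing l m).
Proof.
move=> /within_continuousP cl /within_continuousP cm lm0.
have lpos a : A a -> 0 < l a -> \forall b \near a, A b -> 0 < l b.
  by move=> Aa la; apply: (cl a [set x | 0 < x]) => //; exact: lt_nbhsr.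
have lneg a : A a -> l a < 0 -> \forall b \near a, A b -> l b < 0.
  by move=> Aa la; apply: (cl a [set x | x < 0]) => //; exact: lt_nbhsl.
have mpos a : A a -> 0 < m a -> \forall b \near a, A b -> 0 < m b.
  by move=> Aa la; apply: (cm a [set x | 0 < x]) => //; exact: lt_nbhsr.
have mneg a : A a -> m a < 0 -> \forall b \near a, A b -> m b < 0.
  by move=> Aa la; apply: (cm a [set x | x < 0]) => //; exact: lt_nbhsl.
have lsg a : A a -> l a != 0 -> \forall b \near a, A b -> (0 < l b) = (0 < l a) /\ l b != 0.
  move=> Aa; rewrite neq_lt => /orP[la|la].
    have := lneg a Aa la; apply: filterS => b h /h lb.
    by rewrite !ltNge !ltW// lt_eqF.
  by have := lpos a Aa la; apply: filterS => b h /h lb; rewrite la lb gt_eqF.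
split.
  move=> a Aa; have [ma|ma] := ltP 0 (m a).
    exists ([set a | 0 < m a], fun a => 0 < l a); split => //; first by left.
    exact: mpos.
  exists ([set a | l a != 0 \/ m a < 0], fun=> false); split => //=; first by right.
    case: (lm0 a Aa); first by left.
    by right; rewrite lt_neqAle b.
  have [la|la] := eqVneq (l a) 0; last first.
    by have := lsg a Aa la; apply: filterS => b h /h[]; left.
  have : m a < 0 by case: (lm0 a Aa); rewrite ?la ?eqxx// lt_neqAle ma => ->.
  by move=> /(mneg a Aa); apply: filterS => b h /h; right.
have mixed a : A a -> 0 < m a -> l a != 0 \/ m a < 0 ->
    \forall b \near a, A b -> (0 < l b) = (0 < l a).
  move=> Aa ma [la|]; last by rewrite ltNge (ltW ma).
  by have := lsg a Aa la; apply: filterS => b h /h[].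
move=> c c' a [->|->] [->|->] Aa /= ca c'a.
- by apply: filterE => b _; rewrite !addbb.
- by have := mixed a Aa ca c'a; apply: filterS => b h /h ->.
- by have := mixed a Aa c'a ca; apply: filterS => b h /h ->.
- by apply: filterE.
Qed.

(** The monodromy of the pulled-back double cover from [- d] to [d]. It is a parity of crossings
    that makes sense for any continuous curve avoiding the origin, even one meeting the ray
    infinitely often. *)
Definition crosses (l m : R -> R) (d : R) (b : bool) : Prop :=
  exists phi : R -> bool, potential_on (`[- d, d]%classic : set R) (crossing l m) phi /\ phi d (+) phi (- d) = b.

Lemma crosses_uniq (l m : R -> R) (d : R) b b' : 0 < d ->
  {within `[- d, d], continuous l} -> {within `[- d, d], continuous m} ->
  (forall a : R, - d <= a <= d -> l a != 0 \/ m a != 0) ->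
  crosses l m d b -> crosses l m d b' -> b = b'.
Proof.
move=> d0 cl cm lm0 [phi [pphi <-]] [phi' [pphi' <-]].
have [cov _] := crossing_torsor cl cm (fun a h => lm0 a ltac:(by move: h; rewrite /= in_itv)).
have h : phi d (+) phi' d = phi (- d) (+) phi' (- d).
  apply: (connected_locally_constant (@segment_connected R (- d) d) (f := fun t => phi t (+) phi' t)).
  - move=> t tI; have [c [cc ct cb]] := cov t tI.
    have := pphi c t cc tI ct; have := pphi' c t cc tI ct.
    apply: filterS2 => s h' h sI; move: (h sI) (h' sI).
    by case: (phi t); case: (phi s); case: (phi' t); case: (phi' s); case: (c.2 s); case: (c.2 t).
  - by rewrite /= in_itv /=; lra.
  - by rewrite /= in_itv /=; lra.
by move: h; case: (phi d); case: (phi' d); case: (phi (- d)); case: (phi' (- d)).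
Qed.

(* Reversing time and taking opposites exchanges the two rays l = 0. *)
Lemma crosses_flip (l m : R -> R) (d : R) b : 0 < d ->
  {within `[- d, d], continuous l} -> {within `[- d, d], continuous m} ->
  (forall a : R, - d <= a <= d -> l a != 0 \/ m a != 0) -> 0 < l d -> l (- d) < 0 ->
  crosses l m d b -> crosses (fun t => - l (- t)) (fun t => - m (- t)) d (~~ b).
Proof.
move=> d0 cl cm lm0 ld lNd [phi [pphi pb]].
pose I : set R := `[- d, d]%classic.
(* Passing from the ray [l = 0 < m] to the opposite one changes the potential by [up], which equals
   [0 < l] where [m] is positive and [0 <= l] where [m] is negative. Its values at [- d] and [d]
   differ, whence the negation. *)
pose up t := (0 < l t) || ((l t == 0) && (m t < 0)).
exists (fun t => phi (- t) (+) up (- t)); split; last first.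
  rewrite opprK /up ld (lt_gtF lNd) (lt_eqF lNd) /= -pb.
  by case: (phi d); case: (phi (- d)).
have NI t : I t -> I (- t) by rewrite /I /= !in_itv /=; lra.
have nearN (t : R) (P : set R) : (\forall s \near - t, P s) -> \forall s \near t, P (- s).
  by move=> h; have /(_ P h) := @opp_continuous R t.
have [/within_continuousP cl' /within_continuousP cm'] := (cl, cm).
move=> c t [->|->] tI /= ct.
- have mt : m (- t) < 0 by rewrite -oppr_gt0.
  have h1 := pphi ([set a | l a != 0 \/ m a < 0], fun=> false) (- t) (or_intror erefl) (NI _ tI) (or_intror mt).
  have h2 : \forall s \near - t, I s -> m s < 0 by apply: (cm' _ [set x | x < 0]) (NI _ tI) _; exact: lt_nbhsl.
  apply: filterS2 (nearN _ _ h1) (nearN _ _ h2) => s h1s h2s sI.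
  move: (h1s (NI _ sI)); rewrite /= !addbF => ->.
  rewrite /up mt (h2s (NI _ sI)) !oppr_gt0 !andbT.
  by case: (ltgtP (l (- s)) 0); case: (ltgtP (l (- t)) 0); case: (phi (- t)).
- have [mt|mt] := ltP 0 (m (- t)).
    have h1 := pphi ([set a | 0 < m a], fun a => 0 < l a) (- t) (or_introl erefl) (NI _ tI) mt.
    have h2 : \forall s \near - t, I s -> 0 < m s by apply: (cm' _ [set x | 0 < x]) (NI _ tI) _; exact: lt_nbhsr.
    apply: filterS2 (nearN _ _ h1) (nearN _ _ h2) => s h1s h2s sI.
    move: (h1s (NI _ sI)); rewrite /= !addbF /up (lt_gtF mt) (lt_gtF (h2s (NI _ sI))) !andbF !orbF.
    by [].
  have lt0 : l (- t) != 0 by case: ct; [rewrite oppr_eq0|rewrite oppr_lt0 ltNge mt].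
  have h1 := pphi ([set a | l a != 0 \/ m a < 0], fun=> false) (- t) (or_intror erefl) (NI _ tI) (or_introl lt0).
  have h2 : \forall s \near - t, I s -> up s = up (- t).
    move: lt0; rewrite neq_lt => /orP[l0|l0].
      have : \forall s \near - t, I s -> l s < 0 by apply: (cl' _ [set x | x < 0]) (NI _ tI) _; exact: lt_nbhsl.
      by apply: filterS => s h /h ls; rewrite /up (lt_gtF ls) (lt_eqF ls) (lt_gtF l0) (lt_eqF l0).
    have : \forall s \near - t, I s -> 0 < l s by apply: (cl' _ [set x | 0 < x]) (NI _ tI) _; exact: lt_nbhsr.
    by apply: filterS => s h /h ls; rewrite /up ls l0.
  apply: filterS2 (nearN _ _ h1) (nearN _ _ h2) => s h1s h2s sI.
  by move: (h1s (NI _ sI)); rewrite /= !addbF (h2s (NI _ sI)) => ->.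
Qed.

End Crossing.

(** * Linear orders on connected sets *)

Section OrderedSets.
Variable T : topologicalType.

(* Transitivity is automatic when Z is connected, see [preordered_trans]. *)
Record preordered_set (Z : set T) (lt : T -> T -> Prop) : Prop := PreorderedSet {
  po_total : forall u w, Z u -> Z w -> u <> w -> lt u w \/ lt w u;
  po_asym : forall u w, Z u -> Z w -> lt u w -> ~ lt w u;
  po_nearl : forall u w, Z u -> Z w -> lt u w -> \forall u' \near u, Z u' -> lt u' w;
  po_nearr : forall u w, Z u -> Z w -> lt u w -> \forall w' \near w, Z w' -> lt u w' }.

End OrderedSets.

Section OrderedSetTheory.
Variable T : topologicalType.
Implicit Types (Z : set T) (lt : T -> T -> Prop).

Definition flip_rel lt : T -> T -> Prop := fun u w => lt w u.

Lemma preordered_flip Z lt : preordered_set Z lt -> preordered_set Z (flip_rel lt).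
Proof.
move=> [h1 h2 h3 h4]; split; rewrite /flip_rel.
- by move=> u w Zu Zw /(h1 _ _ Zu Zw)[]; [right|left].
- by move=> u w Zu Zw; exact: h2.
- by move=> u w Zu Zw; exact: h4.
- by move=> u w Zu Zw; exact: h3.
Qed.

Lemma preordered_sub Z Z' lt : Z' `<=` Z -> preordered_set Z lt -> preordered_set Z' lt.
Proof.
move=> sub [h1 h2 h3 h4]; split.
- by move=> u w /sub Zu /sub Zw; exact: h1.
- by move=> u w /sub Zu /sub Zw; exact: h2.
- by move=> u w /sub Zu /sub Zw /(h3 _ _ Zu Zw); apply: filterS => z h /sub.
- by move=> u w /sub Zu /sub Zw /(h4 _ _ Zu Zw); apply: filterS => z h /sub.
Qed.

(** A locally constant function on the segment, continued by its value at [b], is locally constant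
    on all of [Z] because both sides of [b] are open. *)
Lemma initial_segment_connected Z lt b : connected Z -> preordered_set Z lt -> Z b ->
  connected [set u | Z u /\ (u = b \/ lt u b)].
Proof.
move=> cZ [tot asym nl nr] Zb; apply: locally_constant_connected => f lf.
pose L := [set u | Z u /\ (u = b \/ lt u b)].
pose f' u := if `[< L u >] then f u else f b.
have Lb : L b by split => //; left.
have f'E u : L u -> f' u = f u by move=> Lu; rewrite /f' asboolT.
have lf' u : Z u -> \forall w \near u, Z w -> f' w = f' u.
  move=> Zu; have [->|ub] := pselect (u = b).
    have := lf b Lb; apply: filterS => w h Zw; rewrite /f' (asboolT Lb).
    by case: asboolP => // /h.
  have [lub|lbu] := tot u b Zu Zb ub.
    have Lu : L u by split => //; right.
    apply: filterS2 (lf u Lu) (nl _ _ Zu Zb lub) => w h1 h2 Zw.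
    have Lw : L w by split => //; right; exact: h2.
    by rewrite !f'E// h1.
  have nL w : Z w -> lt b w -> ~ L w.
    move=> Zw bw [_ [wb|]]; last exact: asym.
    by rewrite wb in bw; exact: (asym b b).
  apply: filterS (nr _ _ Zb Zu lbu) => w h Zw.
  by rewrite /f' !asboolF//; apply: nL => //; exact: h.
move=> x y [Zx xb] [Zy yb]; rewrite -!f'E//.
exact: (connected_locally_constant cZ lf').
Qed.

(* Eilenberg: a connected set that is separated at each of its points, in an
   antisymmetric way, is linearly ordered. *)
Lemma preordered_trans Z lt a b c : connected Z -> preordered_set Z lt ->
  Z a -> Z b -> Z c -> lt a b -> lt b c -> lt a c.
Proof.
move=> cZ po Za Zb Zc ab bc; have [tot asym nl nr] := po.
have cL := initial_segment_connected cZ po Zb.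
(* No point of the segment below [b] equals [c], so its position relative to [c] cannot change on
   the way from [b] to [a]. *)
have E : `[< lt a c >] = `[< lt b c >]; last by apply/asboolP; rewrite E; exact/asboolP.
apply: (connected_locally_constant (f := fun u => `[< lt u c >]) cL).
- move=> u [Zu ub].
  have uc : u <> c.
    move=> uc; rewrite uc in ub; case: ub => [cb|]; last exact: asym.
    by rewrite cb in bc; exact: (asym b b).
  have [uc'|cu] := tot u c Zu Zc uc.
    by have := nl _ _ Zu Zc uc'; apply: filterS => w h [Zw _]; rewrite !asboolT//; exact: h.
  have := nr _ _ Zc Zu cu; apply: filterS => w h [Zw _]; rewrite !asboolF//.
    exact: asym.
  by apply: asym => //; exact: h.
- by split => //; right.
- by split => //; left.
Qed.

Definition seg Z lt u w : set T :=
  [set y | [/\ Z y, y = u \/ lt u y & y = w \/ lt y w]].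

(** An initial segment, for the reversed order, of an initial segment. *)
Lemma seg_connected Z lt u w : connected Z -> preordered_set Z lt -> Z u -> Z w ->
  u = w \/ lt u w -> connected (seg Z lt u w).
Proof.
move=> cZ po Zu Zw uw.
have cL := initial_segment_connected cZ po Zw.
have po' := preordered_flip (preordered_sub (_ : [set y | Z y /\ (y = w \/ lt y w)] `<=` Z) po).
have := initial_segment_connected cL (po' _).
move=> /(_ u) h.
have -> : seg Z lt u w = [set y | [set y | Z y /\ (y = w \/ lt y w)] y /\ (y = u \/ flip_rel lt y u)].
  by apply/seteqP; split => y; [case=> ? ? ?|case=> -[]]; split.
by apply: h => // y [].
Qed.

(** If [y] were missing from [C], the points of [C] below and above [y] would disconnect it. *)
Lemma connected_convex Z lt C u w y : preordered_set Z lt -> connected C -> C `<=` Z ->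
  C u -> C w -> Z y -> lt u y -> lt y w -> C y.
Proof.
move=> po cC CZ Cu Cw Zy uy yw; have [tot asym nl nr] := po; apply: contrapT => nCy.
have : `[< lt u y >] = `[< lt w y >].
  apply: (connected_locally_constant (f := fun u => `[< lt u y >]) cC) => // z Cz.
  have zy : z <> y by move=> zy; apply: nCy; rewrite -zy.
  have Zz := CZ _ Cz.
  have [zy'|yz] := tot z y Zz Zy zy.
    by have := nl _ _ Zz Zy zy'; apply: filterS => t h /CZ Zt; rewrite !asboolT//; exact: h.
  have := nr _ _ Zy Zz yz; apply: filterS => t h /CZ Zt; rewrite !asboolF//.
    exact: asym.
  by apply: asym => //; exact: h.
rewrite asboolT// => /esym/asboolP; apply: asym => //; exact: CZ.
Qed.

End OrderedSetTheory.

(** * The winding parity of two orbit arcs *)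

Section SectionOrder.
Variables (R : realType) (S : topologicalType) (v : R -> S -> S).
Hypotheses (hv : flow v) (hS : surface R S) (hcpt : compact [set: S]).
Let hT : hausdorff_space S := hS.1.

Variables (D : set S) (L M : S -> R) (d : R).
Hypotheses (d0 : 0 < d) (oD : open D).
Hypotheses (cL : forall y, D y -> L @ y --> L y) (cM : forall y, D y -> M @ y --> M y).
Hypothesis LM_inj : forall y y', D y -> D y' -> L y = L y' -> M y = M y' -> y = y'.

(** Coordinates of the vector between two points moving in opposite directions, [u] forwards and [w]
    backwards. Under [top] its [L] component goes from negative to positive, and the side on which
    the vector passes the origin decides which of [u] and [w] comes first. *)
Let lf (H : S -> R) (u w : S) (t : R) : R := H (v t u) - H (v (- t) w).
Let good (u : S) := forall t, - d <= t <= d -> D (v t u).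
Let sep (u w : S) := forall t, - d <= t <= d -> v t u <> v (- t) w.
Let top (u w : S) := 0 < lf L u w d /\ lf L u w (- d) < 0.

Let lf_cvg (H : S -> R) u w t : (forall y, D y -> H @ y --> H y) ->
  D (v t u) -> D (v (- t) w) ->
  (fun p : R * S => lf H p.2 w p.1) @ (t, u) --> lf H u w t.
Proof.
move=> cH Du Dw; apply: cvgB.
  move=> N /(cH _ Du) HN; have := flow_near2 hv HN.
  by move=> [[A B] /= [At Bx] h]; exists (A, B).
move=> N /(cH _ Dw) HN.
have h : \forall s \near - t, N (H (v s w)) := flow_near_time hv HN.
have {}h : \forall s \near t, N (H (v (- s) w)) by have /(_ _ h) := @opp_continuous R t.
exists ([set s | N (H (v (- s) w))], setT) => /=; first by split => //; exact: filterT.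
by move=> [s y] /= [].
Qed.

Let good_opp t : - d <= t <= d -> - d <= - t <= d. Proof. by lra. Qed.

Let lf_within (H : S -> R) u w : (forall y, D y -> H @ y --> H y) -> good u -> good w ->
  {within `[- d, d], continuous (lf H u w)}.
Proof.
move=> cH gu gw; apply/within_continuousP => t N; rewrite /= in_itv /= => tI NN.
have := lf_cvg cH (gu t tI) (gw _ (good_opp tI)) NN.
move=> [[A B] /= [At Bu] h]; apply: filterS At => s As _.
by apply: (h (s, u)); split => //; exact: nbhs_singleton.
Qed.

Let lf_neq0 u w t : D (v t u) -> D (v (- t) w) -> v t u <> v (- t) w ->
  lf L u w t != 0 \/ lf M u w t != 0.
Proof.
move=> Du Dw ne; have [/eqP|] := eqVneq (lf L u w t) 0; last by left.
rewrite subr_eq0 => /eqP eL; right; apply/eqP => /eqP; rewrite subr_eq0 => /eqP eM.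
exact/ne/LM_inj.
Qed.

Let cr u w b := crosses (lf L u w) (lf M u w) d b.

Let cr_uniq u w b b' : good u -> good w -> sep u w -> cr u w b -> cr u w b' -> b = b'.
Proof.
move=> gu gw suw; apply: crosses_uniq => //; [exact: lf_within|exact: lf_within|].
by move=> t tI; apply: lf_neq0; [exact: gu|exact: gw (good_opp tI)|exact: suw].
Qed.

Let cr_flip u w b : good u -> good w -> sep u w -> top u w -> cr u w b -> cr w u (~~ b).
Proof.
move=> gu gw suw [t1 t2] /(crosses_flip d0 _ _ _ t1 t2) h.
have E H : lf H w u = fun t => - lf H u w (- t).
  by apply/funext => t; rewrite /lf opprK opprB.
rewrite /cr !E; apply: h; [exact: lf_within|exact: lf_within|].
by move=> t tI; apply: lf_neq0; [exact: gu|exact: gw (good_opp tI)|exact: suw].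
Qed.

(** One potential is found on the product of a half-disc of points [u] with the time interval, which
    is convex. At the two end times the [L] component does not vanish, so the potential does not
    depend on [u] there, and the parity is the same for all nearby [u]. *)
Let cr_local u0 w : good u0 -> good w -> sep u0 w -> top u0 w ->
  exists b, \forall u \near u0, cr u w b.
Proof.
move=> gu gw suw [t1 t2].
have near_nz (H : S -> R) t : (forall y, D y -> H @ y --> H y) -> - d <= t <= d ->
    lf H u0 w t != 0 -> \forall s \near t & u \near u0, lf H u w s != 0.
  move=> cH tI h.
  have := lf_cvg cH (gu t tI) (gw _ (good_opp tI)).
  move=> /(_ [set x | x != 0]) h'.
  have {h'} := h' _; case.
    by apply: open_nbhs_nbhs; split => //; exact: open_neq.
  by move=> [A B] /= [At Bu] hh; exists (A, B).
have n1 : \forall u \near u0, forall t, `[- d, d]%classic t ->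
    D (v t u) /\ (lf L u w t != 0 \/ lf M u w t != 0).
  apply: flow_tube; first exact: segment_compact.
  move=> t; rewrite /= in_itv /= => tI.
  have h1 : \forall s \near t & u \near u0, D (v s u).
    by apply: (flow_near2 hv); apply: open_nbhs_nbhs; split => //; exact: gu.
  have [h2|h2] := lf_neq0 (gu t tI) (gw _ (good_opp tI)) (suw t tI).
    by apply: filterS2 h1 (near_nz L t cL tI h2) => p p1 p2; split => //; left.
  by apply: filterS2 h1 (near_nz M t cM tI h2) => p p1 p2; split => //; right.
have dI : - d <= d <= d by rewrite lexx andbT ge0_cp// ltW.
have NdI : - d <= - d <= d by rewrite lexx /= ge0_cp// ltW.
have n2 : \forall u \near u0, 0 < lf L u w d.
  have /(_ [set x | 0 < x] (lt_nbhsr t1)) := lf_cvg cL (gu _ dI) (gw _ (good_opp dI)).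
  move=> [[A B] /= [At Bu] h]; apply: filterS Bu => u Bu.
  by apply: (h (d, u)); split => //; exact: nbhs_singleton.
have n3 : \forall u \near u0, lf L u w (- d) < 0.
  have /(_ [set x | x < 0] (lt_nbhsl t2)) := lf_cvg cL (gu _ NdI) (gw _ (good_opp NdI)).
  move=> [[A B] /= [At Bu] h]; apply: filterS Bu => u Bu.
  by apply: (h (- d, u)); split => //; exact: nbhs_singleton.
have [f [g [r dc]]] := disc_chart_exists (hS.2 u0).
have n4 : \forall u \near u0, (forall t, - d <= t <= d ->
    D (v t u) /\ (lf L u w t != 0 \/ lf M u w t != 0)) /\ 0 < lf L u w d /\ lf L u w (- d) < 0.
  apply: filterS3 n1 n2 n3 => u u1 u2 u3; split; last by split.
  by move=> t tI; apply: u1; rewrite /= in_itv.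
have [r1 /andP[r10 r1r] r1N] := chart_disc_small dc n4.
pose r2 := r1 / 2; have r20 : 0 < r2 by rewrite divr_gt0.
have r21 : r2 < r1 by rewrite /r2; lra.
have gN q : half_disc (f u0) r2 q -> (forall t, - d <= t <= d ->
    D (v t (g q)) /\ (lf L (g q) w t != 0 \/ lf M (g q) w t != 0)) /\
    0 < lf L (g q) w d /\ lf L (g q) w (- d) < 0.
  by move=> [q2 qr]; apply: r1N; exists q; split => //; rewrite (le_lt_trans qr).
pose A : set ((R * R) * R) := half_disc (f u0) r2 `*` `[- d, d]%classic.
have cA : compact A by apply: compact_setX; [exact: half_disc_compact|exact: segment_compact].
have vA : convex_subset (A : set ((R * R)%type * R^o)%type).
  move=> a b t [a1 /= a2] [b1 /= b2] t01; split; first exact: half_disc_convex.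
  move: a2 b2; rewrite /= !in_itv /= => /andP[a3 a4] /andP[b3 b4].
  have /andP[tt0 tt1] := t01.
  have -> : a.2 + t *: (b.2 - a.2 : R^o) = (1 - t) * a.2 + t * b.2 by rewrite /GRing.scale /=; lra.
  have h1 : 0 <= 1 - t by lra.
  apply/andP; split.
    have := ler_wpM2l h1 a3; have := ler_wpM2l tt0 b3; lra.
  have := ler_wpM2l h1 a4; have := ler_wpM2l tt0 b4; lra.
have wA (H : S -> R) : (forall y, D y -> H @ y --> H y) ->
    {within A, continuous (fun p : (R * R) * R => lf H (g p.1) w p.2)}.
  move=> cH; apply/within_continuousP => -[q t] N [/= qH]; rewrite in_itv /= => tI NN.
  have [h _] := gN q qH; have [Dq _] := h t tI.
  have [[A1 B1] /= [A1t B1q] hh] := lf_cvg cH Dq (gw _ (good_opp tI)) NN.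
  have qH' p : half_disc (f u0) r2 p -> half_disc (f u0) r p.
    by move=> [p2 pr]; split => //; rewrite (le_trans pr)// ltW// (lt_le_trans r21).
  have hg := dc_g dc (qH' _ qH) B1q.
  exists ([set q | half_disc (f u0) r q -> B1 (g q)], A1); first by split.
  move=> [q' t'] /= [h1 h2] [/= h3 _]; apply: (hh (t', g q')); split => //=.
  by apply: h1; exact: qH'.
have torA : torsor_on A (crossing (fun p : (R * R) * R => lf L (g p.1) w p.2)
    (fun p => lf M (g p.1) w p.2)).
  apply: crossing_torsor; [exact: wA|exact: wA|].
  move=> [q t] [/= qH]; rewrite in_itv /= => tI; have [h _] := gN q qH.
  by have [] := h t tI.
have A0 : A (f u0, 0).
  split => /=; last by rewrite in_itv /=; lra.
  by split; [exact: (dc_ge0 dc)|rewrite subrr normr0 ltW].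
have [phi pphi] := @convex_torsor_potential R ((R * R)%type * R^o)%type A _ _ cA vA A0 torA.
pose F := crossing (fun p : (R * R) * R => lf L (g p.1) w p.2)
    (fun p => lf M (g p.1) w p.2).
have {}pphi c q t : F c -> half_disc (f u0) r2 q -> - d <= t <= d -> c.1 (q, t) ->
    \forall q' \near q & t' \near t, half_disc (f u0) r2 q' -> - d <= t' <= d ->
      phi (q', t') (+) c.2 (q', t') = phi (q, t) (+) c.2 (q, t).
  move=> Fc qH tI ct; have Aqt : A (q, t) by split => //=; rewrite in_itv.
  have [[A1 B1] /= [A1t B1q] hh] := pphi c (q, t) Fc Aqt ct.
  exists (A1, B1) => // -[q' t'] /= AB qH' tI'; apply: (hh (q', t') AB).
  by split => //=; rewrite in_itv.
have phic t : t = d \/ t = - d -> forall q q', half_disc (f u0) r2 q -> half_disc (f u0) r2 q' ->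
    phi (q, t) = phi (q', t).
  move=> td q q' qH qH'.
  have tI : - d <= t <= d by case: td => ->.
  apply: (convex_locally_constant (half_disc_convex (c := f u0) (r := r2)) (f := fun q => phi (q, t))) => // p pH.
  have pnz : lf L (g p) w t != 0.
    by have [_ [h1 h2]] := gN p pH; case: td => ->; [rewrite gt_eqF|rewrite lt_eqF].
  have [[A1 B1] /= [A1t B1q] hh] := pphi _ p t (or_intror erefl) pH tI (or_introl pnz).
  apply: filterS A1t => p' A1p' pH'.
  have := hh (p', t) (conj A1p' (nbhs_singleton B1q)) pH' tI.
  by rewrite /= !addbF.
exists (phi (f u0, d) (+) phi (f u0, - d)).
have u0H : half_disc (f u0) r2 (f u0) by case: A0.
have oC : nbhs u0 (chart_disc f g u0 r2).
  apply: open_nbhs_nbhs; split; last exact: (chart_disc_center dc).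
  by apply: (dc_open dc); rewrite ltW// (lt_le_trans r21).
apply: filterS oC => u Du.
have [gu' _ fur] := chart_discP dc (ltW (lt_le_trans r21 r1r)) Du.
have uH : half_disc (f u0) r2 (f u).
  by case: Du => p [p2 pr pu]; split; [have [_ []] := chart_discP dc (ltW (lt_le_trans r21 r1r)) (ex_intro _ p (And3 p2 pr pu))|exact: ltW].
exists (fun t => phi (f u, t)); split; last first.
  by rewrite (phic d (or_introl erefl) _ _ u0H uH) (phic (- d) (or_intror erefl) _ _ u0H uH).
move=> c t cc; rewrite /= in_itv /= => tI ct.
suff [c' [Fc' c'1 c'2]] : exists c', [/\ F c', c'.1 (f u, t) & forall s, c'.2 (f u, s) = c.2 s].
  have [[A1 B1] /= [A1t B1q] hh] := pphi _ _ _ Fc' uH tI c'1.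
  apply: filterS B1q => s B1s; rewrite /= in_itv /= => sI.
  have := hh (f u, s) (conj (nbhs_singleton A1t) B1s) uH sI.
  by rewrite /= !c'2.
case: cc ct => -> /= ct.
  exists ([set a | 0 < lf M (g a.1) w a.2], fun a => 0 < lf L (g a.1) w a.2); split => /=.
  - by left.
  - by rewrite gu'.
  - by move=> s; rewrite gu'.
exists ([set a | lf L (g a.1) w a.2 != 0 \/ lf M (g a.1) w a.2 < 0], fun=> false); split => //=.
- by right.
- by rewrite gu'.
Qed.

(* The parity of the number of times the vector from [v (- t) w] to [v t u], read
   in a chart, crosses a fixed ray while t goes from -d to d. *)
Definition winding_lt (u w : S) : Prop := u <> w /\ cr u w true.

(** Antisymmetry comes from [cr_flip]: exchanging [u] and [w] reverses time and replaces the vector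
    by its opposite. Totality is the existence of the parity, and openness of both sides is its
    local constancy. *)
Lemma winding_preordered (Z : set S) :
  (forall u, Z u -> good u) -> (forall u w, Z u -> Z w -> u <> w -> sep u w) ->
  (forall u w, Z u -> Z w -> top u w) -> preordered_set Z winding_lt.
Proof.
move=> Zg Zs Zt.
have neN (u w : S) : u <> w -> \forall u' \near u, u' <> w.
  move=> uw; have : open_nbhs u (~` [set w]).
    split; last exact: uw.
    apply: closed_openC; apply: accessible_closed_set1; exact: hausdorff_accessible.
  by move/open_nbhs_nbhs; apply: filterS.
have loc u w b : Z u -> Z w -> u <> w -> cr u w b ->
    \forall u' \near u, Z u' -> u' <> w /\ cr u' w b.
  move=> Zu Zw uw ub.
  have [b' h] := cr_local (Zg _ Zu) (Zg _ Zw) (Zs _ _ Zu Zw uw) (Zt _ _ Zu Zw).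
  have E : b' = b.
    apply: cr_uniq ub; [exact: Zg|exact: Zg|exact: Zs|exact: nbhs_singleton h].
  by rewrite -E; apply: filterS2 h (neN _ _ uw) => u' h1 h2 Zu'.
have flip u w b : Z u -> Z w -> u <> w -> cr u w b -> cr w u (~~ b).
  by move=> Zu Zw uw; apply: cr_flip; [exact: Zg|exact: Zg|exact: Zs|exact: Zt].
split.
- move=> u w Zu Zw uw.
  have [b ub] : exists b, cr u w b.
    by have [b /nbhs_singleton h] := cr_local (Zg _ Zu) (Zg _ Zw) (Zs _ _ Zu Zw uw) (Zt _ _ Zu Zw); exists b.
  case: b ub => ub; first by left.
  by right; split; [exact/nesym|exact: (flip _ _ _ Zu Zw uw ub)].
- move=> u w Zu Zw [uw ub] [wu wb].
  have := cr_uniq (Zg _ Zw) (Zg _ Zu) (Zs _ _ Zw Zu wu) wb (flip _ _ _ Zu Zw uw ub).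
  by [].
- by move=> u w Zu Zw [uw ub]; exact: (loc _ _ _ Zu Zw uw ub).
- move=> u w Zu Zw [uw ub].
  have := loc _ _ _ Zw Zu (nesym uw) (flip _ _ _ Zu Zw uw ub).
  apply: filterS => w' h Zw'; have [w'u w'b] := h Zw'; split; first exact: nesym.
  exact: (flip _ _ _ Zw' Zu w'u w'b).
Qed.

End SectionOrder.

Section OrderedSections.
Variables (R : realType) (S : topologicalType) (v : R -> S -> S).
Hypotheses (hv : flow v) (hS : surface R S) (hcpt : compact [set: S]).

(** [os_closed] stands in for compactness of intervals: cluster points of a sequence in a segment
    stay there, and loops containing a segment are closed. *)
Record ordered_section (x : S) (Z : set S) (d : R) (lt : S -> S -> Prop) : Prop := OrderedSection {
  os_ls : local_section v x Z d;
  os_po : preordered_set Z lt;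
  os_closed : forall u w, Z u -> Z w -> closed (seg Z lt u w) }.

(** [L] is the coordinate along the chord [e] from [v (- d') x] to [v d' x], and [M] the coordinate
    along [e] turned by a right angle. The value [k] separates, for all points near [x], the forward
    ends from the backward ends, which is the condition [top]. *)
Lemma ordered_section_exists x : ~ singular_pt v x ->
  exists Z d lt, ordered_section x Z d lt.
Proof.
move=> nsx; have [f [g [r dc]]] := disc_chart_exists (hS.2 x).
pose D := chart_disc f g x r.
have oD : open D by exact: (dc_open dc).
have Dx : D x by exact: (chart_disc_center dc (dc_r dc)).
have [e0 e00 De0] : exists2 e0, 0 < e0 & forall t, `|t| < e0 -> D (v t x).
  have : \forall t \near (0 : R), D (v t x).
    by apply: (flow_near_time hv); rewrite (flow0 hv); exact: open_nbhs_nbhs.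
  move=> /nbhs_ballP[e0 /= e00 h]; exists e0 => // t te; apply: h.
  by rewrite -ball_normE /= sub0r normrN.
have [d /andP[d0 de0] sec] := local_section_exists hv hS hcpt nsx e00.
(* If [v t u] meets [v (- t) w] with [t] at most [d'] in absolute value, then [w] is [u] moved by at
   most [d], which injectivity of the section excludes for distinct points. *)
pose d' := d / 2; have d'0 : 0 < d' by rewrite divr_gt0.
have d'd : d' < d by rewrite /d'; lra.
pose e := f (v d' x) - f (v (- d') x).
have Dd t : - d' <= t <= d' -> D (v t x).
  by move=> tI; apply: De0; rewrite ltr_norml; lra.
have finj y y' : D y -> D y' -> f y = f y' -> y = y'.
  move=> Dy Dy' E; have [<- _ _] := chart_discP dc (lexx r) Dy.
  by have [<- _ _] := chart_discP dc (lexx r) Dy'; rewrite E.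
have e_neq0 : 0 < e.1 ^+ 2 + e.2 ^+ 2.
  rewrite lt_neqAle addr_ge0 ?sqr_ge0// andbT eq_sym.
  rewrite paddr_eq0 ?sqr_ge0// !sqrf_eq0; apply/negP => /andP[/eqP h1 /eqP h2].
  have : f (v d' x) = f (v (- d') x).
    apply/eqP; rewrite -subr_eq0 -/e; apply/eqP.
    by apply/eqP; rewrite (surjective_pairing e) h1 h2.
  move=> /finj h; have {h} E := h (Dd d' ltac:(lra)) (Dd (- d') ltac:(lra)).
  have [Z1 [_ [ls _ _ _ _]]] := sec setT filterT.
  have := ls_inj ls (t := d' + d') (ls_x ls) (ls_x ls).
  rewrite (flowD hv) E (flowNK hv) => /(_ _ erefl) h.
  have : d' + d' = 0 by apply: h; rewrite ger0_norm; lra.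
  by lra.
pose L y := e.1 * (f y).1 + e.2 * (f y).2.
pose M y := e.1 * (f y).2 - e.2 * (f y).1.
have cf1 y : D y -> (fun z => (f z).1) @ y --> (f y).1.
  by move=> Dy; apply: (cvg_comp _ _ (dc_f dc Dy)); exact: cvg_fst.
have cf2 y : D y -> (fun z => (f z).2) @ y --> (f y).2.
  by move=> Dy; apply: (cvg_comp _ _ (dc_f dc Dy)); exact: cvg_snd.
have cL y : D y -> L @ y --> L y.
  by move=> Dy; apply: cvgD; apply: cvgMl_tmp; [exact: cf1|exact: cf2].
have cM y : D y -> M @ y --> M y.
  by move=> Dy; apply: cvgB; apply: cvgMl_tmp; [exact: cf2|exact: cf1].
have LM_inj y y' : D y -> D y' -> L y = L y' -> M y = M y' -> y = y'.
  move=> Dy Dy' EL EM; apply: finj => //.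
  rewrite (surjective_pairing (f y)) (surjective_pairing (f y')).
  have n0 : e.1 ^+ 2 + e.2 ^+ 2 != 0 by rewrite gt_eqF.
  have E1 z : (e.1 ^+ 2 + e.2 ^+ 2) * (f z).1 = e.1 * L z - e.2 * M z by rewrite /L /M; lra.
  have E2 z : (e.1 ^+ 2 + e.2 ^+ 2) * (f z).2 = e.2 * L z + e.1 * M z by rewrite /L /M; lra.
  by congr (_, _); apply: (mulfI n0); rewrite ?E1 ?E2 EL EM.
pose k := (L (v d' x) + L (v (- d') x)) / 2.
have Lgap : L (v (- d') x) < k < L (v d' x).
  have : 0 < L (v d' x) - L (v (- d') x).
    have -> : L (v d' x) - L (v (- d') x) = e.1 ^+ 2 + e.2 ^+ 2 by rewrite /L /e /=; lra.
    exact: e_neq0.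
  by rewrite /k; lra.
have NM : nbhs x [set y | (forall t, - d' <= t <= d' -> D (v t y)) /\
    L (v (- d') y) < k < L (v d' y)].
  have n1 : \forall y \near x, forall t, `[- d', d']%classic t -> D (v t y).
    apply: flow_tube; first exact: segment_compact.
    move=> t; rewrite /= in_itv /= => tI.
    by apply: (flow_near2 hv); apply: open_nbhs_nbhs; split => //; exact: Dd.
  have n2 : \forall y \near x, L (v (- d') y) < k.
    apply: (@flow_near _ _ _ hv _ x [set z | L z < k]).
    have /cvgr_lt := cL _ (Dd (- d') ltac:(lra)); apply; lra.
  have n3 : \forall y \near x, k < L (v d' y).
    apply: (@flow_near _ _ _ hv _ x [set z | k < L z]).
    have /cvgr_gt := cL _ (Dd d' ltac:(lra)); apply; lra.
  apply: filterS3 n1 n2 n3 => y y1 y2 y3; split; last by rewrite y2 y3.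
  by move=> t tI; apply: y1; rewrite /= in_itv.
have [Z1 [Z2 [ls1 ls2 Z12 Z2M clZ]]] := sec _ NM.
pose lt := winding_lt v L M d'.
have po : preordered_set Z2 lt.
  apply: (winding_preordered hv hS d'0 oD cL cM LM_inj).
  - by move=> u /Z2M[].
  - move=> u w Zu Zw uw t tI E.
    have E2 : v (t + t) u = w by rewrite (flowD hv) E (flowNK hv).
    have t0 : t + t = 0.
      by apply: (ls_inj ls2 Zw Zu _ E2); rewrite ltr_norml; lra.
    by apply: uw; rewrite -E2 t0 (flow0 hv).
  - move=> u w /Z2M[_ u2] /Z2M[_ w2]; split; rewrite ?opprK; lra.
exists Z1, d, lt; split => //; first exact: (preordered_sub Z12 po).
move=> u w Zu Zw.
have [Zu2 Zw2] := (Z12 _ Zu, Z12 _ Zw).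
(* A limit point of the segment may leave [Z1], but not [Z2], where the order still places it
   between [u] and [w]; [connected_convex] then brings it back into [Z1]. *)
have inZ2 : closure (seg Z1 lt u w) `<=` Z2.
  apply: subset_trans clZ; apply: closure_subset => y; by case.
apply/closure_id/seteqP; split; first exact: subset_closure.
move=> y cy; have Z2y := inZ2 _ cy.
have h1 : y = u \/ lt u y.
  apply: contrapT => /not_orP[yu uy].
  have yu' : lt y u by have [|//] := po_total po Zu2 Z2y (nesym yu).
  have [z [[Zz zu _] h]] := cy _ (po_nearl po Z2y Zu2 yu').
  have {}h := h (Z12 _ Zz); case: zu => [zu|]; last exact: (po_asym po (Z12 _ Zz) Zu2 h).
  by rewrite zu in h; exact: (po_asym po Zu2 Zu2 h h).
have h2 : y = w \/ lt y w.
  apply: contrapT => /not_orP[yw wy].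
  have yw' : lt w y by have [|//] := po_total po Z2y Zw2 yw.
  have [z [[Zz _ zw] h]] := cy _ (po_nearr po Zw2 Z2y yw').
  have {}h := h (Z12 _ Zz); case: zw => [zw|zw]; last exact: (po_asym po (Z12 _ Zz) Zw2 zw h).
  by rewrite zw in h; exact: (po_asym po Zw2 Zw2 h h).
split => //.
have [->//|yu] := pselect (y = u); have [->//|yw] := pselect (y = w).
case: h1 => // uy; case: h2 => // yw'.
exact: (connected_convex po (ls_connected ls1) Z12 Zu Zw Z2y uy yw').
Qed.

End OrderedSections.

(** * Flow-box coordinates *)

Section SectionTheory.
Variables (R : realType) (S : topologicalType) (v : R -> S -> S).
Hypotheses (hv : flow v) (hS : surface R S) (hcpt : compact [set: S]).
Let hT : hausdorff_space S := hS.1.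
Variables (x : S) (Z : set S) (d : R) (lt : S -> S -> Prop).
Hypothesis os : ordered_section v x Z d lt.
Let ls := os_ls os.
Let po := os_po os.
Let d0 : 0 < d := ls_d ls.

Lemma os_trans a b c : Z a -> Z b -> Z c -> lt a b -> lt b c -> lt a c.
Proof. by move=> Za Zb Zc; exact: (preordered_trans (ls_connected ls) po Za Zb Zc). Qed.

Lemma os_irr a : Z a -> ~ lt a a.
Proof. by move=> Za h; exact: (po_asym po Za Za h h). Qed.

Lemma os_seg_connected u w : Z u -> Z w -> u = w \/ lt u w -> connected (seg Z lt u w).
Proof. exact: seg_connected (ls_connected ls) po. Qed.

Definition box : set S := flow_box v Z setT d.

Lemma box_open : open box.
Proof. by apply: (ls_open ls); [exact: openT|rewrite lexx d0]. Qed.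

Let coord (b : S) : exists p : S * R, box b -> [/\ Z p.1, `|p.2| < d & v p.2 p.1 = b].
Proof.
have [[u [t [Zu _ td ub]]]|nb] := pselect (box b); last by exists (b, 0).
by exists (u, t).
Qed.

Definition box_proj (b : S) : S := (projT1 (cid (coord b))).1.
Definition box_time (b : S) : R := (projT1 (cid (coord b))).2.

Lemma box_coordP b : box b ->
  [/\ Z (box_proj b), `|box_time b| < d & v (box_time b) (box_proj b) = b].
Proof. exact: (projT2 (cid (coord b))). Qed.

Lemma section_uniq u w s t : Z u -> Z w -> `|s - t| < 2 * d -> v s u = v t w -> u = w /\ s = t.
Proof.
move=> Zu Zw st E.
have E' : v (s - t) u = w by rewrite addrC (flowD hv) E (flowK hv).
have st0 := ls_inj ls Zw Zu st E'.
by split; [rewrite -E' st0 (flow0 hv)|apply/eqP; rewrite -subr_eq0 st0].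
Qed.

Lemma box_in u t : Z u -> `|t| < d -> box (v t u).
Proof. by move=> Zu td; exists u, t. Qed.

Lemma box_coordE u t : Z u -> `|t| < d -> box_proj (v t u) = u /\ box_time (v t u) = t.
Proof.
move=> Zu td; have [Zp pd E] := box_coordP (box_in Zu td).
apply: section_uniq E => //; rewrite (le_lt_trans (ler_normB _ _))//; lra.
Qed.

Lemma section_box u : Z u -> box u.
Proof. by move=> Zu; rewrite -(flow0 hv u); apply: box_in => //; rewrite normr0. Qed.

Lemma section_coord u : Z u -> box_proj u = u /\ box_time u = 0.
Proof.
by move=> Zu; rewrite -{1 3}(flow0 hv u); apply: box_coordE => //; rewrite normr0.
Qed.

Lemma box_proj_near b (N : set S) : box b -> nbhs (box_proj b) N ->
  \forall b' \near b, box b' /\ N (box_proj b').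
Proof.
move=> Bb; rewrite nbhsE => -[W1 [oW W1b] WN]; have [Zb tb E] := box_coordP Bb.
have : nbhs b (flow_box v Z W1 d).
  apply: open_nbhs_nbhs; split; first by apply: (ls_open ls) => //; rewrite lexx d0.
  by exists (box_proj b), (box_time b).
apply: filterS => b' [u [t [Zu Wu td <-]]]; split; first exact: box_in.
by have [-> _] := box_coordE Zu td; exact: WN.
Qed.

(** A lower flow box over the same section, carried along the flow by the box time of [b], is a
    neighbourhood of [b] on which the time varies little. *)
Lemma box_time_near b (e : R) : box b -> 0 < e ->
  \forall b' \near b, box b' /\ `|box_time b - box_time b'| < e.
Proof.
move=> Bb e0; have [Zb tb E] := box_coordP Bb.
pose e1 := Num.min e (d - `|box_time b|).
have e10 : 0 < e1 by rewrite lt_min e0 subr_gt0.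
have e1d : e1 <= d by rewrite ge_min; apply/orP; right; have := normr_ge0 (box_time b); lra.
have /(open_flow_image hv (box_time b)) o1 : open (flow_box v Z setT e1).
  by apply: (ls_open ls); [exact: openT|rewrite e10].
have : nbhs b [set v (box_time b) y | y in flow_box v Z setT e1].
  apply: open_nbhs_nbhs; split => //.
  exists (box_proj b) => //; exists (box_proj b), 0; split => //; rewrite ?normr0//.
  exact: (flow0 hv).
apply: filterS => _ [_ [u [t [Zu _ td <-]]] <-].
move: td; rewrite lt_min => /andP[te td].
have sd : `|box_time b + t| < d by rewrite (le_lt_trans (ler_normD _ _))//; lra.
rewrite -(flowD hv); split; first exact: box_in.
by have [_ ->] := box_coordE Zu sd; rewrite opprD addrA subrr sub0r normrN.
Qed.

(** The section inherits local connectedness from the surface, by projecting a small connected open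
    set along the flow. *)
Lemma section_locally_connected w (N : set S) : Z w -> nbhs w N ->
  exists C, [/\ connected C, C `<=` Z, C `<=` N, C w & \forall y \near w, Z y -> C y].
Proof.
move=> Zw Nw; have [pw _] := section_coord Zw.
have : \forall b \near w, box b /\ N (box_proj b).
  by apply: box_proj_near; [exact: section_box|rewrite pw].
move=> /(surface_locally_connected hS)[Q [oQ Qw cQ QN]].
exists (box_proj @` Q); split.
- apply: connected_continuous_connected => //; apply/within_continuousP => b N' Qb N'b.
  have [Bb _] := QN _ Qb.
  by have := box_proj_near Bb N'b; apply: filterS => b' [].
- by move=> _ [b /QN[Bb _] <-]; have [] := box_coordP Bb.
- by move=> _ [b /QN[Bb Nb] <-].
- by exists w.
- have := open_nbhs_nbhs (conj oQ Qw); apply: filterS => y Qy Zy; exists y => //.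
  by have [] := section_coord Zy.
Qed.

(** Otherwise [u] would be isolated in the connected segment from [u] to [w]. *)
Lemma section_between u w (N : set S) : Z u -> Z w -> lt u w -> nbhs u N ->
  exists y, [/\ Z y, N y, lt u y & lt y w].
Proof.
move=> Zu Zw uw Nu; apply: contrapT => h.
have uu : seg Z lt u w u by split => //; [left|right].
have ww : seg Z lt u w w by split => //; [right|left].
have : `[< u = u >] = `[< w = u >].
  apply: (connected_locally_constant (f := fun y => `[< y = u >])
    (os_seg_connected Zu Zw (or_intror uw))) => // y [Zy uy yw].
  have [->|yu] := pselect (y = u).
    have := po_nearl po Zu Zw uw; apply: filterS2 Nu => z Nz zw [Zz uz _].
    rewrite [RHS]asboolT//; apply/asboolT; case: uz => // uz.
    by exfalso; apply: h; exists z; split => //; exact: zw.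
  case: uy => // uy; have := po_nearr po Zu Zy uy; apply: filterS => z uz [Zz _ _].
  rewrite !asboolF// => zu; have := uz Zz; rewrite zu; exact: os_irr.
rewrite asboolT// => /esym/asboolP wu; rewrite wu in uw; exact: (os_irr Zu uw).
Qed.

Lemma os_flip : ordered_section v x Z d (flip_rel lt).
Proof.
split => //; first exact: preordered_flip.
move=> u w Zu Zw; have -> : seg Z (flip_rel lt) u w = seg Z lt w u.
  by apply/seteqP; split => y [Zy h1 h2]; split.
exact: (os_closed os).
Qed.

Lemma os_rev : ordered_section (fun t => v (- t)) x Z d lt.
Proof.
have fb U e : flow_box (fun t => v (- t)) Z U e = flow_box v Z U e.
  apply/seteqP; split => b [u [t [Zu Uu te ub]]]; exists u, (- t).
    by rewrite normrN.
  by rewrite normrN opprK.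
split => //; last exact: (os_closed os).
split; [exact: (ls_x ls)|exact: (ls_connected ls)|exact: d0| |].
  move=> u w t Zu Zw td E; apply: oppr_inj; rewrite oppr0.
  by apply: (ls_inj ls Zu Zw _ E); rewrite normrN.
by move=> U e oU ed; rewrite fb; exact: (ls_open ls).
Qed.

End SectionTheory.

Lemma flow_rev (R : realType) (S : topologicalType) (v : R -> S -> S) :
  flow v -> flow (fun t => v (- t)).
Proof.
move=> hv; split.
- move=> [t x] N /= /(flow_near2 hv)[[A B] /= [At Bx] h].
  exists ([set s | A (- s)], B) => /=.
    by split => //; have /(_ _ At) := @opp_continuous R t.
  by move=> [s y] /= [As By]; exact: (h (- s, y)).
- by move=> x; rewrite oppr0 (flow0 hv).
- by move=> s t x; rewrite opprD (flowD hv).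
Qed.

(** * Injective maps between pieces of an ordered set *)

Section Monotone.
Variables (T : topologicalType) (Z : set T).
Hypothesis cZ : connected Z.
Variables (C : set T) (f : T -> T).
Hypotheses (CZ : C `<=` Z) (fZ : forall u, C u -> Z (f u)).
Hypothesis fC : {within C, continuous f}.
Hypothesis finj : forall u w, C u -> C w -> f u = f w -> u = w.

Let image_connected D : connected D -> D `<=` C -> connected (f @` D).
Proof.
move=> cD DC; apply: connected_continuous_connected => //.
apply/within_continuousP => y N Dy Ny.
have := iffLR (within_continuousP _ _) fC y N (DC _ Dy) Ny.
by apply: filterS => z h /DC; exact: h.
Qed.

(** At a fold, the value of [f] nearer to [f y] on one side of [y] would also be taken on the other
    side. The second order is separate so that it can be replaced by its reverse. *)
Let no_fold (lt1 lt2 : T -> T -> Prop) u y w :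
  preordered_set Z lt1 -> preordered_set Z lt2 -> C u -> C y -> C w ->
  seg Z lt1 u y `<=` C -> seg Z lt1 y w `<=` C ->
  lt1 u y -> lt1 y w -> lt2 (f u) (f y) -> ~ lt2 (f w) (f y).
Proof.
move=> po1 po2 Cu Cy Cw sC sC' uy yw fu fw.
have [[Zu Zy] Zw] := (CZ Cu, CZ Cy, CZ Cw).
have irr z : Z z -> ~ lt1 z z by move=> Zz h; exact: (po_asym po1 Zz Zz h h).
have fuw : f u <> f w.
  move=> /finj uw; rewrite (uw Cu Cw) in uy; exact: (po_asym po1 Zy Zw yw uy).
have [h|h] := po_total po2 (fZ Cu) (fZ Cw) fuw.
  have cI := image_connected (seg_connected cZ po1 Zu Zy (or_intror uy)) sC.
  have : (f @` seg Z lt1 u y) (f w).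
    apply: (connected_convex po2 cI _ _ _ (fZ Cw) h fw).
    - by move=> _ [z /sC Cz <-]; exact: fZ.
    - by exists u => //; split => //; [left|right].
    - by exists y => //; split => //; [right|left].
  move=> [z sz] /finj E; have zw := E (sC _ sz) Cw; case: sz => _ _; rewrite zw => -[wy|wy].
    by rewrite wy in yw; exact: (irr _ Zy yw).
  exact: (po_asym po1 Zy Zw yw wy).
have cI := image_connected (seg_connected cZ po1 Zy Zw (or_intror yw)) sC'.
have : (f @` seg Z lt1 y w) (f u).
  apply: (connected_convex po2 cI _ _ _ (fZ Cu) h fu).
  - by move=> _ [z /sC' Cz <-]; exact: fZ.
  - by exists w => //; split => //; [right|left].
  - by exists y => //; split => //; [left|right].
move=> [z sz] /finj E; have zu := E (sC' _ sz) Cu; case: sz => _; rewrite zu => -[yu|yu] _.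
  by rewrite yu in uy; exact: (irr _ Zy uy).
exact: (po_asym po1 Zu Zy uy yu).
Qed.

Let convexC lt u w : preordered_set Z lt -> connected C -> C u -> C w -> seg Z lt u w `<=` C.
Proof.
move=> po cC Cu Cw y [Zy [->//|uy] [->//|yw]].
exact: (connected_convex po cC CZ Cu Cw Zy uy yw).
Qed.

Let same_side (lt1 lt2 : T -> T -> Prop) u w y : preordered_set Z lt1 -> preordered_set Z lt2 ->
  connected C -> C u -> C w -> C y -> lt1 u w -> ~ seg Z lt1 u w y ->
  lt2 (f u) (f y) <-> lt2 (f w) (f y).
Proof.
move=> po1 po2 cC Cu Cw Cy uw ny.
have sC := convexC po1 cC Cu Cw.
have E : `[< lt2 (f u) (f y) >] = `[< lt2 (f w) (f y) >].
  apply: (connected_locally_constant (f := fun z => `[< lt2 (f z) (f y) >])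
    (seg_connected cZ po1 (CZ Cu) (CZ Cw) (or_intror uw))).
  - move=> z sz; have Cz := sC _ sz.
    have zy : f z <> f y by move=> /finj E; rewrite (E Cz Cy) in sz.
    have [h|h] := po_total po2 (fZ Cz) (fZ Cy) zy.
      have := iffLR (within_continuousP _ _) fC z _ Cz (po_nearl po2 (fZ Cz) (fZ Cy) h).
      by apply: filterS => t ht /sC Ct; rewrite !asboolT//; apply: ht => //; exact: fZ.
    have := iffLR (within_continuousP _ _) fC z _ Cz (po_nearr po2 (fZ Cy) (fZ Cz) h).
    apply: filterS => t ht /sC Ct; rewrite !asboolF//; first exact: (po_asym po2 (fZ Cy) (fZ Cz) h).
    by apply: (po_asym po2 (fZ Cy) (fZ Ct)); apply: ht => //; exact: fZ.
  - by split; [exact: CZ|left|right].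
  - by split; [exact: CZ|right|left].
by split => h; apply/asboolP; [rewrite -E|rewrite E]; exact/asboolP.
Qed.

Definition side_preserving (lt : T -> T -> Prop) y :=
  (forall u, C u -> lt u y -> lt (f u) (f y)) /\ (forall u, C u -> lt y u -> lt (f y) (f u)).
Definition side_reversing (lt : T -> T -> Prop) y :=
  (forall u, C u -> lt u y -> lt (f y) (f u)) /\ (forall u, C u -> lt y u -> lt (f u) (f y)).

(** By [same_side] the points on one side of [y] all go to one side of [f y], and by [no_fold] the
    two sides of [y] do not go to the same one. If [y] is an end of [C], one half of the conclusion
    is vacuous. *)
Lemma side_dichotomy lt y : preordered_set Z lt -> connected C -> C y ->
  side_preserving lt y \/ side_reversing lt y.
Proof.
move=> po cC Cy; have pof := preordered_flip po.
have irr z : Z z -> ~ lt z z by move=> Zz h; exact: (po_asym po Zz Zz h h).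
have ne u : C u -> u <> y -> f u <> f y by move=> Cu uy /finj E; apply: uy; exact: E.
have ltne u : C u -> lt u y \/ lt y u -> u <> y.
  by move=> Cu h uy; rewrite uy in h; case: h; exact: irr (CZ Cy).
have sideL lt2 u w : preordered_set Z lt2 -> C u -> C w -> lt u y -> lt w y ->
    lt2 (f u) (f y) -> lt2 (f w) (f y).
  move=> po2 Cu Cw uy wy h.
  have nseg a b : C b -> lt b y -> ~ seg Z lt a b y.
    move=> Cb by_ [_ _ [yb|yb]]; first by rewrite yb in by_; exact: (irr b (CZ Cb) by_).
    exact: (po_asym po (CZ Cb) (CZ Cy) by_ yb).
  have [<-//|uw] := pselect (u = w).
  have [uw'|wu'] := po_total po (CZ Cu) (CZ Cw) uw.
    exact: (same_side po po2 cC Cu Cw Cy uw' (nseg _ _ Cw wy)).1.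
  exact: (same_side po po2 cC Cw Cu Cy wu' (nseg _ _ Cu uy)).2.
have sideR lt2 u w : preordered_set Z lt2 -> C u -> C w -> lt y u -> lt y w ->
    lt2 (f u) (f y) -> lt2 (f w) (f y).
  move=> po2 Cu Cw uy wy h.
  have nseg a b : C a -> lt y a -> ~ seg Z lt a b y.
    move=> Cb by_ [_ [yb|yb] _]; first by rewrite yb in by_; exact: (irr a (CZ Cb) by_).
    exact: (po_asym po (CZ Cy) (CZ Cb) by_ yb).
  have [<-//|uw] := pselect (u = w).
  have [uw'|wu'] := po_total po (CZ Cu) (CZ Cw) uw.
    exact: (same_side po po2 cC Cu Cw Cy uw' (nseg _ _ Cu uy)).1.
  exact: (same_side po po2 cC Cw Cu Cy wu' (nseg _ _ Cw wy)).2.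
have fold lt2 u w : preordered_set Z lt2 -> C u -> C w -> lt u y -> lt y w ->
    lt2 (f u) (f y) -> ~ lt2 (f w) (f y).
  move=> po2 Cu Cw uy yw; apply: (no_fold po po2) uy yw => //; exact: convexC.
have tot u : C u -> u <> y -> lt (f u) (f y) \/ lt (f y) (f u).
  by move=> Cu uy; apply: (po_total po); [exact: fZ|exact: fZ|exact: ne].
have [[w [Cw yw]]|nR] := pselect (exists w, C w /\ lt y w).
  have [h|h] := tot w Cw (ltne _ Cw (or_intror yw)).
    right; split.
      move=> u Cu uy; have [h'|//] := tot u Cu (ltne _ Cu (or_introl uy)).
      by have := fold lt u w po Cu Cw uy yw h'.
    by move=> u Cu yu; apply: (sideR lt w u).
  left; split.
    move=> u Cu uy; have [//|h'] := tot u Cu (ltne _ Cu (or_introl uy)).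
    by have := fold (flip_rel lt) u w pof Cu Cw uy yw h'.
  by move=> u Cu yu; apply: (sideR (flip_rel lt) w u).
have [[w [Cw wy]]|nL] := pselect (exists w, C w /\ lt w y).
  have [h|h] := tot w Cw (ltne _ Cw (or_introl wy)).
    left; split; last by move=> u Cu yu; case: nR; exists u.
    by move=> u Cu uy; apply: (sideL lt w u).
  right; split; last by move=> u Cu yu; case: nR; exists u.
  by move=> u Cu uy; apply: (sideL (flip_rel lt) w u).
left; split; first by move=> u Cu uy; case: nL; exists u.
by move=> u Cu yu; case: nR; exists u.
Qed.

End Monotone.

(** * Periodic orbits *)

Definition returns (R : realType) (S : topologicalType) (v : R -> S -> S) (p : S) : Prop :=
  forall (n : R) (U : set S), nbhs p U -> exists t, n < `|t| /\ U (v t p).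

Lemma hausdorff_separation (T : topologicalType) (a b : T) : hausdorff_space T -> a <> b ->
  exists A B : set T, [/\ nbhs a A, nbhs b B & forall z, A z -> ~ B z].
Proof.
move=> hT ab; have /existsNP[A /existsNP[B /not_implyP[Aa /not_implyP[Bb AB]]]] :
    ~ cluster (nbhs a) b by move=> /hT.
exists A, B; split => // z Az Bz; apply: AB; exists z; by split.
Qed.

Section PeriodicOrbits.
Variables (R : realType) (S : topologicalType).
Hypotheses (hS : surface R S) (hcpt : compact [set: S]).
Let hT : hausdorff_space S := hS.1.

Lemma avoid_tube (v : R -> S -> S) (c p : S) (K : set R) : flow v -> compact K ->
  (forall t, K t -> v t c <> p) ->
  exists Y U : set S, [/\ nbhs c Y, nbhs p U & forall u t, Y u -> K t -> ~ U (v t u)].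
Proof.
move=> hv /compact_near_coveringP cK h.
pose F := filter_prod (nbhs c) (nbhs p).
have H : F [set z | K `<=` (fun t => v t z.1 <> z.2)].
  apply: (cK (S * S)%type F (fun z t => v t z.1 <> z.2)) => t Kt.
  have [A [B [An Bn AB]]] := hausdorff_separation hT (h t Kt).
  have [[A1 Y] /= [A1t Yc] hh] := flow_near2 hv An.
  exists (A1, Y `*` B); first by split => //; exists (Y, B).
  move=> [s [u q]] /= [A1s [Yu Bq]] E; apply: (AB q) => //.
  by rewrite -E; exact: (hh (s, u)).
move: H => [[Y U] /= [Yc Up] YU]; exists Y, U; split => // u t Yu Kt Uv.
exact: (YU (u, v t u) (conj Yu Uv) t Kt).
Qed.

(** * A return map that moves a point towards a fixed point *)

Section Trap.
Variables (v : R -> S -> S).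
Hypothesis hv : flow v.
Variables (x : S) (Z : set S) (d : R) (lt : S -> S -> Prop).
Hypothesis os : ordered_section v x Z d lt.
Let ls := os_ls os.
Let po := os_po os.
Let d0 : 0 < d := ls_d ls.

Variables (y p : S) (T : R) (h : S -> S).
Hypotheses (Zy : Z y) (Zp : Z p) (yp : lt y p) (dT : 2 * d <= T).
(** [h] is a return map whose return time [T - tau] may vary with the point. *)
Hypothesis hP : forall u, seg Z lt y p u ->
  Z (h u) /\ exists tau, `|tau| < d /\ v T u = v tau (h u).
Hypotheses (hy : h y = y) (yhp : lt y (h p)) (hpp : lt (h p) p).
Hypothesis np : forall t, 0 < t -> v t p <> p.

Let I : set S := seg Z lt y p.

Let Iy : I y. Proof. by split => //; [left|right]. Qed.
Let Ip : I p. Proof. by split => //; [right|left]. Qed.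
Let IZ u : I u -> Z u. Proof. by case. Qed.
Let hZ u : I u -> Z (h u). Proof. by move/hP => []. Qed.
Let trans := os_trans os.
Let irr := os_irr os.
Let asym u w : Z u -> Z w -> lt u w -> ~ lt w u. Proof. exact: (po_asym po). Qed.

Let hE u : I u -> box v Z d (v T u) /\ box_proj v Z d (v T u) = h u.
Proof.
move=> /hP[Zh [tau [td ->]]]; split; first exact: box_in.
by have [] := box_coordE hv os Zh td.
Qed.

Let h_near u (N : set S) : I u -> nbhs (h u) N -> \forall w \near u, I w -> N (h w).
Proof.
move=> Iu; have [Bu <-] := hE Iu => NN.
have := flow_near hv (box_proj_near hv os Bu NN).
by apply: filterS => w [_ Nw] Iw; have [_ <-] := hE Iw.
Qed.

Let hinj u w : I u -> I w -> h u = h w -> u = w.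
Proof.
move=> Iu Iw E; have [Zu [t1 [t1d E1]]] := hP Iu; have [Zw [t2 [t2d E2]]] := hP Iw.
have E3 : v (T - t1) u = v (T - t2) w.
  rewrite addrC [in RHS]addrC !(flowD hv (- _)) E1 E2 !(flowK hv); exact: E.
have [] // := section_uniq hv os (IZ Iu) (IZ Iw) _ E3.
move: t1d t2d; rewrite !ltr_norml; lra.
Qed.

Let Ibound u w : I w -> Z u -> y = u \/ lt y u -> u = w \/ lt u w -> I u.
Proof.
move=> [Zw yw wp] Zu yu uw; split => //; first by case: yu => [->|]; [left|right].
case: uw => [->//|uw]; right; case: wp => [<-//|wp]; exact: (trans Zu Zw Zp uw wp).
Qed.

(** By injectivity [h] does not take the value [y = h y] between [w] and [p], so [h w] is on the
    same side of [y] as [h p]. *)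
Let h_gt w : I w -> lt y w -> lt y (h w).
Proof.
move=> Iw yw; have [[Zw _ wp] Zhw] := (Iw, hZ Iw).
case: wp => [->//|wp].
have sI : seg Z lt w p `<=` I.
  move=> z [Zz wz zp]; split => //; right; case: wz => [->//|wz]; exact: (trans Zy Zw Zz yw wz).
have gty z : seg Z lt w p z -> lt y z.
  by move=> [Zz [->//|wz] _]; exact: (trans Zy Zw Zz yw wz).
have E : `[< lt y (h w) >] = `[< lt y (h p) >].
  apply: (connected_locally_constant (f := fun z => `[< lt y (h z) >])
    (os_seg_connected os Zw Zp (or_intror wp))).
  - move=> z sz; have Iz := sI _ sz.
    have zy : y <> h z.
      rewrite -{1}hy => /hinj E; have := gty _ sz; rewrite -(E Iy Iz); exact: irr.
    have [h1|h1] := po_total po Zy (hZ Iz) zy.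
      have := h_near Iz (po_nearr po Zy (hZ Iz) h1).
      by apply: filterS => t ht /sI It; rewrite !asboolT//; apply: ht => //; exact: hZ.
    have := h_near Iz (po_nearl po (hZ Iz) Zy h1).
    apply: filterS => t ht /sI It; rewrite !asboolF//.
      exact: (asym (hZ Iz) Zy h1).
    by apply: (asym (hZ It) Zy); apply: ht => //; exact: hZ.
  - by split => //; [left|right].
  - by split => //; [right|left].
by apply/asboolP; rewrite E; exact/asboolP.
Qed.

(** If the order were reversed, [h w] would lie between [h y] and [h u] and be taken between [y] and
    [u], against injectivity. *)
Let h_incr u w : I u -> I w -> lt u w -> lt (h u) (h w).
Proof.
move=> Iu Iw uw; have [Zu yu _] := Iu; have [Zw yw _] := Iw.
have yw' : lt y w by case: yu => [E|yu]; [rewrite -E|exact: (trans Zy Zu Zw yu uw)].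
case: yu => [E|yu]; first by rewrite E hy; exact: h_gt.
have ne : h u <> h w.
  by move=> /hinj E; rewrite (E Iu Iw) in uw; exact: (irr Zw uw).
have [//|h1] := po_total po (hZ Iu) (hZ Iw) ne.
have sI : seg Z lt y u `<=` I.
  move=> z [Zz yz zu]; apply: (Ibound Iu Zz) => //; by case: yz => [->|]; [left|right].
have cI : connected (h @` seg Z lt y u).
  apply: connected_continuous_connected; first exact: (os_seg_connected os Zy Zu (or_intror yu)).
  by apply/within_continuousP => z N /sI Iz /(h_near Iz); apply: filterS => t ht /sI; exact: ht.
have : (h @` seg Z lt y u) (h w).
  apply: (connected_convex po cI _ _ _ (hZ Iw) (h_gt Iw yw') h1).
  - by move=> _ [z /sI Iz <-]; exact: hZ.
  - by exists y => //; split => //; [left|right].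
  - by exists u => //; split => //; [right|left].
move=> [z sz] /hinj E; have zw := E (sI _ sz) Iw; case: sz => _ _; rewrite zw => -[wu|wu].
  by rewrite wu in uw; case: (irr Zu uw).
by case: (asym Zu Zw uw wu).
Qed.

Let hI u : I u -> I (h u).
Proof.
move=> Iu; have [Zu yu up] := Iu; split; first exact: hZ.
  case: yu => [->|yu]; first by left.
  by right; exact: h_gt.
right; case: up => [->//|up].
by apply: (trans (hZ Iu) (hZ Ip) Zp) => //; exact: h_incr.
Qed.

Let P n := iter n h p.

Let PI n : I (P n). Proof. by elim: n => //= n; exact: hI. Qed.

Let P_decr n : lt (P n.+1) (P n).
Proof. by elim: n => [//|n IH]; exact: (h_incr (PI n.+1) (PI n) IH). Qed.

Let P_decr' m n : (m < n)%N -> lt (P n) (P m).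
Proof.
elim: n => // n IH; rewrite ltnS leq_eqVlt => /orP[/eqP->|/IH h1]; first exact: P_decr.
by apply: trans h1; [exact/IZ/PI|exact/IZ/PI|exact/IZ/PI|exact: P_decr].
Qed.

Let P_time n : exists2 s, 0 <= s & P n = v s p.
Proof.
elim: n => [|n [s s0 E]]; first by exists 0 => //; rewrite (flow0 hv).
have [_ [tau [td E1]]] := hP (PI n).
exists (T - tau + s); first by move: d0 dT td; rewrite ltr_norml; lra.
by rewrite (flowD hv) -E addrC (flowD hv) E1 (flowK hv).
Qed.

(** A cluster point of the iterates exists in [S] by compactness and lies in every segment from [y]
    to [P n], these being closed. A connected neighbourhood in the section contains whole segments,
    which turns the cluster point of a decreasing sequence into a limit. *)
Let limit_exists : exists2 c, I c & (forall n, lt c (P n)) /\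
  forall N : set S, nbhs c N -> exists n, seg Z lt c (P n) `<=` N.
Proof.
have [c [_ cc]] : exists c, [set: S] c /\ cluster (P @ \oo) c.
  by apply: hcpt; exact: filterT.
have cP n : seg Z lt y (P n) c.
  have cl := os_closed os Zy (IZ (PI n)).
  rewrite (iffLR (closure_id _) cl) => N Nc.
  have : (P @ \oo) (seg Z lt y (P n)).
    exists n => // m /= nm; split; first exact/IZ/PI.
      by have [_ [->|]] := PI m; [left|right].
    by move: nm; rewrite leq_eqVlt => /orP[/eqP->|/P_decr']; [left|right].
  by move=> /(cc _ N) /(_ Nc).
have Zc : Z c by have [] := cP 0%N.
exists c; first by have [? ? ?] := cP 0%N; split.
have clt n : lt c (P n).
  have [_ _ [->|h1]] := cP n.+1; first exact: P_decr.
  by apply: (trans Zc (IZ (PI n.+1)) (IZ (PI n)) h1); exact: P_decr.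
split => // N Nc.
have [C [cC CZ CN Cc nC]] := section_locally_connected hv hS os Zc Nc.
have [z0 [[n _ <-] CPn]] : (range P `&` [set z | Z z -> C z]) !=set0.
  by apply: cc => //; exists 0%N => // m _ /=; exists m.
exists n => z [Zz cz zP]; apply: CN.
have CP := CPn (IZ (PI n)).
case: cz => [->//|cz]; case: zP => [->//|zP].
exact: (connected_convex po cC CZ Cc CP Zz cz zP).
Qed.

(* The iterates of p under the return map decrease to a periodic point c, and the
   orbits of all points near p end up close to the orbit of c, away from p. *)
Lemma trapped : ~ returns v p.
Proof.
have [c Ic [cP climit]] := limit_exists; have Zc := IZ Ic.
have hc : h c = c.
  apply: contrapT => hc.
  have [h1|h1] := po_total po (hZ Ic) Zc hc.
    have [n sn] := climit _ (h_near Ic (po_nearl po (hZ Ic) Zc h1)).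
    have : seg Z lt c (P n) (P n) by split; [exact/IZ/PI|right; exact: cP|left].
    move=> /sn /(_ (PI n)) h2; have := h2 (hZ (PI n)).
    by move=> h3; exact: (asym (IZ (PI n.+1)) Zc h3 (cP n.+1)).
  have [n sn] := climit _ (po_nearl po Zc (hZ Ic) h1).
  have : seg Z lt c (P n) (P n) by split; [exact/IZ/PI|right; exact: cP|left].
  move=> /sn /(_ (IZ (PI n))) h2.
  have h3 : lt (h c) (P n) by apply: (trans (hZ Ic) (IZ (PI n.+1)) (IZ (PI n)) _ (P_decr n)); exact: h_incr.
  exact: (asym (IZ (PI n)) (hZ Ic) h2 h3).
have [_ [tau [td Ec]]] := hP Ic; rewrite hc in Ec.
pose per := T - tau.
have per0 : 0 < per by rewrite /per; move: d0 dT td; rewrite ltr_norml; lra.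
have vper : v per c = c by rewrite /per addrC (flowD hv) Ec (flowK hv).
have pc r : v r c <> p.
  by move=> E; apply: (np per0); rewrite -E -(flowD hv) addrC (flowD hv) vper.
(* [T + d] bounds every return time [T - r], where [r] is below [d] in absolute value. *)
have [Y [U [Yc Up YU]]] := avoid_tube hv (segment_compact (a := 0) (b := T + d)) (fun t _ => pc t).
have [n0 n0Y] := climit _ Yc.
pose A := seg Z lt c (P n0).
have AI u : A u -> I u.
  move=> [Zu cu uP]; apply: (Ibound (PI n0) Zu) => //.
  have [_ yc _] := Ic.
  case: cu => [->|cu]; first by case: yc => [->|]; [left|right].
  by right; case: yc => [<-//|yc]; exact: (trans Zy Zc Zu yc cu).
have hA u : A u -> A (h u).
  move=> Au; have Iu := AI _ Au; have [Zu cu uP] := Au; split; first exact: hZ.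
    case: cu => [->|cu]; first by left.
    by right; rewrite -hc; exact: h_incr.
  right; case: uP => [->|uP]; first exact: (P_decr n0).
  by apply: (trans (hZ Iu) (IZ (PI n0.+1)) (IZ (PI n0)) _ (P_decr n0)); exact: (h_incr Iu (PI n0)).
(* Since [2 * d <= T], each return takes more than [d], so one unit of [n] pays for one return. *)
have avoidA (n : nat) : forall u t, A u -> 0 <= t -> t < n%:R * d -> ~ U (v t u).
  elim: n => [u t _ t0|n IH u t Au t0 tn]; first by rewrite mul0r ltNge t0.
  have [tT|tT] := leP t (T + d).
    by apply: YU; [exact: n0Y|rewrite /= in_itv /= t0].
  have [_ [r [rd Er]]] := hP (AI _ Au).
  have -> : v t u = v (t - (T - r)) (h u).
    have -> : h u = v (T - r) u by rewrite addrC (flowD hv) Er (flowK hv).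
    by rewrite -(flowD hv) subrK.
  move: d0 dT rd tn; rewrite ltr_norml -natr1 mulrDl mul1r => d0' dT' rd tn.
  by apply: IH; [exact: hA|lra|lra].
have avoidA' u t : A u -> 0 <= t -> ~ U (v t u).
  move=> Au t0; apply: (avoidA (Num.bound (t / d))) => //.
  rewrite -ltr_pdivrMr//; apply: archi_boundP; exact: divr_ge0 (ltW d0).
(* [P n0.+1], unlike [P n0], lies strictly between the ends of [A]; points near [p] therefore
   project into [A] after time [s]. *)
have [s s0 Ps] := P_time n0.+1.
have Bs : box v Z d (v s p) by rewrite -Ps; apply: (section_box hv os); exact/IZ/PI.
have pjs : box_proj v Z d (v s p) = P n0.+1.
  by rewrite -Ps; have [] := section_coord hv os (IZ (PI n0.+1)).
have nA : nbhs (box_proj v Z d (v s p)) [set z | Z z -> A z].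
  rewrite pjs.
  have h1 := po_nearr po Zc (IZ (PI n0.+1)) (cP n0.+1).
  have h2 := po_nearl po (IZ (PI n0.+1)) (IZ (PI n0)) (P_decr n0).
  by apply: filterS2 h1 h2 => z z1 z2 Zz; split => //; right; [exact: z1|exact: z2].
have nU := flow_near hv (box_proj_near hv os Bs nA).
have nUU : \forall w \near p, U w /\ forall t, s + d <= t -> ~ U (v t w).
  apply: filterS2 Up nU => w Uw [Bw Aw]; split => // t st.
  have [Zw rd Ew] := box_coordP Bw.
  have -> : v t w = v (t - s + box_time v Z d (v s w)) (box_proj v Z d (v s w)).
    by rewrite (flowD hv) Ew -(flowD hv) subrK.
  by apply: avoidA'; [exact: Aw|move: rd; rewrite ltr_norml; lra].
(* A return at a negative time is also excluded: the point [v t p] is then near [p] and reaches [p]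
   itself after the large positive time [- t]. *)
move=> /(_ (s + d) _ nUU)[t [st [Ut ht]]].
have [t0|t0] := leP 0 t.
  have [_] := nbhs_singleton nUU; move=> /(_ t); rewrite ger0_norm// in st.
  by move=> /(_ (ltW st)).
rewrite ltr0_norm// in st.
apply: (ht (- t) (ltW st)); rewrite (flowK hv); exact: nbhs_singleton Up.
Qed.

End Trap.
End PeriodicOrbits.

(** * Points near a periodic orbit *)

Section PeriodicNeighbourhood.
Variables (R : realType) (S : topologicalType) (v : R -> S -> S).
Hypotheses (hv : flow v) (hS : surface R S) (hcpt : compact [set: S]).

Lemma returns_flow s p : returns v p -> returns v (v s p).
Proof.
move=> rp n U /(flow_near hv)/(rp n)[t [nt Ut]]; exists t; split => //.
by rewrite -(flowD hv) addrC (flowD hv).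
Qed.

Lemma closed_pt_flow s p : closed_pt v p -> closed_pt v (v s p).
Proof.
have per t : v t p = p -> v t (v s p) = v s p.
  by move=> E; rewrite -(flowD hv) addrC (flowD hv) E.
move=> [sp|[nsp [T [T0 vT]]]]; first by left => t; exact: per.
right; split; last by exists T; split => //; exact: per.
move=> sing; apply: nsp => t; have := sing t.
rewrite -(flowD hv) addrC (flowD hv) => /(congr1 (v (- s))).
by rewrite !(flowK hv).
Qed.

Lemma nonclosed_aperiodic p : ~ closed_pt v p -> forall t, 0 < t -> v t p <> p.
Proof.
move=> ncp t t0 E; apply: ncp; have [sp|nsp] := pselect (singular_pt v p); first by left.
by right; split => //; exists t.
Qed.

Section OneSide.
Variables (y : S) (Z : set S) (d : R) (lt : S -> S -> Prop).
Hypothesis os : ordered_section v y Z d lt.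
Let ls := os_ls os.
Let po := os_po os.
Let d0 : 0 < d := ls_d ls.
Variables (T : R) (C : set S).
Hypotheses (T0 : 0 < T) (vTy : v T y = y).
Hypotheses (cC : connected C) (CZ : C `<=` Z) (Cy : C y).
Hypothesis Cnear : \forall u \near y, Z u -> C u.

Let ret s u := box_proj v Z d (v s u).
Let inbox s := forall u, C u -> box v Z d (v s u).

Let dT : 2 * d <= T.
Proof.
rewrite leNgt; apply/negP => Td.
have := ls_inj ls (ls_x ls) (ls_x ls) _ vTy.
rewrite gtr0_norm// => /(_ Td) E; by have := T0; rewrite E ltxx.
Qed.

Let retP s u : inbox s -> C u -> [/\ Z (ret s u), `|box_time v Z d (v s u)| < d &
  v s u = v (box_time v Z d (v s u)) (ret s u)].
Proof. by move=> bs /bs/box_coordP[]. Qed.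

Let ret_cont s : inbox s -> {within C, continuous (ret s)}.
Proof.
move=> bs; apply/within_continuousP => u N Cu NN.
have := flow_near hv (box_proj_near hv os (bs _ Cu) NN).
by apply: filterS => w [].
Qed.

Let ret_inj s u w : inbox s -> C u -> C w -> ret s u = ret s w -> u = w.
Proof.
move=> bs Cu Cw E; have [Zu t1d E1] := retP bs Cu; have [Zw t2d E2] := retP bs Cw.
have E3 : v (s - box_time v Z d (v s u)) u = v (s - box_time v Z d (v s w)) w.
  by rewrite addrC [in RHS]addrC !(flowD hv (- _)) {2}E1 {2}E2 !(flowK hv).
have [] // := section_uniq hv os (CZ Cu) (CZ Cw) _ E3.
by move: t1d t2d; rewrite !ltr_norml; lra.
Qed.

Let ret_y s : v s y = y -> ret s y = y.
Proof. by move=> E; rewrite /ret E; have [] := section_coord hv os (ls_x ls). Qed.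

Let dich s : inbox s -> side_preserving C (ret s) lt y \/ side_reversing C (ret s) lt y.
Proof.
move=> bs; apply: (side_dichotomy (ls_connected ls) CZ) => //.
- by move=> u Cu; have [] := retP bs Cu.
- exact: ret_cont.
- by move=> u w; exact: ret_inj.
Qed.

Hypotheses (b1 : inbox T) (b2 : inbox (T + T)) (b3 : inbox (- (T + T))).
Variable p : S.
Hypotheses (Cp : C p) (yp : lt y p).

Let Zy : Z y := ls_x ls.
Let Zp : Z p := CZ Cp.
Let irr := os_irr os.
Let asym u w : Z u -> Z w -> lt u w -> ~ lt w u. Proof. exact: (po_asym po). Qed.
Let vT2y : v (T + T) y = y. Proof. by rewrite (flowD hv) vTy. Qed.
Let vNT2y : v (- (T + T)) y = y. Proof. by rewrite -{1}vT2y (flowK hv). Qed.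

Let ret_near s : v s y = y -> \forall u \near y,
  `|box_time v Z d (v s u)| < d / 2 /\ (Z (ret s u) -> C (ret s u)).
Proof.
move=> E; have By : box v Z d (v s y) by rewrite E; exact: (section_box hv os).
have [py ty] : box_proj v Z d (v s y) = y /\ box_time v Z d (v s y) = 0.
  by rewrite E; exact: (section_coord hv os).
have d20 : 0 < d / 2 by rewrite divr_gt0.
have h1 := flow_near hv (box_time_near hv os By d20).
have : nbhs (box_proj v Z d (v s y)) [set u | Z u -> C u] by rewrite py.
move=> /(box_proj_near hv os By)/(flow_near hv) h2.
by apply: filterS2 h1 h2 => u [_ u1] [_ u2]; split => //; move: u1; rewrite ty sub0r normrN.
Qed.

(** Two turns are the square of one turn, and a square preserves sides whether or not one turn does.
    A single point [u] above [y] decides; it is taken so close to [y] that both single turns stay in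
    [C] and their box times add up. *)
Let ret2_gt : side_preserving C (ret (T + T)) lt y.
Proof.
have [//|[_ rv]] := dich b2.
have n1 := ret_near vTy.
have n2 : nbhs (box_proj v Z d (v T y)) [set u | `|box_time v Z d (v T u)| < d / 2].
  rewrite -/(ret T y) (ret_y vTy); by apply: filterS n1 => u [].
have By : box v Z d (v T y) by rewrite vTy; exact: (section_box hv os).
have n3 := flow_near hv (box_proj_near hv os By n2).
have [u [Zu [[[t1 cr] Cu] [_ t2]] yu up]] := section_between os Zy Zp yp (filterI (filterI n1 Cnear) n3).
have {}Cu := Cu Zu.
have {}t2 : `|box_time v Z d (v T (ret T u))| < d / 2 := t2.
have [Zr1 _ E1] := retP b1 Cu; have {}cr := cr Zr1.
have [Zr2 _ E2] := retP b1 cr; have [Zr3 t3 E3] := retP b2 Cu.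
have E4 : v (box_time v Z d (v (T + T) u)) (ret (T + T) u) =
    v (box_time v Z d (v T u) + box_time v Z d (v T (ret T u))) (ret T (ret T u)).
  move: (box_time v Z d (v T u)) E1 (box_time v Z d (v T (ret T u))) E2 => s1 E1 s2 E2.
  rewrite -E3 (flowD hv T T) E1 -(flowD hv T s1) (addrC T) (flowD hv s1 T) E2.
  by rewrite (flowD hv).
have [E5 _] : ret (T + T) u = ret T (ret T u) /\ box_time v Z d (v (T + T) u) =
    box_time v Z d (v T u) + box_time v Z d (v T (ret T u)).
  apply: (section_uniq hv os Zr3 Zr2 _ E4).
  by move: t1 t2 t3; rewrite !ltr_norml; lra.
have ff : lt y (ret T (ret T u)).
  have [[pl pr]|[pl pr]] := dich b1; rewrite (ret_y vTy) in pl pr.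
    exact: (pr _ cr (pr _ Cu yu)).
  exact: (pl _ cr (pr _ Cu yu)).
have := rv u Cu yu; rewrite (ret_y vT2y) E5 => fl.
by case: (asym Zy Zr2 ff fl).
Qed.

(** Two turns backwards undo two turns forwards, and the latter preserve sides. *)
Let ret3_gt : side_preserving C (ret (- (T + T))) lt y.
Proof.
have [//|[_ rv]] := dich b3.
have n1 := ret_near vT2y.
have [u [Zu [[_ cr] Cu] yu up]] := section_between os Zy Zp yp (filterI n1 Cnear).
have {}Cu := Cu Zu.
have [Zr1 t1 E1] := retP b2 Cu; have {}cr := cr Zr1.
have [Zr2 t2 E2] := retP b3 cr.
have gt1 : lt y (ret (T + T) u) by have [_ /(_ u Cu yu)] := ret2_gt; rewrite (ret_y vT2y).
have E : v 0 u = v (box_time v Z d (v (T + T) u) + box_time v Z d (v (- (T + T)) (ret (T + T) u)))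
    (ret (- (T + T)) (ret (T + T) u)).
  move: (box_time v Z d (v (T + T) u)) E1 (box_time v Z d (v (- (T + T)) (ret (T + T) u))) E2.
  move=> s1 E1 s2 E2; rewrite (flowD hv s1 s2) -E2 -(flowD hv s1) (addrC s1) (flowD hv _ s1).
  by rewrite -E1 (flowK hv) (flow0 hv).
have [|E5 _] := section_uniq hv os Zu Zr2 _ E.
  by move: t1 t2; rewrite sub0r normrN !ltr_norml; lra.
have := rv _ cr gt1; rewrite (ret_y vNT2y) -E5.
by move=> uy; case: (asym Zy Zu yu uy).
Qed.

(** An aperiodic [p] is moved by two turns. Either the forward map brings it closer to [y], or the
    backward map does; [trapped] applies to the flow or to its reversal. *)
Lemma one_side_not_returning : ~ closed_pt v p -> ~ returns v p.
Proof.
move=> ncp rp; have ap := nonclosed_aperiodic ncp.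
have T2d : 2 * d <= T + T by move: T0 dT; lra.
have ap' t : t != 0 -> v t p <> p.
  rewrite neq_lt => /orP[t0|t0]; last exact: ap.
  move=> E; apply: (ap (- t)); first by rewrite oppr_gt0.
  by rewrite -{1}E (flowK hv).
have sC : seg Z lt y p `<=` C.
  move=> z [Zz [->//|yz] [->//|zp]]; exact: (connected_convex po cC CZ Cy Cp Zz yz zp).
have retne s : `|s| = T + T -> inbox s -> ret s p <> p.
  move=> sT bs E; have [_ td Es] := retP bs Cp; rewrite E in Es.
  move: (box_time v Z d (v s p)) td Es => tau td Es.
  apply: (ap' (s - tau)).
    rewrite subr_eq0; apply/eqP => st; move: td; rewrite -st sT; move: d0 T2d; lra.
  by rewrite addrC (flowD hv) Es (flowK hv).
have [_ gt2] := ret2_gt; have [_ gt3] := ret3_gt.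
rewrite (ret_y vT2y) in gt2; rewrite (ret_y vNT2y) in gt3.
have [Zr2 t2 E2] := retP b2 Cp; have [Zr3 t3 E3] := retP b3 Cp.
have TT0 : 0 < T + T by rewrite addr_gt0.
have n2 : ret (T + T) p <> p by apply: retne => //; rewrite gtr0_norm.
have n3 : ret (- (T + T)) p <> p by apply: retne => //; rewrite normrN gtr0_norm.
have [lt2|lt2] := po_total po Zr2 Zp n2.
  apply: (trapped hS hcpt hv os Zy Zp yp T2d (h := ret (T + T))) rp => //.
  - move=> u /sC Cu; have [Zr td E] := retP b2 Cu; split => //.
    by exists (box_time v Z d (v (T + T) u)).
  - exact: ret_y.
  - exact: gt2.
(* If the backward map also moved [p] away from [y], it would take the value [p] at some [q] between
   [y] and [p]. Then [q] is the forward image of [p], which lies beyond [p]. *)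
have lt3 : lt (ret (- (T + T)) p) p.
  have [//|pr] := po_total po Zr3 Zp n3.
  have cI : connected (ret (- (T + T)) @` seg Z lt y p).
    apply: connected_continuous_connected; first exact: (os_seg_connected os Zy Zp (or_intror yp)).
    apply/within_continuousP => z N /sC Cz Nz.
    have := iffLR (within_continuousP _ _) (ret_cont b3) z N Cz Nz.
    by apply: filterS => t ht /sC; exact: ht.
  have : (ret (- (T + T)) @` seg Z lt y p) p.
    apply: (connected_convex po cI _ _ _ Zp yp pr).
    - by move=> _ [z /sC Cz <-]; have [] := retP b3 Cz.
    - by exists y; [split => //; [left|right]|exact: ret_y].
    - by exists p => //; split => //; [right|left].
  move=> [q sq qp]; have Cq := sC _ sq; have Zq := CZ Cq.
  have [_ tq Eq] := retP b3 Cq; rewrite qp in Eq.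
  have E4 : v (box_time v Z d (v (T + T) p)) (ret (T + T) p) =
      v (- box_time v Z d (v (- (T + T)) q)) q.
    move: (box_time v Z d (v (- (T + T)) q)) Eq => s1 Eq; rewrite -E2.
    have -> : q = v (T + T) (v s1 p) by rewrite -Eq (flowNK hv).
    by rewrite -!(flowD hv); congr (v _ p); lra.
  have [E5 _] : ret (T + T) p = q /\ box_time v Z d (v (T + T) p) = - box_time v Z d (v (- (T + T)) q).
    apply: (section_uniq hv os Zr2 Zq _ E4).
    by move: t2 tq; rewrite opprK !ltr_norml; lra.
  rewrite E5 in lt2; case: sq => _ _ [qp'|qp']; last by case: (asym Zp Zq lt2 qp').
  by rewrite qp' in lt2; case: (irr Zp lt2).
have rv := os_rev os.
apply: (trapped hS hcpt (flow_rev hv) rv Zy Zp yp T2d (h := ret (- (T + T)))) => //.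
- move=> u /sC Cu; have [Zr td E] := retP b3 Cu; split => //.
  by exists (- box_time v Z d (v (- (T + T)) u)); rewrite normrN opprK.
- exact: ret_y.
- exact: gt3.
- by move=> t t0; apply: ap'; rewrite oppr_eq0 gt_eqF.
- move=> n U /(rp n)[t [nt Ut]]; exists (- t); by rewrite normrN opprK.
Qed.

End OneSide.

Lemma periodic_nbhd (y : S) : periodic_pt v y ->
  \forall p \near y, returns v p -> closed_pt v p.
Proof.
move=> [nsy [T [T0 vTy]]].
have [Z [d [lt os]]] := ordered_section_exists hv hS hcpt nsy.
have ls := os_ls os; have Zy := ls_x ls.
have nb s : v s y = y -> \forall u \near y, box v Z d (v s u).
  move=> E; apply: (flow_near hv); rewrite E; apply: open_nbhs_nbhs.
  by split; [exact: (box_open os)|exact: (section_box hv os)].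
have vT2y : v (T + T) y = y by rewrite (flowD hv) vTy.
have vNT2y : v (- (T + T)) y = y by rewrite -{1}vT2y (flowK hv).
have nN : \forall u \near y, [/\ box v Z d (v T u), box v Z d (v (T + T) u) &
    box v Z d (v (- (T + T)) u)].
  by apply: filterS3 (nb _ vTy) (nb _ vT2y) (nb _ vNT2y) => u; split.
have [C [cC CZ CN Cy Cnear]] := section_locally_connected hv hS os Zy nN.
have By : box v Z d y by exact: (section_box hv os).
have [py _] := section_coord hv os Zy.
have : \forall q \near y, box v Z d q /\ (Z (box_proj v Z d q) -> C (box_proj v Z d q)).
  by apply: (box_proj_near hv os By (N := [set q | Z q -> C q])); rewrite py.
apply: filterS => q [Bq Cq] rq; have [Zp td E] := box_coordP Bq.
set p := box_proj v Z d q in Zp E Cq *; have Cp := Cq Zp.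
rewrite -E; apply: closed_pt_flow.
have rp : returns v p.
  have -> : p = v (- box_time v Z d q) q by rewrite -{2}E (flowK hv).
  exact: returns_flow.
have [<-|yp] := pselect (y = p); first by right; split => //; exists T.
apply: contrapT => ncp.
have [lt1|lt1] := po_total (os_po os) Zy Zp yp.
  apply: (one_side_not_returning os T0 vTy cC CZ Cy Cnear _ _ _ Cp lt1 ncp rp).
  - by move=> u /CN[].
  - by move=> u /CN[].
  - by move=> u /CN[].
apply: (one_side_not_returning (os_flip os) T0 vTy cC CZ Cy Cnear _ _ _ Cp lt1 ncp rp).
- by move=> u /CN[].
- by move=> u /CN[].
- by move=> u /CN[].
Qed.

End PeriodicNeighbourhood.

(** * Loops through a gap *)

Section LoopTorsor.
Variables (R : realType) (S : topologicalType) (v : R -> S -> S).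
Hypotheses (hv : flow v) (hS : surface R S) (hcpt : compact [set: S]).
Let hT : hausdorff_space S := hS.1.
Variables (x : S) (Z : set S) (d : R) (lt : S -> S -> Prop).
Hypothesis os : ordered_section v x Z d lt.
Let ls := os_ls os.
Let po := os_po os.
Let d0 : 0 < d := ls_d ls.

Variables (z : S) (s : R) (G : set S).
Let z' := v s z.
Let J : set S := seg Z lt z z' `|` seg Z lt z' z.
Hypotheses (Zz : Z z) (Zz' : Z z') (s0 : 0 < s) (JG : J `<=` G).
Hypothesis noG : forall q, 0 < q < s -> ~ G (v q z).

Let orb (a b : R) : set S := [set v q z | q in `[a, b]].
Let loop : set S := orb 0 s `|` J.

Let proj := box_proj v Z d.
Let time := box_time v Z d.

Let orbP a b q : a <= q <= b -> orb a b (v q z).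
Proof. by move=> h; exists q => //=; rewrite in_itv. Qed.

Let orbE a b y : orb a b y -> exists2 q, a <= q <= b & v q z = y.
Proof. by move=> [q /=]; rewrite in_itv /= => h <-; exists q. Qed.

Let orb_closed a b : closed (orb a b).
Proof.
apply: compact_closed => //; apply: continuous_compact; last exact: segment_compact.
by apply: continuous_subspaceT => t N; exact: (flow_near_time hv).
Qed.

Let J_closed : closed J.
Proof. by apply: closedU; exact: (os_closed os). Qed.

Lemma loop_closed : closed loop.
Proof. by apply: closedU; [exact: orb_closed|exact: J_closed]. Qed.

Let irr := os_irr os.
Let asym u w : Z u -> Z w -> lt u w -> ~ lt w u. Proof. exact: (po_asym po). Qed.

Let zz'_cases : z = z' \/ lt z z' \/ lt z' z.
Proof.
have [->|ne] := pselect (z = z'); first by left.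
by right; exact: (po_total po).
Qed.

Let Jz : J z.
Proof.
have [E|[h|h]] := zz'_cases.
- by left; split => //; left.
- by left; split => //; [left|right].
- by right; split => //; [right|left].
Qed.

Let Jz' : J z'.
Proof.
have [E|[h|h]] := zz'_cases.
- by left; split => //; left.
- by left; split => //; [right|left].
- by right; split => //; [left|right].
Qed.

Let outJ w : Z w -> ~ J w -> (lt w z /\ lt w z') \/ (lt z w /\ lt z' w).
Proof.
move=> Zw nJ.
have wz : w <> z by move=> E; apply: nJ; rewrite E.
have wz' : w <> z' by move=> E; apply: nJ; rewrite E.
have [h1|h1] := po_total po Zw Zz wz; have [h2|h2] := po_total po Zw Zz' wz'.
- by left.
- by case: nJ; right; split => //; right.
- by case: nJ; left; split => //; right.
- by right.
Qed.

Let s2d : 2 * d <= s.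
Proof.
rewrite leNgt; apply/negP => sd.
have := ls_inj ls (t := s) Zz' Zz; rewrite gtr0_norm// => /(_ sd erefl) E.
by have := s0; rewrite E ltxx.
Qed.

(** A repetition would make [z], a point of [J] and so of [G], come back before time [s]. *)
Let orb_inj q q' : 0 < q < s -> 0 < q' < s -> v q z = v q' z -> q = q'.
Proof.
have key a b : a < b -> 0 < a -> b < s -> v a z = v b z -> False.
  move=> ab a0 bs E; apply: (noG (q := b - a)); first by lra.
  have -> : v (b - a) z = z by rewrite addrC (flowD hv) -E (flowK hv).
  exact: JG.
move=> /andP[q0 qs] /andP[q'0 q's] E; have [h|h|//] := ltgtP q q'.
  by case: (key _ _ h q0 q's E).
by case: (key _ _ h q'0 qs (esym E)).
Qed.

Let orb_notJ q : 0 < q < s -> ~ J (v q z).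
Proof. by move=> qs /JG; exact: noG. Qed.

(** This height keeps the times [r - dr r] and [r + dr r] within [[0, s]]. Once the rest of the loop
    is removed, as in [Nr], the loop appears near [v r z] as the single flow line over [z]. *)
Let dr (r : R) := Num.min d (Num.min r (s - r)).
Let Nr (r : R) : set S := [set a | flow_box v Z setT (dr r) (v (- r) a)] `&`
  ~` (orb 0 (r - dr r) `|` orb (r + dr r) s `|` J).
Let psir (r : R) (a : S) : bool := `[< lt (proj (v (- r) a)) z >].

Let drP r : 0 < r < s -> [/\ 0 < dr r, dr r <= d, dr r <= r & dr r <= s - r].
Proof.
move=> /andP[r0 rs]; rewrite /dr !lt_min !ge_min !lexx !orbT /= d0 r0 subr_gt0 rs.
by split.
Qed.

Let Nr_box r a : 0 < r < s -> Nr r a -> box v Z d (v (- r) a).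
Proof.
move=> /drP[_ drd _ _] [[u [t [Zu _ td <-]]] _].
by apply: box_in => //; rewrite (lt_le_trans td).
Qed.

Let Nr_open r : 0 < r < s -> open (Nr r).
Proof.
move=> rs; have [d1 d2 d3 d4] := drP rs; apply: openI.
  rewrite openE => a /= h; apply: (flow_near hv); apply: open_nbhs_nbhs; split => //.
  by apply: (ls_open ls); [exact: openT|rewrite d1].
apply: closed_openC; apply: closedU => //; apply: closedU; exact: orb_closed.
Qed.

Let Nr_loop r a : 0 < r < s -> Nr r a -> loop a -> exists q, [/\ 0 < q < s, `|q - r| < dr r,
  v q z = a & proj (v (- r) a) = z /\ time (v (- r) a) = q - r].
Proof.
move=> rs [_ nG] [/orbE[q /andP[q0 qs] E]|Ja]; last by case: nG; right.
have [d1 d2 d3 d4] := drP rs.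
have qr : `|q - r| < dr r.
  rewrite ltr_norml ltrBrDr ltrBlDr !ltNge; apply/andP; split; apply/negP => h; apply: nG.
    by left; left; rewrite -E; apply: orbP; rewrite q0 /=; lra.
  by left; right; rewrite -E; apply: orbP; rewrite qs andbT; lra.
exists q; split => //.
  by move: qr; rewrite ltr_norml; lra.
by rewrite -E -(flowD hv) addrC; apply: (box_coordE hv os) => //; rewrite (lt_le_trans qr).
Qed.

Let near_side (h : S -> S) (a w : S) : Z (h a) -> Z w -> h a <> w ->
  (forall N : set S, nbhs (h a) N -> \forall b \near a, Z (h b) /\ N (h b)) ->
  (lt (h a) w /\ \forall b \near a, lt (h b) w) \/ (lt w (h a) /\ \forall b \near a, lt w (h b)).
Proof.
move=> Zh Zw ne hc; have [h1|h1] := po_total po Zh Zw ne; [left|right]; split => //.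
  by apply: filterS (hc _ (po_nearl po Zh Zw h1)) => b [Zb]; exact.
by apply: filterS (hc _ (po_nearr po Zw Zh h1)) => b [Zb]; exact.
Qed.

Let proj_near a (N : set S) : box v Z d a -> nbhs (proj a) N ->
  \forall b \near a, Z (proj b) /\ N (proj b).
Proof.
move=> Ba Na; apply: filterS (box_proj_near hv os Ba Na) => b [Bb Nb]; split => //.
by have [] := box_coordP Bb.
Qed.

Let projr_near r a (N : set S) : box v Z d (v (- r) a) -> nbhs (proj (v (- r) a)) N ->
  \forall b \near a, Z (proj (v (- r) b)) /\ N (proj (v (- r) b)).
Proof. by move=> Ba /(proj_near Ba)/(flow_near hv). Qed.

Let psir_const r a : 0 < r < s -> Nr r a -> ~ loop a -> \forall b \near a, psir r b = psir r a.
Proof.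
move=> rs Na nl; have Ba := Nr_box rs Na; have [Zp pt E] := box_coordP Ba.
have ne : proj (v (- r) a) <> z.
  move=> pz; apply: nl; left.
  have [d1 d2 d3 d4] := drP rs.
  have [[u [t [Zu _ td Eu]]] _] := Na.
  have [pu tu] := box_coordE hv os Zu (lt_le_trans td d2).
  have uz : u = z by rewrite -pu Eu.
  have -> : a = v (r + t) z by rewrite (flowD hv) -uz Eu (flowNK hv).
  by apply: orbP; move: td; rewrite ltr_norml; lra.
have [[h1 h2]|[h1 h2]] := near_side (h := fun b => proj (v (- r) b)) Zp Zz ne
    (fun N => @projr_near r a N Ba).
  by apply: filterS h2 => b hb; rewrite /psir !asboolT.
have ZT : \forall b \near a, Z (proj (v (- r) b)).
  apply: (@flow_near _ _ _ hv _ a [set b | Z (proj b)]).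
  by apply: filterS (open_nbhs_nbhs (conj (box_open os) Ba)) => b /box_coordP[].
apply: filterS2 h2 ZT => b hb Zb.
by rewrite /psir !asboolF//; [exact: (asym Zz Zp h1)|exact: (asym Zz Zb hb)].
Qed.

Let psir_agree r r' a : 0 < r < s -> 0 < r' < s -> Nr r a -> Nr r' a -> loop a ->
  \forall b \near a, psir r b = psir r' b.
Proof.
move=> rs rs' Na Na' la.
have [q [qs qr qa [pq tq]]] := Nr_loop rs Na la; have [q' [q's q'r q'a [pq' tq']]] := Nr_loop rs' Na' la.
have qq : q = q' by apply: orb_inj => //; rewrite qa q'a.
have [e1 e2 e3 e4] := drP rs'; have Ba := Nr_box rs Na.
have qr' : `|q - r'| < d by rewrite qq (lt_le_trans q'r).
have e0 : 0 < d - `|q - r'| by rewrite subr_gt0.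
apply: filterS (flow_near hv (box_time_near hv os Ba e0)) => b [Bb tb].
have [Zb tbd Eb] := box_coordP Bb.
rewrite /psir; suff -> : proj (v (- r') b) = proj (v (- r) b) by [].
have Eb' : v (- r') b = v (time (v (- r) b) + r - r') (proj (v (- r) b)).
  by rewrite addrC (flowD hv) addrC (flowD hv) Eb (flowNK hv).
rewrite Eb'; have [] // := @box_coordE _ _ _ hv _ _ _ _ os _ (time (v (- r) b) + r - r') Zb.
have -> : time (v (- r) b) + r - r' = (time (v (- r) b) - time (v (- r) a)) + (q - r') by rewrite tq; lra.
have tb' : `|time (v (- r) b) - time (v (- r) a)| < d - `|q - r'| by rewrite distrC.
by apply: le_lt_trans (ler_normD _ _) _; lra.
Qed.

(* [loop] is the orbit arc from z to z' closed up by the piece J of the section; the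
   torsor is the one dual to it, with a chart N2 around J and charts Nr around the
   points v r z. If the return map reverses sides at z, the non-strict inequality
   makes psi2 and psir differ by a constant on the orbit arc as well. *)
Let N2 : set S := box v Z d `&` ~` orb d (s - d).
Let psi2 (pres : bool) (a : S) : bool :=
  if 0 <= time a then `[< lt (proj a) z >]
  else if pres then `[< lt (proj a) z' >] else `[< lt (proj a) z' \/ proj a = z' >].

Let time_near a (e : R) : box v Z d a -> 0 < e ->
  \forall b \near a, box v Z d b /\ `|time a - time b| < e.
Proof. exact: (box_time_near hv os). Qed.

(** In the box the loop consists of the arc arriving at [z'] at negative times, the arc leaving [z]
    at positive times, and [J] at time 0. At time 0 off [J] the two comparisons agree, because the
    point is on the same side of [z] and of [z']. *)
Let psi2_const pres a : N2 a -> ~ loop a -> \forall b \near a, psi2 pres b = psi2 pres a.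
Proof.
move=> [Ba _] nl; have [Zp pt E] := box_coordP Ba; rewrite -/(proj a) -/(time a) in Zp pt E.
have ZT : \forall b \near a, Z (proj b).
  by apply: filterS (open_nbhs_nbhs (conj (box_open os) Ba)) => b /box_coordP[].
have [t0|t0|t0] := ltgtP (time a) 0.
- have ne : proj a <> z'.
    move=> pz; apply: nl; left; rewrite -E pz /z' -(flowD hv); apply: orbP.
    by move: pt s2d; rewrite ltr_norml; lra.
  have nt0 : 0 < - time a by rewrite oppr_gt0.
  have n1 := time_near Ba nt0.
  have tE b : `|time a - time b| < - time a -> (0 <= time b) = false.
    by rewrite ltr_norml => h; apply/negbTE; rewrite -ltNge; lra.
  have [[h1 h2]|[h1 h2]] := near_side Zp Zz' ne (fun N => @proj_near a N Ba).
    apply: filterS2 n1 h2 => b [_ tb] hb; rewrite /psi2 tE// leNgt t0 /=.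
    by case: pres; rewrite !asboolT//; left.
  apply: filterS3 n1 h2 ZT => b [_ tb] hb Zb; rewrite /psi2 tE// leNgt t0 /=.
  have n2 u : Z u -> lt z' u -> ~ lt u z' by move=> Zu; exact: asym.
  have n3 u : Z u -> lt z' u -> u <> z' by move=> Zu h uz; rewrite uz in h; exact: (irr Zz' h).
  by case: pres; rewrite !asboolF//; try (by move=> []; [exact: n2|exact: n3]); exact: n2.
- have ne : proj a <> z.
    move=> pz; apply: nl; left; rewrite -E pz; apply: orbP.
    by move: pt s2d; rewrite ltr_norml; lra.
  have n1 := time_near Ba t0.
  have tE b : `|time a - time b| < time a -> (0 <= time b) = true.
    by rewrite ltr_norml => h; lra.
  have [[h1 h2]|[h1 h2]] := near_side Zp Zz ne (fun N => @proj_near a N Ba).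
    apply: filterS2 n1 h2 => b [_ tb] hb; rewrite /psi2 tE// (ltW t0).
    by rewrite !asboolT.
  apply: filterS3 n1 h2 ZT => b [_ tb] hb Zb; rewrite /psi2 tE// (ltW t0).
  by rewrite !asboolF//; exact: asym.
- have aE : a = proj a by rewrite -{1}E t0 (flow0 hv).
  have nJ : ~ J (proj a) by move=> Ja; apply: nl; right; rewrite aE.
  have ne : proj a <> z by move=> pz; apply: nJ; rewrite pz.
  have ne' : proj a <> z' by move=> pz; apply: nJ; rewrite pz.
  have a1 := near_side Zp Zz ne (fun N => @proj_near a N Ba).
  have a2 := near_side Zp Zz' ne' (fun N => @proj_near a N Ba).
  have [[m1 m2]|[m1 m2]] := outJ Zp nJ.
    have {a1} a1 : \forall b \near a, lt (proj b) z by case: a1 => -[] // h; case: (asym Zp Zz m1 h).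
    have {a2} a2 : \forall b \near a, lt (proj b) z' by case: a2 => -[] // h; case: (asym Zp Zz' m2 h).
    have tr b : lt (proj b) z -> lt (proj b) z' -> psi2 pres b = true.
      by move=> h1 h2; rewrite /psi2; case: ifP => _; [|case: pres]; rewrite asboolT//; left.
    by apply: filterS2 a1 a2 => b b1 b2; rewrite !tr.
  have {a1} a1 : \forall b \near a, lt z (proj b) by case: a1 => -[] // h; case: (asym Zz Zp m1 h).
  have {a2} a2 : \forall b \near a, lt z' (proj b) by case: a2 => -[] // h; case: (asym Zz' Zp m2 h).
  have tr b : Z (proj b) -> lt z (proj b) -> lt z' (proj b) -> psi2 pres b = false.
    move=> Zb h1 h2; rewrite /psi2; case: ifP => _; first by rewrite asboolF//; exact: asym.
    have n2 := asym Zz' Zb h2.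
    have n3 : proj b <> z' by move=> uz; rewrite uz in h2; exact: (irr Zz' h2).
    by case: pres; rewrite asboolF// => -[].
  by apply: filterS3 a1 a2 ZT => b b1 b2 Zb; rewrite !tr.
Qed.

Let f u := proj (v s u).

Let return_side : exists (pres : bool) (C : set S), [/\ connected C, C `<=` Z, C z,
  \forall u \near z, Z u -> C u & (forall u, C u -> box v Z d (v s u)) /\
  (forall u, C u -> (u = z -> f u = z') /\
     (lt u z -> if pres then lt (f u) z' else lt z' (f u)) /\
     (lt z u -> if pres then lt z' (f u) else lt (f u) z'))].
Proof.
have Bz : box v Z d (v s z) by exact: (section_box hv os).
have nB : \forall u \near z, box v Z d (v s u).
  by apply: (flow_near hv); apply: open_nbhs_nbhs; split => //; exact: (box_open os).
have [C [cC CZ CN Cz Cnear]] := section_locally_connected hv hS os Zz nB.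
have fz : f z = z' by have [] := section_coord hv os Zz'.
have [pr|rv] : side_preserving C f lt z \/ side_reversing C f lt z.
  apply: (side_dichotomy (ls_connected ls) CZ) => //.
  - by move=> u /CN/box_coordP[].
  - apply/within_continuousP => u N /CN Bu Nu.
    by apply: filterS (flow_near hv (proj_near Bu Nu)) => w [].
  - move=> u w Cu Cw E.
    have [Zu t1 E1] := box_coordP (CN _ Cu); have [Zw t2 E2] := box_coordP (CN _ Cw).
    rewrite -/(f u) -/(time (v s u)) in Zu t1 E1; rewrite -/(f w) -/(time (v s w)) in Zw t2 E2.
    move: (time (v s u)) (time (v s w)) t1 t2 E1 E2 => r1 r2 t1 t2 E1 E2.
    have E3 : v (s - r1) u = v (s - r2) w.
      by rewrite addrC [in RHS]addrC !(flowD hv (- _)) -E1 -E2 !(flowK hv).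
    have [] // := section_uniq hv os (CZ _ Cu) (CZ _ Cw) _ E3.
    by move: t1 t2; rewrite !ltr_norml; lra.
- exists true, C; split => //; split => // u Cu; split; first by move=> ->.
  by case: pr; rewrite fz => p1 p2; split; [exact: p1|exact: p2].
- exists false, C; split => //; split => // u Cu; split; first by move=> ->.
  by case: rv; rewrite fz => p1 p2; split; [exact: p1|exact: p2].
Qed.

Let psi2_agree pres C r a : connected C -> C `<=` Z -> C z ->
  (\forall u \near z, Z u -> C u) -> (forall u, C u -> box v Z d (v s u)) ->
  (forall u, C u -> (u = z -> f u = z') /\
     (lt u z -> if pres then lt (f u) z' else lt z' (f u)) /\
     (lt z u -> if pres then lt z' (f u) else lt (f u) z')) ->
  0 < r < s -> N2 a -> Nr r a -> loop a ->
  \forall b \near a, psi2 pres b (+) psir r b = psi2 pres a (+) psir r a.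
Proof.
move=> cC CZ Cz Cnear CB Cf rs [Ba nob] Na la.
have [q [qs qr qa [pq tq]]] := Nr_loop rs Na la.
have Bra := Nr_box rs Na.
suff [k hk] : exists k, \forall b \near a, psi2 pres b (+) psir r b = k.
  by have ka := nbhs_singleton hk; apply: filterS hk => b ->; rewrite ka.
have [qd|qd] := ltP q d.
  (* Near the beginning of the arc both potentials compare the same section point with [z]. *)
  exists false; pose e := Num.min q (d - q).
  have e0 : 0 < e by rewrite lt_min subr_gt0 qd andbT; case/andP: qs.
  apply: filterS (flow_near hv (time_near Bra e0)) => b [Bb]; rewrite tq => tb.
  have [Zb tbd Eb] := box_coordP Bb; rewrite -/(proj _) -/(time _) in Zb tbd Eb.
  move: tb; rewrite lt_min !ltr_norml => tb.
  have bE : b = v (time (v (- r) b) + r) (proj (v (- r) b)).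
    by rewrite addrC (flowD hv) Eb (flowNK hv).
  have [|pb tmb] := @box_coordE _ _ _ hv _ _ _ _ os _ (time (v (- r) b) + r) Zb.
    by rewrite ltr_norml; lra.
  rewrite -bE -/(proj b) -/(time b) in pb tmb.
  by rewrite /psi2 tmb pb /psir; case: ifP => [_|]; [rewrite addbb|lra].
have qsd : s - d < q.
  rewrite ltNge; apply/negP => h; apply: nob; rewrite -qa; apply: orbP; lra.
(* Near the end of the arc one potential compares [u] with [z], the other its return [f u] with
   [z']. They agree if the return preserves sides and are opposite if it reverses them. *)
exists (~~ pres); pose e := Num.min (q - s + d) (s - q) / 2.
have e0 : 0 < e by rewrite divr_gt0// lt_min; lra.
have [eL1 eL2] : 2 * e <= q - s + d /\ 2 * e <= s - q.
  by rewrite /e mulrC divfK// !ge_min !lexx orbT.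
have Bz : box v Z d (v s z) by exact: (section_box hv os).
have tz : time (v s z) = 0 by have [] := section_coord hv os Zz'.
have n1 : nbhs (proj (v (- r) a)) [set u | (Z u -> C u) /\ `|time (v s u)| < e].
  rewrite pq; have := flow_near hv (time_near Bz e0).
  by apply: filterS2 Cnear => u u1 [_]; rewrite tz sub0r normrN.
apply: filterS2 (flow_near hv (time_near Bra e0)) (projr_near Bra n1) => b [Bb] + [Zb [Cb tsb]].
rewrite tq => tb; have {}Cb := Cb Zb.
have [_ tbd Eb] := box_coordP Bb; rewrite -/(proj _) -/(time _) in tbd Eb.
set u := proj (v (- r) b) in Zb Cb tsb Eb.
have [Zf tf Ef] : [/\ Z (f u), `|time (v s u)| < d & v (time (v s u)) (f u) = v s u].
  exact: box_coordP (CB _ Cb).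
have bE : b = v (time (v (- r) b) + r - s + time (v s u)) (f u).
  rewrite (flowD hv) Ef -(flowD hv) subrK addrC (flowD hv) Eb (flowNK hv).
  by [].
move: tb tsb; rewrite !ltr_norml => tb tsb.
have [|pb tmb] := @box_coordE _ _ _ hv _ _ _ _ os _ (time (v (- r) b) + r - s + time (v s u)) Zf.
  by rewrite ltr_norml; lra.
rewrite -bE -/(proj b) -/(time b) in pb tmb.
have tneg : (0 <= time b) = false by apply/negbTE; rewrite -ltNge tmb; lra.
rewrite /psi2 tneg pb /psir -/u.
have [c1 [c2 c3]] := Cf u Cb; have Zu := Zb; clear Cf.
have [uz|uz] := pselect (u = z).
  rewrite (c1 uz) uz; have n1' := irr Zz; have n2' := irr Zz'.
  by case: pres c2 c3 => _ _ /=; rewrite ?(asboolF n1') ?(asboolF n2') ?asboolT//; right.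
have [h|h] := po_total po Zu Zz uz.
  have := c2 h; rewrite (asboolT h); case: pres c2 c3 => _ _ /= fh; first by rewrite asboolT.
  rewrite asboolF// => -[|E]; first exact: (asym Zz' Zf fh).
  by rewrite E in fh; exact: (irr Zz' fh).
have := c3 h; rewrite (asboolF (asym Zz Zu h)); case: pres c2 c3 => _ _ /= fh.
  by rewrite asboolF//; exact: (asym Zz' Zf fh).
by rewrite asboolT//; left.
Qed.

(** The two charts singled out are those needed to evaluate the class: it is trivial off the loop,
    and along the section its potential jumps at [z]. *)
Lemma loop_torsor : exists F : set (set S * (S -> bool)), [/\ torsor_on setT F,
  F (~` (orb 0 s `|` J), fun=> false) & exists psi, F (box v Z d `&` ~` orb d (s - d), psi) /\
    forall w, Z w -> psi w = `[< lt w z >]].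
Proof.
have [pres [C [cC CZ Cz Cnear [CB Cf]]]] := return_side.
pose F : set (set S * (S -> bool)) := [set c | c = (~` loop, fun=> false) \/
  (c = (N2, psi2 pres) \/ exists2 r, 0 < r < s & c = (Nr r, psir r))].
have agree r a : 0 < r < s -> N2 a -> Nr r a -> loop a ->
  \forall b \near a, psi2 pres b (+) psir r b = psi2 pres a (+) psir r a.
  exact: psi2_agree cC CZ Cz Cnear CB Cf.
have open_loopC : open (~` loop) by apply: closed_openC; exact: loop_closed.
have openF c : F c -> open c.1.
  move=> [->|[->|[r rs ->]]] //=; last exact: Nr_open.
  by apply: openI; [exact: (box_open os)|apply: closed_openC; exact: orb_closed].
have constF c a : F c -> c.1 a -> ~ loop a -> \forall b \near a, c.2 b = c.2 a.
  move=> [->|[->|[r rs ->]]] /= ca nl.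
  - by apply: filterE.
  - exact: psi2_const.
  - exact: psir_const.
have JN2 a : J a -> N2 a.
  move=> Ja; split; first by apply: (section_box hv os); case: Ja => -[].
  move=> /orbE[q qs E]; apply: (orb_notJ (q := q)); last by rewrite E.
  by move: d0 s2d; lra.
exists F; split; last first.
- exists (psi2 pres); split; first by right; left.
  move=> w Zw; have [pw tw] := section_coord hv os Zw.
  by rewrite /psi2 /time tw lexx /proj pw.
- by left.
split.
  move=> a _.
  suff [c Fc ca] : exists2 c, F c & c.1 a.
    exists c; split => //; have := open_nbhs_nbhs (conj (openF _ Fc) ca).
    by apply: filterS.
  have [la|nla] := pselect (loop a); last by exists (~` loop, fun=> false) => //; left.
  have [Ja|nJa] := pselect (J a); first by exists (N2, psi2 pres); [right; left|exact: JN2].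
  case: la => // /orbE[q /andP[q0 qs] E].
  have q0' : 0 < q.
    by rewrite lt_neqAle q0 andbT; apply/eqP => q00; apply: nJa; rewrite -E -q00 (flow0 hv).
  have qs' : q < s.
    by rewrite lt_neqAle qs andbT; apply/eqP => qss; apply: nJa; rewrite -E qss.
  have qI : 0 < q < s by rewrite q0'.
  have [e1 e2 e3 e4] := drP qI.
  exists (Nr q, psir q); first by right; right; exists q.
  split.
    rewrite /= -E (flowK hv); exists z, 0; split => //; first by rewrite normr0.
    exact: (flow0 hv).
  have bad q' : 0 <= q' <= s -> q' <> q -> v q' z <> a.
    move=> /andP[q'0 q's] ne E'.
    have q'0' : 0 < q'.
      by rewrite lt_neqAle q'0 andbT; apply/eqP => h; apply: nJa; rewrite -E' -h (flow0 hv).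
    have q's' : q' < s.
      by rewrite lt_neqAle q's andbT; apply/eqP => h; apply: nJa; rewrite -E' h.
    by apply: ne; apply: orb_inj; rewrite ?q'0'// E'.
  move=> [[/orbE[q' q'I]|/orbE[q' q'I]]|//]; apply: bad; lra.
move=> c c' a Fc Fc' _ ca c'a.
have [la|nla] := pselect (loop a); last first.
  by apply: filterS2 (constF c a Fc ca nla) (constF c' a Fc' c'a nla) => b -> ->.
case: Fc ca => [->//|[->|[r rs ->]]] /= ca; case: Fc' c'a => [->//|[->|[r' rs' ->]]] /= c'a.
- by apply: filterE => b _; rewrite !addbb.
- by apply: filterS (agree r' a rs' ca c'a la).
- by apply: filterS (agree r a rs c'a ca la) => b; rewrite addbC => -> _; rewrite addbC.
- have h := psir_agree rs rs' ca c'a la; have ha := nbhs_singleton h.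
  by apply: filterS h => b -> _; rewrite ha !addbb.
Qed.

End LoopTorsor.

Section OrbitClosures.
Variables (R : realType) (S : topologicalType) (v : R -> S -> S).
Hypothesis hv : flow v.

Lemma orbit_refl x : orbit v x x.
Proof. by exists 0 => //; rewrite (flow0 hv). Qed.

Lemma orbit_flow x y t : orbit v x y -> orbit v x (v t y).
Proof. by move=> [s _ <-]; exists (t + s) => //; rewrite (flowD hv). Qed.

Lemma orbit_closure_flow x y t : closure (orbit v x) y -> closure (orbit v x) (v t y).
Proof.
move=> cy N /(flow_near hv)/cy[z [oz Nz]]; exists (v t z); split => //.
exact: orbit_flow.
Qed.

Lemma orbit_closure_sub x y : closure (orbit v x) y -> closure (orbit v y) `<=` closure (orbit v x).
Proof.
move=> cy; rewrite [X in _ `<=` X](iffLR (closure_id _) (@closed_closure _ (orbit v x))).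
by apply: closure_subset => _ [t _ <-]; exact: orbit_closure_flow.
Qed.

Lemma orbit_connected x : connected (orbit v x).
Proof.
apply: connected_continuous_connected; first exact/connected_intervalP.
by apply: continuous_subspaceT => t N; exact: (flow_near_time hv).
Qed.

Lemma orbit_closure_interior x : interior (closure (orbit v x)) !=set0 ->
  interior (closure (orbit v x)) x.
Proof.
move=> [y iy]; have [_ [[t _ <-] it]] := interior_subset iy _ (nbhs_interior iy).
rewrite /interior /= in it.
have := flow_near hv it; apply: filterS => w cw.
by rewrite -(flowK hv t w); exact: orbit_closure_flow.
Qed.

End OrbitClosures.

(** * Gaps of an orbit closure in a section *)

Section Gaps.
Variables (R : realType) (S : topologicalType) (v : R -> S -> S).
Hypotheses (hv : flow v) (hS : surface R S) (hcpt : compact [set: S]).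
Variables (x : S) (Z : set S) (d : R).

Definition gap (K : set S) (lt : S -> S -> Prop) (z : S) : set S :=
  [set u | Z u /\ forall y, seg Z lt z u y \/ seg Z lt u z y -> ~ K y].

Let K := closure (orbit v x).

Lemma section_orbit_near lt k (N : set S) : ordered_section v x Z d lt ->
  Z k -> K k -> nbhs k N -> exists w, [/\ Z w, N w & orbit v x w].
Proof.
move=> os Zk Kk Nk; have [pk _] := section_coord hv os Zk.
have := box_proj_near hv os (section_box hv os Zk) (N := N); rewrite pk => /(_ Nk) /Kk.
move=> [b [ob [Bb Nb]]]; have [Zb _ Eb] := box_coordP Bb.
exists (box_proj v Z d b); split => //.
have -> : box_proj v Z d b = v (- box_time v Z d b) b by rewrite -{3}Eb (flowK hv).
exact: orbit_flow.
Qed.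

(** A point [v q z] of the segment is outside the gap of [z], so a point of [K], and near it one of
    the orbit of [x], lies strictly between; the end [p] is moved there. An orbit meets the section
    at times at least [2 * d] apart, so each time window of length [d] needs at most one such
    move. *)
Lemma shrink_segment lt z s p0 : ordered_section v x Z d lt ->
  Z z -> ~ K z -> orbit v x p0 -> Z p0 -> lt z p0 ->
  (forall q, 0 < q < s -> ~ gap K lt z (v q z)) ->
  exists p, [/\ orbit v x p, Z p, lt z p, p = p0 \/ lt p p0 &
    forall q, 0 < q < s -> ~ seg Z lt z p (v q z)].
Proof.
move=> os Zz nKz op0 Zp0 zp0 first.
have d0 := ls_d (os_ls os); have po := os_po os.
have asym u w : Z u -> Z w -> lt u w -> ~ lt w u by move=> Zu Zw; exact: (po_asym po Zu Zw).
have irr := os_irr os; have trans := os_trans os.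
have nK q : ~ K (v q z).
  by move=> h; apply: nKz; rewrite -(flowK hv q z); exact: orbit_closure_flow.
have gapz : gap K lt z z.
  split => // y h; suff -> : y = z by [].
  by case: h => -[Zy [//|h1] [//|h2]]; case: (asym _ _ Zz Zy h1 h2).
have ind (n : nat) : exists p, [/\ orbit v x p, Z p, lt z p, p = p0 \/ lt p p0 &
    forall q, 0 < q < s -> q < n%:R * d -> ~ seg Z lt z p (v q z)].
  elim: n => [|n [p [op Zp zp pp0 IH]]].
    exists p0; split => //; first by left.
    by move=> q /andP[q0 _]; rewrite mul0r ltNge (ltW q0).
  have [[q [qs qn sq]]|none] := pselect (exists q, [/\ 0 < q < s, q < n.+1%:R * d & seg Z lt z p (v q z)]);
      last first.
    by exists p; split => // q qs qn sq; apply: none; exists q.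
  pose y := v q z; have [Zy zy yp] := sq; rewrite -/y in Zy zy yp.
  have ynz : y <> z by move=> E; apply: (first q qs); rewrite -/y E.
  case: zy => // zy.
  have [k [sk Kk]] : exists k, (seg Z lt z y k \/ seg Z lt y z k) /\ K k.
    apply: contrapT => none; apply: (first q qs); split => // k sk Kk.
    by apply: none; exists k.
  have [Zk zk ky] : [/\ Z k, lt z k & lt k y].
    have kz : k <> z by move=> E; rewrite E in Kk.
    have ky : k <> y by move=> E; apply: (nK q); rewrite -/y -E.
    case: sk => -[Zk [//|h1] [//|h2]]; first by split.
    by case: (asym _ _ Zz Zy zy); exact: (trans _ _ _ Zy Zk Zz h1 h2).
  have nk : nbhs k [set w | (Z w -> lt z w) /\ (Z w -> lt w y)].
    by apply: filterI; [exact: (po_nearr po)|exact: (po_nearl po)].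
  have [p'' [Zp'' [zp'' p''y] op'']] := section_orbit_near os Zk Kk nk.
  have {}zp'' := zp'' Zp''; have {}p''y := p''y Zp''.
  have p''p : lt p'' p by case: yp => [<-//|yp]; exact: (trans _ _ _ Zp'' Zy Zp p''y yp).
  exists p''; split => //.
    right; case: pp0 => [<-//|pp0]; exact: (trans _ _ _ Zp'' Zp Zp0 p''p pp0).
  move=> q' q's q'n [Zq' zq' q'p].
  have q'p2 : v q' z = p \/ lt (v q' z) p.
    by right; case: q'p => [->//|h]; exact: (trans _ _ _ Zq' Zp'' Zp h p''p).
  have qn' : n%:R * d <= q by rewrite leNgt; apply/negP => h; exact: (IH q qs h sq).
  have q'n' : n%:R * d <= q'.
    by rewrite leNgt; apply/negP => h; apply: (IH q' q's h).
  have [_ qq] : z = z /\ q' - q = 0.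
    split => //; apply: (ls_inj (os_ls os) Zq' Zy).
      by move: qn q'n; rewrite -natr1 mulrDl mul1r ltr_norml; lra.
    by rewrite /y -(flowD hv) subrK.
  have E : v q' z = y by rewrite /y; congr (v _ z); lra.
  rewrite E in q'p; case: q'p => [E'|h]; last exact: (asym _ _ Zp'' Zy p''y h).
  by rewrite E' in p''y; exact: (irr _ Zp'' p''y).
have [p [op Zp zp pp0 h]] := ind (Num.bound (s / d)).
exists p; split => // q qs; apply: h => //.
case/andP: (qs) => q0 qs'; rewrite -ltr_pdivrMr//.
apply: (@lt_trans _ _ (s / d)); first by rewrite ltr_pM2r// invr_gt0.
by apply: archi_boundP; rewrite divr_ge0 ?(ltW d0)// ltW// (lt_trans q0).
Qed.

(** Times at which an orbit meets the section are at least [2 * d] apart, so a return time within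
    [d] of the infimum is the first one. *)
Lemma first_return lt z s1 : ordered_section v x Z d lt -> 0 < s1 ->
  gap K lt z (v s1 z) -> exists s, [/\ 0 < s, gap K lt z (v s z) &
    forall q, 0 < q < s -> ~ gap K lt z (v q z)].
Proof.
move=> os s10 g1; have d0 := ls_d (os_ls os).
pose A := [set t : R | 0 < t /\ gap K lt z (v t z)].
have hA : has_inf A.
  by split; [exists s1|exists 0 => t [/ltW]].
have [s [sA gs] si] : exists2 s, A s & s < inf A + d.
  by have := @inf_adherent R A d d0 hA; case=> s; exists s.
exists s; split => // q /andP[q0 qs] gq.
have qi : inf A <= q by apply: ge_inf; [case: hA|split].
have : s - q = 0.
  apply: (ls_inj (os_ls os) gs.1 gq.1); last by rewrite -(flowD hv) subrK.
  by rewrite ltr_norml; lra.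
by lra.
Qed.

End Gaps.

(** * Non-closed orbits of a recurrent flow have closures with interior *)

Section RecurrentInterior.
Variables (R : realType) (S : topologicalType) (v : R -> S -> S).
Hypotheses (hv : flow v) (hS : surface R S) (hcpt : compact [set: S]).
Hypothesis hret : forall p, returns v p.
Variable x : S.
Hypothesis ncx : ~ closed_pt v x.

Let K := closure (orbit v x).
Hypothesis Kint : ~ interior K x.

Let nK q y : ~ K y -> ~ K (v q y).
Proof. by move=> nKy h; apply: nKy; rewrite -(flowK hv q y); exact: orbit_closure_flow. Qed.

Let aper t : t != 0 -> v t x <> x.
Proof.
have ap := nonclosed_aperiodic ncx.
rewrite neq_lt => /orP[t0|t0]; last exact: ap.
move=> E; apply: (ap (- t)); first by rewrite oppr_gt0.
by rewrite -{1}E (flowK hv).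
Qed.

Let nsx : ~ singular_pt v x. Proof. by move=> sx; apply: ncx; left. Qed.

Section Loop.
Variables (Z : set S) (d : R) (lt : S -> S -> Prop).
Hypothesis os : ordered_section v x Z d lt.
Let ls := os_ls os.
Let po := os_po os.
Let d0 : 0 < d := ls_d ls.
Let irr := os_irr os.
Let trans := os_trans os.
Let asym u w : Z u -> Z w -> lt u w -> ~ lt w u. Proof. exact: (po_asym po). Qed.

Let section_return u (N : set S) : Z u -> nbhs u N ->
  exists t, [/\ t != 0, Z (v t u) & N (v t u)].
Proof.
move=> Zu Nu; have [pu _] := section_coord hv os Zu.
have := box_proj_near hv os (section_box hv os Zu) (N := N); rewrite pu => /(_ Nu).
move=> /(hret d)[t [dt [Bt Nt]]]; have [Zt td Et] := box_coordP Bt.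
have E : v (t - box_time v Z d (v t u)) u = box_proj v Z d (v t u).
  move: (box_time v Z d (v t u)) (box_proj v Z d (v t u)) Et => r w Et.
  by rewrite addrC (flowD hv) -Et (flowK hv).
exists (t - box_time v Z d (v t u)); rewrite E; split => //.
rewrite subr_eq0; apply/eqP => h; rewrite -h in td.
by have := lt_trans dt td; rewrite ltxx.
Qed.

Let K_nowhere_dense u (N : set S) : Z u -> nbhs u N -> exists w, [/\ Z w, N w & ~ K w].
Proof.
move=> Zu; rewrite nbhsE => -[W [oW Wu] WN]; apply: contrapT => h; apply: Kint.
apply: (orbit_closure_interior hv); exists u.
have : open_nbhs u (flow_box v Z W d).
  split; first by apply: (ls_open ls) => //; rewrite lexx d0.
  by exists u, 0; split => //; [rewrite normr0|exact: (flow0 hv)].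
move=> /open_nbhs_nbhs; apply: filterS => _ [w [t [Zw Ww td <-]]].
apply: (orbit_closure_flow hv); apply: contrapT => nKw; apply: h.
by exists w; split => //; exact: WN.
Qed.

Let gap_sym u w : Z u -> gap Z K lt u w -> gap Z K lt w u.
Proof. by move=> Zu [Zw h]; split => // y [|] sy; apply: h; [right|left]. Qed.

Let gap_refl u : Z u -> ~ K u -> gap Z K lt u u.
Proof.
move=> Zu nKu; split => // y h; suff -> : y = u by [].
by case: h => -[Zy [//|h1] [//|h2]]; case: (asym Zu Zy h1 h2).
Qed.

Let gap_nbhs u : Z u -> ~ K u -> \forall w \near u, Z w -> gap Z K lt u w.
Proof.
move=> Zu nKu.
have : nbhs u (~` K) by apply: open_nbhs_nbhs; split => //; apply: closed_openC; exact: closed_closure.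
move=> /(section_locally_connected hv hS os Zu)[C [cC CZ CN Cu nC]].
apply: filterS nC => w h Zw; have Cw := h Zw; split => // y hy; apply: CN.
by case: hy => -[Zy [->//|h1] [->//|h2]]; exact: (connected_convex po cC CZ _ _ Zy h1 h2).
Qed.

Let gap_ends u w : Z u -> gap Z K lt u w -> ~ K u /\ ~ K w.
Proof.
move=> Zu [Zw h].
have [E|uw] := pselect (u = w).
  by rewrite -E in h *; have := h u; split; apply: h; left; split => //; left.
have [l|l] := po_total po Zu Zw uw.
  by split; apply: h; left; split => //; [left|right|right|left].
by split; apply: h; right; split => //; [right|left|left|right].
Qed.

Let gap_side u w k : Z u -> Z k -> K k -> gap Z K lt u w -> lt u k -> lt w k.
Proof.
move=> Zu Zk Kk g uk; have [nKu nKw] := gap_ends Zu g; have [Zw h] := g.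
have wk : w <> k by move=> E; rewrite E in nKw.
have [//|kw] := po_total po Zw Zk wk.
by case: (h k) => //; left; split => //; right.
Qed.

Let gap_side' u w k : Z u -> Z k -> K k -> gap Z K lt u w -> lt k u -> lt k w.
Proof.
move=> Zu Zk Kk g uk; have [nKu nKw] := gap_ends Zu g; have [Zw h] := g.
have wk : w <> k by move=> E; rewrite E in nKw.
have [kw|//] := po_total po Zw Zk wk.
by case: (h k) => //; right; split => //; right.
Qed.

(** The points [p] and [p'] are chosen after the loop, by shrinking on both sides of [z]. No
    interior point of the orbit arc then lies between them; the segment fits into the chart around
    [J], and there the potential separates [p], below [z], from [p'], above it. *)
Lemma loop_exists (V : set S) : nbhs x V ->
  exists (F : set (set S * (S -> bool))) (L C : set S) (p p' : S), [/\
    torsor_on setT F, F (~` L, fun=> false), closed L, (forall y, L y -> ~ K y) &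
    [/\ connected C, C `<=` V, [/\ C p, C p', orbit v x p & orbit v x p'] &
      exists N psi, [/\ F (N, psi), C `<=` N & psi p <> psi p']]].
Proof.
move=> Vx; have Zx := ls_x ls.
have [C1 [cC1 C1Z C1V C1x nC1]] := section_locally_connected hv hS os Zx Vx.
have [p0 [p0' [p0p0' [C1p0 C1p0'] [op0 op0']]]] : exists p0 p0', [/\ lt p0 p0', C1 p0 /\ C1 p0' &
    orbit v x p0 /\ orbit v x p0'].
  have [t [t0 Zt Ct]] := section_return Zx nC1; have {}Ct := Ct Zt.
  have [l|l] := po_total po Zt Zx (aper t0).
    by exists (v t x), x; split => //; split => //; [exists t|exact: orbit_refl].
  by exists x, (v t x); split => //; split => //; [exact: orbit_refl|exists t].
have [Zp0 Zp0'] := (C1Z _ C1p0, C1Z _ C1p0').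
have orbK y : orbit v x y -> K y by exact: subset_closure.
have [z0 [Zz0 p0z0 z0p0' nKz0]] : exists z0, [/\ Z z0, lt p0 z0, lt z0 p0' & ~ K z0].
  have [w [Zw _ l1 l2]] := section_between os Zp0 Zp0' p0p0' filterT.
  have nw : nbhs w [set y | (Z y -> lt p0 y) /\ (Z y -> lt y p0')].
    by apply: filterI; [exact: (po_nearr po)|exact: (po_nearl po)].
  have [z0 [Zz0 [h1 h2] nKz0]] := K_nowhere_dense Zw nw.
  by exists z0; split => //; [exact: h1|exact: h2].
have [z [s1 [Zz p0z zp0' [s10 gs1]]]] : exists z s1, [/\ Z z, lt p0 z, lt z p0' &
    0 < s1 /\ gap Z K lt z (v s1 z)].
  have [t [t0 Zt g]] := section_return Zz0 (gap_nbhs Zz0 nKz0); have {}g := g Zt.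
  move: t0; rewrite neq_lt => /orP[t0|t0]; last by exists z0, t; split.
  (* When [z0] comes back only at a negative time, the loop starts at the point reached instead,
     which lies in the same gap. *)
  exists (v t z0), (- t); split => //.
  - exact: (gap_side' Zz0 Zp0 (orbK _ op0) g).
  - exact: (gap_side Zz0 Zp0' (orbK _ op0') g).
  - by rewrite oppr_gt0 (flowK hv); split => //; exact: gap_sym.
have [s [s0 gs first]] := first_return hv os s10 gs1.
have [nKz nKz'] := gap_ends Zz gs; have Zz' := gs.1.
have [p' [op' Zp' zp' p'p0' np']] := shrink_segment hv os Zz nKz op0' Zp0' zp0' first.
have [p [op Zp pz pp0 np]] : exists p, [/\ orbit v x p, Z p, lt p z, p = p0 \/ lt p0 p &
    forall q, 0 < q < s -> ~ seg Z lt p z (v q z)].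
  have [|p [op Zp pz pp0 np]] := shrink_segment hv (os_flip os) Zz nKz op0 Zp0 p0z (s := s).
    move=> q qs [Zq h]; apply: (first q qs); split => // y hy; apply: h.
    by case: hy => -[Zy h1 h2]; [right|left]; split.
  exists p; split => // q qs [Zq h1 h2]; apply: (np q qs); by split.
have JG y : seg Z lt z (v s z) y \/ seg Z lt (v s z) z y -> gap Z K lt z y.
  move=> hy; have Zy : Z y by case: hy => -[].
  split => // w hw; apply: gs.2.
  have [e|e] := pselect (w = z).
    by rewrite e; have [E|ne] := pselect (z = v s z);
      [left; split => //; left|
       have [l|l] := po_total po Zz Zz' ne; [left; split => //; [left|right]|right; split => //; [right|left]]].
  have [e'|e'] := pselect (w = y); first by rewrite e'.
  have Zw : Z w by case: hw => -[].
  have [lw|lw] : (lt z w /\ lt w y) \/ (lt y w /\ lt w z).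
    by case: hw => -[_ [//|h1] [//|h2]]; [left|right].
    left; split => //; first by right; case: lw.
    right; have [zw wy] := lw.
    case: hy => -[_ h1 h2].
      by case: h2 => [<-//|h2]; exact: (trans Zw Zy Zz' wy h2).
    have zy := trans Zz Zw Zy zw wy.
    by case: h2 => [E|h2]; [rewrite E in zy; case: (irr Zz zy)|case: (asym Zz Zy zy h2)].
  right; split => //; last by right; case: lw.
  right; have [yw wz] := lw.
  case: hy => -[_ h1 h2].
    have yz := trans Zy Zw Zz yw wz.
    by case: h1 => [E|h1]; [rewrite E in yz; case: (irr Zz yz)|case: (asym Zy Zz yz h1)].
  by case: h1 => [<-//|h1]; exact: (trans Zz' Zy Zw h1 yw).
have noz q : 0 < q < s -> v q z <> z.
  by move=> qs E; apply: (first q qs); rewrite E; exact: gap_refl.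
have [F [torF F0 [psi [F2 psiE]]]] := loop_torsor hv hS os Zz Zz' s0 JG first.
exists F, ([set v q z | q in `[0, s]] `|` (seg Z lt z (v s z) `|` seg Z lt (v s z) z)),
  (seg Z lt p p'), p, p'.
have lpp' : lt p p' by exact: (trans Zp Zz Zp' pz zp').
split => //.
- exact: (loop_closed hv hS os Zz Zz').
- move=> y [[q _ <-]|Jy]; first exact: nK.
  by have [] := gap_ends Zz (JG y Jy).
split.
- exact: (os_seg_connected os Zp Zp' (or_intror lpp')).
- move=> y [Zy py yp']; apply: C1V.
  have l1 : y = p0 \/ lt p0 y.
    case: py => [->|py]; first by case: pp0; [left|right].
    by right; case: pp0 => [<-//|pp0]; exact: (trans Zp0 Zp Zy pp0 py).
  have l2 : y = p0' \/ lt y p0'.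
    case: yp' => [->|yp']; first by case: p'p0'; [left|right].
    by right; case: p'p0' => [<-//|p'p0']; exact: (trans Zy Zp' Zp0' yp' p'p0').
  case: l1 => [->//|l1]; case: l2 => [->//|l2].
  exact: (connected_convex po cC1 C1Z C1p0 C1p0' Zy l1 l2).
- by split => //; split => //; [left|right|right|left].
- exists (box v Z d `&` ~` [set v q z | q in `[d, s - d]]), psi; split => //.
    move=> y [Zy py yp']; split; first exact: (section_box hv os).
    move=> [q /=]; rewrite in_itv /= => /andP[q1 q2] E.
    have qs : 0 < q < s by move: d0; lra.
    have yz : y <> z by rewrite -E; exact: noz.
    have [l|l] := po_total po Zy Zz yz.
      by apply: (np q qs); rewrite E; split => //; right.
    by apply: (np' q qs); rewrite E; split => //; right.
  by rewrite !psiE// asboolT// asboolF//; exact: asym.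
Qed.

End Loop.

(** Let [Phi] identify torsors number [k < l]. Along the orbit of [x] both are trivial, so [Phi]
    agrees at [p] and [p']. Along the small segment number [l] only the [k]-th is trivial, so [Phi]
    changes as [psi] does, and [psi] differs at [p] and [p']. *)
Lemma no_nowhere_dense_orbit : False.
Proof.
have [Z [d [lt os]]] := ordered_section_exists hv hS hcpt nsx.
pose P (V : set S) (D : set (set S * (S -> bool)) * set S * set S * S * S) :=
  let: (F, L, C, p, p') := D in [/\
    torsor_on setT F, F (~` L, fun=> false), closed L, (forall y, L y -> ~ K y) &
    [/\ connected C, C `<=` V, [/\ C p, C p', orbit v x p & orbit v x p'] &
      exists N psi, [/\ F (N, psi), C `<=` N & psi p <> psi p']]].
have /choice[D DP] : forall V, exists D, nbhs x V -> P V D.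
  move=> V; have [Vx|nVx] := pselect (nbhs x V); last by exists (set0, set0, set0, x, x).
  by have [F [L [C [p [p' h]]]]] := loop_exists os Vx; exists (F, L, C, p, p').
pose Lof V := (D V).1.1.1.2.
(* Each neighbourhood excludes the loop found in the previous one, so later segments miss earlier
   loops. *)
pose V := fix V n := if n is n'.+1 then V n' `&` ~` Lof (V n') else setT.
have Kx : K x by apply: subset_closure; exact: orbit_refl.
have VN n : nbhs x (V n).
  elim: n => [|n IH]; first exact: filterT.
  apply: filterI => //; apply: open_nbhs_nbhs.
  have := DP _ IH; rewrite /P /Lof; case: (D (V n)) => [[[[F L] C] p] p'] /= [_ _ cL LK _].
  by split; [exact: closed_openC|move=> Lx; exact: (LK x)].
have Vmono k l : (k < l)%N -> V l `<=` ~` Lof (V k).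
  elim: l => // l IH; rewrite ltnS leq_eqVlt => /orP[/eqP-> y []//|kl y [Vy _]].
  exact: IH.
pose F n := (D (V n)).1.1.1.1.
have torF n : torsor_on setT (F n).
  by have := DP _ (VN n); rewrite /P /F; case: (D (V n)) => [[[[? ?] ?] ?] ?] /= [].
have [k [l [Phi [kl PhiP]]]] := torsor_finiteness hS hcpt torF.
have hk : F k (~` Lof (V k), fun=> false) /\ forall y, Lof (V k) y -> ~ K y.
  by have := DP _ (VN k); rewrite /P /F /Lof; case: (D (V k)) => [[[[? ?] ?] ?] ?] /= [].
have [Fk LkK] := hk.
have := DP _ (VN l); rewrite /P.
have El : F l = (D (V l)).1.1.1.1 by [].
case: (D (V l)) El => [[[[Fl L] C] p] p'] /= El [_ Fl0 _ LK [cC CV [Cp Cp' op op'] [N [psi [FN CN ne]]]]].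
have CL y : C y -> ~ Lof (V k) y by move=> /CV; exact: Vmono.
have orbK y : orbit v x y -> K y by exact: subset_closure.
have E1 : Phi p = Phi p'.
  apply: (connected_locally_constant (f := Phi) (@orbit_connected _ _ _ hv x)) => // y oy.
  have h1 : (~` Lof (V k)) y by move=> /LkK; apply; exact: orbK.
  have h2 : (~` L) y by move=> /LK; apply; exact: orbK.
  have := PhiP (~` Lof (V k), fun=> false) (~` L, fun=> false) y Fk _ h1 h2.
  rewrite El => /(_ Fl0) /=; apply: filterS => w; rewrite !addbF => ->.
  by [].
apply: ne.
have E2 : Phi p (+) psi p = Phi p' (+) psi p'.
  apply: (connected_locally_constant cC (f := fun y => Phi y (+) psi y)) => // y Cy.
  have := PhiP (~` Lof (V k), fun=> false) (N, psi) y Fk _ (CL _ Cy) (CN _ Cy).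
  by rewrite El => /(_ FN) /=; apply: filterS => w; rewrite !addbF => -> _.
by move: E2; rewrite E1; case: (Phi p'); case: (psi p); case: (psi p').
Qed.

End RecurrentInterior.

(** * Recurrence and orbit classes *)

Section Recurrence.
Variables (R : realType) (S : topologicalType) (v : R -> S -> S).
Hypotheses (hv : flow v) (hS : surface R S) (hcpt : compact [set: S]).
Let hT : hausdorff_space S := hS.1.

Lemma recurrent_returns x : recurrent_pt v x <-> returns v x.
Proof.
split.
  move=> [ox|ax] n U Ux.
    have [_ [[t /= nt <-] Ut]] := ox `|n| Logic.I _ Ux.
    by exists t; split => //; rewrite (le_lt_trans (ler_norm n))// (lt_le_trans nt)// ler_norm.
  have [_ [[t /= nt <-] Ut]] := ax (- `|n|) Logic.I _ Ux.
  exists t; split => //.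
  by have := ler_norm n; have := ler_norm (- t); rewrite normrN; lra.
move=> rx; apply: contrapT => /not_orP[nox nax].
have [n1 [U1 [U1x h1]]] : exists n1 U1, nbhs x U1 /\ forall t, n1 < t -> ~ U1 (v t x).
  move: nox => /existsNP[n1 /not_implyP[_ /existsNP[U1 /not_implyP[U1x h]]]].
  exists n1, U1; split => // t nt Ut; apply: h; exists (v t x); split => //.
  by exists t.
have [n2 [U2 [U2x h2]]] : exists n2 U2, nbhs x U2 /\ forall t, t < n2 -> ~ U2 (v t x).
  move: nax => /existsNP[n2 /not_implyP[_ /existsNP[U2 /not_implyP[U2x h]]]].
  exists n2, U2; split => // t nt Ut; apply: h; exists (v t x); split => //.
  by exists t.
have [t [nt [Ut1 Ut2]]] := rx (`|n1| + `|n2|) _ (filterI U1x U2x).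
have [t0|t0] := leP 0 t.
  apply: (h1 t) => //; rewrite (ger0_norm t0) in nt.
  by have := ler_norm n1; have := normr_ge0 n2; lra.
apply: (h2 t) => //; rewrite (ltr0_norm t0) in nt.
by have := ler_norm (- n2); rewrite normrN; have := normr_ge0 n1; lra.
Qed.

Lemma flow_period x T (k : nat) : v T x = x -> v (k%:R * T) x = x.
Proof.
move=> E; elim: k => [|k IH]; first by rewrite mul0r (flow0 hv).
by rewrite -natr1 mulrDl mul1r (flowD hv) E.
Qed.

Lemma closed_pt_returns x : closed_pt v x -> returns v x.
Proof.
have key T : 0 < T -> v T x = x -> returns v x.
  move=> T0 E n U Ux; exists ((Num.bound (`|n| / T))%:R * T).
  rewrite flow_period//; split; last exact: nbhs_singleton.
  have : `|n| / T < (Num.bound (`|n| / T))%:R by apply: archi_boundP; rewrite divr_ge0 ?(ltW T0).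
  rewrite ltr_pdivrMr// => h.
  by rewrite (le_lt_trans (ler_norm n))// (lt_le_trans h)// ler_norm.
by move=> [sx|[_ [T [T0 E]]]]; [exact: (key 1)|exact: (key T)].
Qed.

Lemma period_closed_pt x t : t != 0 -> v t x = x -> closed_pt v x.
Proof.
move=> t0 E; have [sx|nsx] := pselect (singular_pt v x); first by left.
right; split => //; move: t0; rewrite neq_lt => /orP[t0|t0]; last by exists t.
exists (- t); split; first by rewrite oppr_gt0.
by rewrite -{1}E (flowK hv).
Qed.

Lemma closed_orbitP x : closed_orbit v x <-> closed_pt v x.
Proof.
split; first by apply; exact: orbit_refl.
by move=> cx _ [t _ <-]; exact: closed_pt_flow.
Qed.

Lemma not_returnsP x : ~ returns v x -> exists (M : R) (U : set S),
  [/\ 0 < M, nbhs x U & forall t, M < `|t| -> ~ U (v t x)].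
Proof.
move=> /existsNP[n /existsNP[U /not_implyP[Ux h]]].
exists (`|n| + 1), U; split; [by have := normr_ge0 n; lra|by []|].
move=> t nt Ut; apply: h; exists t; split => //.
by rewrite (le_lt_trans (ler_norm n))// (lt_trans _ nt)// ltrDl.
Qed.

(** Times farther than [M] from [t0] are excluded by the neighbourhood [U] moved to [v t0 x]. The
    remaining times at distance at least [e] form a compact set whose image is closed and, [x] being
    aperiodic, misses [v t0 x]. *)
Lemma not_returns_proper x : ~ returns v x -> proper_orbit v x.
Proof.
move=> nrx t0 e e0; have [M [U [M0 Ux hM]]] := not_returnsP nrx.
have ap t : t != 0 -> v t x <> x.
  by move=> tn E; apply: nrx; apply: closed_pt_returns; exact: period_closed_pt E.
pose A : set R := `[t0 - M, t0 - e] `|` `[t0 + e, t0 + M].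
have cA : closed [set v t x | t in A].
  apply: compact_closed => //; apply: continuous_compact.
    by apply: continuous_subspaceT => t N; exact: (flow_near_time hv).
  by apply: compactU; exact: segment_compact.
have nA : ~ [set v t x | t in A] (v t0 x).
  move=> [t At E]; apply: (ap (t - t0)).
    apply/eqP => /eqP; rewrite subr_eq0 => /eqP tt.
    by move: At; rewrite tt /A /= !in_itv /= => -[|] /andP[]; lra.
  by rewrite addrC (flowD hv) E (flowK hv).
exists ([set y | U (v (- t0) y)] `&` ~` [set v t x | t in A]).
  apply: filterI; first exact: (flow_preimage_nbhs hv).
  by apply: open_nbhs_nbhs; split => //; exact: closed_openC.
move=> t [/= Ut nAt]; exists t; split => //.
have tM : `|t - t0| <= M.
  by rewrite leNgt; apply/negP => /hM; apply; rewrite addrC (flowD hv).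
rewrite ltNge; apply/negP => et; apply: nAt; exists t => //.
move: tM et; rewrite ler_norml => /andP[l1 l2].
have [t1|t1] := leP 0 (t - t0).
  by rewrite ger0_norm// => et; right; rewrite /= in_itv /=; lra.
by rewrite ltr0_norm// => et; left; rewrite /= in_itv /=; lra.
Qed.

(** A return at a time beyond 2 is the same point as one at a time below 1, and the difference is a
    nonzero period. *)
Lemma proper_returns_closed x : proper_orbit v x -> returns v x -> closed_pt v x.
Proof.
move=> px rx; have [W Wx h] := px 0 1 ltr01.
rewrite (flow0 hv) in Wx.
have [t [t2 Wt]] := rx 2 _ Wx; have [s [E]] := h t Wt; rewrite subr0 => s1.
apply: (@period_closed_pt _ (t - s)); last by rewrite addrC (flowD hv) -E (flowK hv).
apply/eqP => /eqP; rewrite subr_eq0 => /eqP ts; rewrite ts in t2.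
by have := lt_trans t2 s1; lra.
Qed.

Lemma recurrent_iff_no_proper :
  recurrent_flow v <-> (forall x, proper_orbit v x -> closed_orbit v x).
Proof.
split.
  by move=> rv x px; apply/closed_orbitP; apply: proper_returns_closed px _; apply/recurrent_returns.
move=> h x; apply/recurrent_returns; apply: contrapT => nrx.
apply: (nrx); apply: closed_pt_returns; apply/closed_orbitP; apply: h.
exact: not_returns_proper.
Qed.

(* Of three non-collinear points of a chart, the one with the middle value of h
   would lie on the segment joining the two others. *)
Lemma no_injection_to_line (x : S) (U : set S) (h : S -> R) : nbhs x U ->
  (forall y, U y -> h @ y --> h y) -> (forall y y', U y -> U y' -> h y = h y' -> y = y') -> False.
Proof.
move=> Ux hc hinj; have [f [g [r dc]]] := disc_chart_exists (hS.2 x).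
have [r' /andP[r'0 r'r] rU] := chart_disc_small dc Ux.
pose r1 := r' / 2; have r10 : 0 < r1 by rewrite divr_gt0.
have r1r' : r1 < r' by rewrite /r1; lra.
pose c := f x; pose H := half_disc c r1.
have HU q : H q -> U (g q).
  by move=> [q2 qr]; apply: rU; exists q; split => //; rewrite (le_lt_trans qr).
have Hr q : H q -> half_disc c r q.
  by move=> [q2 qr]; split => //; rewrite (le_trans qr)// ltW// (lt_le_trans r1r').
pose k := h \o g.
have kc : {within H, continuous k}.
  apply/within_continuousP => q N Hq /(hc _ (HU _ Hq)) Nq.
  have := dc_g dc (Hr _ Hq) Nq; by apply: filterS => p hp /Hr; exact: hp.
have kinj q q' : H q -> H q' -> k q = k q' -> q = q'.
  move=> Hq Hq' /hinj E; have := E (HU _ Hq) (HU _ Hq').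
  by move=> /(congr1 f); rewrite !(dc_fg dc) //; exact: Hr.
have between a b e : H a -> H b -> H e -> k a < k b -> k b < k e ->
    exists t : R, b = a + t *: (e - a).
  move=> Ha Hb He ab be; apply: contrapT => nt.
  have sH : [set a + t *: (e - a) | t in `[0%R : R, 1%R]] `<=` H.
    by move=> _ [t /= t01 <-]; apply: half_disc_convex => //; move: t01; rewrite in_itv.
  have : (k a < k b) = (k e < k b).
    apply: (connected_locally_constant (f := fun y => k y < k b) (@segment_image_connected _ _ a e)).
    - move=> y sy; have Hy := sH _ sy.
      have yb : k y != k b.
        apply/eqP => /kinj E; have yb := E Hy Hb.
        by move: sy => [t _ ty]; apply: nt; exists t; rewrite ty.
      move: yb; rewrite neq_lt => /orP[l|l].
        have := iffLR (within_continuousP _ _) kc y [set z | z < k b] Hy (lt_nbhsl l).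
        by apply: filterS => w hw /sH/hw /= wb; rewrite l wb.
      have := iffLR (within_continuousP _ _) kc y [set z | k b < z] Hy (lt_nbhsr l).
      by apply: filterS => w hw /sH/hw /= wb; rewrite (lt_gtF l) (lt_gtF wb).
    - by exists 0; rewrite /= ?in_itv /= ?lexx ?ler01// scale0r addr0.
    - by exists 1; rewrite /= ?in_itv /= ?lexx ?ler01// scale1r addrC subrK.
  by rewrite ab (lt_gtF be).
have c2 : 0 <= c.2 by exact: (dc_ge0 dc).
pose b := (c.1 + r1, c.2); pose e := (c.1, c.2 + r1).
have Hc : H c by split => //; rewrite subrr normr0 ltW.
have Hb : H b.
  split => //; rewrite normB_pair_le /= subrr normr0 (ltW r10) andbT.
  by rewrite opprD addrA subrr sub0r normrN gtr0_norm.
have He : H e.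
  split; first by rewrite /= addr_ge0// ltW.
  rewrite normB_pair_le /= subrr normr0 (ltW r10) /=.
  by rewrite opprD addrA subrr sub0r normrN gtr0_norm.
have cE : c = (c.1, c.2) by case: (c).
have coord (p q o : R * R) (t : R) : p = q + t *: (o - q) ->
    p.1 = q.1 + t * (o.1 - q.1) /\ p.2 = q.2 + t * (o.2 - q.2) by move=> ->.
have nm p q o : H p -> H q -> H o -> k p < k q -> k q < k o ->
    (q = c /\ (p = b /\ o = e \/ p = e /\ o = b)) \/
    (q = b /\ (p = c /\ o = e \/ p = e /\ o = c)) \/
    (q = e /\ (p = c /\ o = b \/ p = b /\ o = c)) -> False.
  move=> Hp Hq Ho pq qo; have [t /coord] := between _ _ _ Hp Hq Ho pq qo.
  by move=> [E1 E2] [[? [[? ?]|[? ?]]]|[[? [[? ?]|[? ?]]]|[? [[? ?]|[? ?]]]]]; subst p q o;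
    move: E1 E2; rewrite /b /e /=; lra.
have ncb : k c <> k b by move=> /kinj E; have /(congr1 fst) := E Hc Hb; rewrite /=; lra.
have nce : k c <> k e by move=> /kinj E; have /(congr1 snd) := E Hc He; rewrite /=; lra.
have nbe : k b <> k e by move=> /kinj E; have /(congr1 fst) := E Hb He; rewrite /=; lra.
have [l1|l1|//] := ltgtP (k c) (k b); have [l2|l2|//] := ltgtP (k c) (k e);
  have [l3|l3|//] := ltgtP (k b) (k e).
- by apply: (nm c b e) => //; tauto.
- by apply: (nm c e b) => //; tauto.
- by have := lt_trans l1 l3; rewrite ltNge (ltW l2).
- by apply: (nm e c b) => //; tauto.
- by apply: (nm b c e) => //; tauto.
- by have := lt_trans l3 l1; rewrite ltNge (ltW l2).
- by apply: (nm b e c) => //; tauto.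
- by apply: (nm e b c) => //; tauto.
Qed.

(** Near [x] the embedded orbit is a compact arc, hence closed there. Were it a neighbourhood of
    [x], the box time would map an open piece of the surface injectively into a line. *)
Lemma not_returns_locally_closed x : ~ returns v x ->
  (exists2 U : set S, nbhs x U & forall y, U y -> closure (orbit v x) y -> orbit v x y) /\
  ~ nbhs x (orbit v x).
Proof.
move=> nrx.
have nsx : ~ singular_pt v x by move=> sx; apply: nrx; apply: closed_pt_returns; left.
have [Z [d [lt os]]] := ordered_section_exists hv hS hcpt nsx.
have Zx := ls_x (os_ls os); have d0 := ls_d (os_ls os).
have d20 : 0 < d / 2 by rewrite divr_gt0.
have [W] := not_returns_proper nrx 0 d20; rewrite (flow0 hv) => Wx WP.
pose A := [set v t x | t in `[- (d / 2), d / 2]].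
have cA : closed A.
  apply: compact_closed => //; apply: continuous_compact; last exact: segment_compact.
  by apply: continuous_subspaceT => t N; exact: (flow_near_time hv).
have WA y : W y -> orbit v x y -> A y.
  move=> Wy [t _ E]; rewrite -E in Wy *; have [s [<- sd]] := WP t Wy.
  by exists s => //; move: sd; rewrite subr0 ltr_norml /= in_itv /=; lra.
split.
  have := Wx; rewrite {1}nbhsE => -[U [oU Ux] UW]; exists U; first exact: (open_nbhs_nbhs (conj oU Ux)).
  move=> y Uy cy; suff [t _ <-] : A y by exists t.
  apply: contrapT => nAy.
  have : nbhs y (U `&` ~` A).
    by apply: filterI; apply: open_nbhs_nbhs; split => //; exact: closed_openC.
  by move=> /cy[w [ow [Uw nAw]]]; apply: nAw; apply: WA => //; exact: UW.
move=> nx; have nxW : nbhs x (W `&` orbit v x) by exact: filterI.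
have AP y : A y -> box v Z d y /\ box_proj v Z d y = x.
  move=> [t /=]; rewrite in_itv /= => ht <-.
  have td : `|t| < d by rewrite ltr_norml; lra.
  by split; [exact: box_in|have [] := box_coordE hv os Zx td].
apply: (no_injection_to_line (h := box_time v Z d) nxW).
- move=> y [Wy oy]; have [By _] := AP _ (WA _ Wy oy).
  apply/cvgrPdist_lt => e e0.
  by apply: filterS (box_time_near hv os By e0) => z [].
- move=> y y' [Wy oy] [Wy' oy'] E; have [By py] := AP _ (WA _ Wy oy).
  have [By' py'] := AP _ (WA _ Wy' oy').
  have [_ _ <-] := box_coordP By; have [_ _ <-] := box_coordP By'.
  by rewrite py py' E.
Qed.

Lemma closed_pt_orbit_closed x : closed_pt v x -> closed (orbit v x).
Proof.
move=> cx; have [T T0 E] : exists2 T, 0 < T & v T x = x.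
  by case: cx => [sx|[_ [T [T0 E]]]]; [exists 1|exists T].
have -> : orbit v x = [set v t x | t in `[0, T]].
  apply/seteqP; split => _ [t tI <-]; last by exists t.
  pose k := Num.floor (t / T); pose r := t - k%:~R * T.
  have [r0 rT] : 0 <= r /\ r <= T.
    have := Num.Theory.floor_le_tmp (t / T); have := Num.Theory.floorD1_gt (t / T).
    rewrite -/k intrD ltr_pdivrMr// ler_pdivlMr// mulrDl mul1r /r; lra.
  exists r; first by rewrite /= in_itv /= r0.
  have Ek : v (k%:~R * T) x = x.
    case: k {r r0 rT} => n; first exact: flow_period.
    rewrite NegzE mulrNz mulNr -{1}(flow_period n.+1 E); exact: (flowK hv).
  by rewrite -[in RHS](subrK (k%:~R * T) t) (flowD hv (t - _) (_ * T)) Ek.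
apply: compact_closed => //; apply: continuous_compact; last exact: segment_compact.
by apply: continuous_subspaceT => t N; exact: (flow_near_time hv).
Qed.

(** The points [v n x], for natural [n], cluster in the compact [S]. If the orbit were closed the
    cluster point would be on it, and [x] would return. *)
Lemma closed_not_returns x : ~ returns v x -> ~ closed (orbit v x).
Proof.
move=> nrx clo; have [M [U [M0 Ux hM]]] := not_returnsP nrx.
pose u (n : nat) := v n%:R x.
have [c [_ cc]] : exists c, [set: S] c /\ cluster (u @ \oo) c.
  by apply: hcpt; exact: filterT.
have [s _ E] : orbit v x c.
  rewrite (iffLR (closure_id _) clo) => N Nc.
  have : (u @ \oo) (orbit v x) by exists 0%N => // n _ /=; exists n%:R.
  by move=> /(cc _ N)/(_ Nc).
have Nc : nbhs c [set y | U (v (- s) y)] by rewrite -E; exact: (flow_preimage_nbhs hv).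
pose m := Num.bound (M + `|s|).
have mP : M + `|s| < m%:R by apply: archi_boundP; rewrite addr_ge0// ltW.
have : (u @ \oo) [set y | exists2 n, (m <= n)%N & y = u n].
  by exists m => // n /= mn; exists n.
move=> /cc/(_ Nc)[_ [[n mn ->]]] /=; rewrite /u -(flowD hv); apply: hM.
have nm : (m%:R : R) <= n%:R by rewrite ler_nat.
by rewrite ltr_normr; apply/orP; left; have := ler_norm s; lra.
Qed.

(** Points near [x] lie in the interior of the closure of its orbit. They are not singular, being
    moved by [v T], nor periodic, since the orbit of [x] accumulates at them and [periodic_nbhd]
    would make [x] closed. Each thus has a closure with interior around it, which the orbit of [x]
    enters, so the two closures coincide. *)
Lemma recurrent_class_nbhd x : recurrent_flow v -> ~ closed_pt v x ->
  \forall y \near x, closure (orbit v y) = closure (orbit v x).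
Proof.
move=> rv ncx.
have hret p : returns v p by apply/recurrent_returns.
have int y : ~ closed_pt v y -> interior (closure (orbit v y)) y.
  by move=> ncy; apply: contrapT => h; exact: (no_nowhere_dense_orbit hv hS hcpt hret ncy h).
have nsx : ~ singular_pt v x by move=> sx; apply: ncx; left.
have [T T0 vT] := singular_ptPn hv nsx.
have ns : \forall y \near x, v T y <> y.
  have [A [B [AT Bx AB]]] := hausdorff_separation hT vT.
  apply: filterS2 (flow_near hv AT) Bx => y Ay By E; apply: (AB y) => //.
  by rewrite -E.
apply: filterS2 ns (int x ncx) => y vTy cy.
have ncy : ~ closed_pt v y.
  move=> [sy|py]; first by apply: vTy; exact: sy.
  have [_ [[t _ <-] h]] := cy _ (periodic_nbhd hv hS hcpt py).
  apply: ncx; rewrite -(flowK hv t x); apply: closed_pt_flow => //; exact: h.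
apply/seteqP; split; first exact: orbit_closure_sub.
apply: orbit_closure_sub => //.
have [_ [[t _ <-] h]] := cy _ (int y ncy).
by rewrite -(flowK hv t x); exact: orbit_closure_flow.
Qed.

Definition orbit_class x : set S := [set y | closure (orbit v x) = closure (orbit v y)].

Lemma recurrent_iff_locally_dense :
  recurrent_flow v <-> (forall x, closed_orbit v x \/ locally_dense v x).
Proof.
split.
  move=> rv x; have [cx|ncx] := pselect (closed_pt v x); first by left; apply/closed_orbitP.
  right; exists x; apply: filterS (recurrent_class_nbhd rv ncx) => y <-.
  by apply: subset_closure; exact: orbit_refl.
move=> h x; apply/recurrent_returns; apply: contrapT => nrx.
have [/closed_orbitP/closed_pt_returns//|/(orbit_closure_interior hv) ix] := h x.
have [[U Ux UP] nx] := not_returns_locally_closed nrx.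
by apply: nx; apply: filterS2 Ux ix => y Uy cy; exact: UP.
Qed.

Lemma orbit_sub_class x : orbit v x `<=` orbit_class x.
Proof.
move=> y oy; apply/seteqP; split; last first.
  by apply: orbit_closure_sub => //; exact: subset_closure.
apply: orbit_closure_sub => //; apply: subset_closure.
by move: oy => [t _ <-]; exists (- t) => //; rewrite (flowK hv).
Qed.

(** For a point that does not return, local closedness makes the class equal to the orbit, which is
    neither closed nor open. *)
Lemma recurrent_iff_classes :
  recurrent_flow v <-> (forall x, closed (orbit_class x) \/ open (orbit_class x)).
Proof.
have cl_closed y x : closed_pt v y -> closure (orbit v x) = closure (orbit v y) -> orbit v y x.
  move=> cy E; have : closure (orbit v x) x by apply: subset_closure; exact: orbit_refl.
  by rewrite E -(iffLR (closure_id _) (closed_pt_orbit_closed cy)).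
split.
  move=> rv x; have [cx|ncx] := pselect (closed_pt v x).
    left; have -> : orbit_class x = orbit v x; last exact: closed_pt_orbit_closed.
    apply/seteqP; split; last exact: orbit_sub_class.
    by move=> y /esym; exact: cl_closed.
  right; rewrite openE => y xy; rewrite /orbit_class /= in xy.
  have ncy : ~ closed_pt v y.
    by move=> cy; apply: ncx; have [t _ <-] := cl_closed _ _ cy xy; exact: closed_pt_flow.
  by apply: filterS (recurrent_class_nbhd rv ncy) => w; rewrite /orbit_class /= xy => ->.
move=> h x; apply/recurrent_returns; apply: contrapT => nrx.
have [[U Ux UP] nx] := not_returns_locally_closed nrx.
have E : orbit_class x = orbit v x.
  apply/seteqP; split; last exact: orbit_sub_class.
  move=> y xy; rewrite /orbit_class /= in xy.
  have : closure (orbit v y) x by rewrite -xy; apply: subset_closure; exact: orbit_refl.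
  move=> /(_ U Ux)[_ [[t _ <-] Uw]].
  have : orbit v x (v t y).
    by apply: UP => //; rewrite xy; apply: subset_closure; exists t.
  by move=> /(orbit_flow hv (- t)); rewrite (flowK hv).
have := h x; rewrite E => -[cx|ox]; first exact: (closed_not_returns nrx cx).
apply: nx; apply: open_nbhs_nbhs; split => //; exact: orbit_refl.
Qed.

End Recurrence.

(** * Separation of the quotients, read on the surface *)

Section QuotientSpaces.

Lemma T_half_quotient (X : Defs.space) (Rel : pts X -> pts X -> Prop) :
  (forall x, Rel x x) -> (forall x y, Rel x y -> Rel x = Rel y) ->
  T_half (quotient_space Rel) <-> forall x, sp_closed (Rel x) \/ @opens X (Rel x).
Proof.
move=> refl eqv.
have sigE (p q : pts (quotient_space Rel)) : proj1_sig p = proj1_sig q -> p = q.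
  by case: p q => [A hA] [B hB] /= E; subst B; congr (exist _ _ _); exact: Prop_irrelevance.
pose cl x : pts (quotient_space Rel) := exist _ (Rel x) (ex_intro _ x erefl).
have E1 (p : pts (quotient_space Rel)) :
    [set y | exists2 A, [set p] A & proj1_sig A y] = proj1_sig p.
  by apply/seteqP; split => y; [move=> [A -> //]|exists p].
have E2 (p : pts (quotient_space Rel)) :
    [set y | exists2 A, (~` [set p]) A & proj1_sig A y] = ~` proj1_sig p.
  apply/seteqP; split => y.
    move=> [[A [x' EA]] Ap /= Ay py]; apply: Ap; apply: sigE => /=.
    case: p py => [B [x EB]] /= By; rewrite EA EB in Ay By *.
    by rewrite (eqv _ _ Ay) (eqv _ _ By).
  move=> npy; exists (cl y) => /=; last exact: refl.
  by move=> E; apply: npy; rewrite -E /=; exact: refl.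
split.
  move=> h x; have := h (cl x); rewrite /sp_closed /= /quotient_space /=.
  by rewrite E1 E2.
move=> h p; case: (p) => A [x EA].
have := h x; rewrite -EA /sp_closed /= => -[h1|h1]; [left|right].
  by have := E2 (exist _ A (ex_intro _ x EA)); rewrite /= => ->.
by have := E1 (exist _ A (ex_intro _ x EA)); rewrite /= => ->.
Qed.

Variables (R : realType) (S : topologicalType) (v : R -> S -> S).
Hypothesis hv : flow v.

Lemma T_half_orbit_class_space :
  T_half (orbit_class_space v) <->
  forall x, closed (orbit_class v x) \/ open (orbit_class v x).
Proof.
have [h1 h2] := @T_half_quotient (top_space S)
  (fun x y => closure (orbit v x) = closure (orbit v y)) (fun x => erefl)
  (fun x y E => funext (fun z => congr1 (fun A => A = closure (orbit v z)) E)).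
have E x : sp_closed (X := top_space S) (orbit_class v x) = closed (orbit_class v x).
  exact: openC.
split; first by move=> /h1 h x; rewrite -E; exact: h.
by move=> h; apply: h2 => x; have := h x; rewrite -E.
Qed.

Let opt x : pts (orbit_space v) :=
  exist _ (fun y => orbit v x = orbit v y) (ex_intro _ x erefl).

Let opt_eq x y : orbit v x = orbit v y -> opt x = opt y.
Proof.
move=> E; rewrite /opt; move: (ex_intro _ x _) (ex_intro _ y _).
by rewrite E => h1 h2; congr (exist _ _ _); exact: Prop_irrelevance.
Qed.

Let opt_surj (p : pts (orbit_space v)) y : proj1_sig p y -> p = opt y.
Proof.
case: p => A [x EA] /= Ay; have xy : orbit v x = orbit v y by rewrite EA in Ay.
rewrite -(opt_eq xy) /opt; move: (ex_intro _ x _) (ex_intro _ x _).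
by rewrite EA => h1 h2; congr (exist _ _ _); exact: Prop_irrelevance.
Qed.

Let opt_ex (p : pts (orbit_space v)) : exists w, p = opt w.
Proof. by case: (proj2_sig p) => w E; exists w; apply: opt_surj; rewrite E. Qed.

Let orbit_eq x y : orbit v x y -> orbit v x = orbit v y.
Proof.
move=> [t _ <-]; apply/seteqP; split => _ [s _ <-].
  by exists (s - t) => //; rewrite -(flowD hv) subrK.
by exists (s + t) => //; rewrite (flowD hv).
Qed.

Let saturate (U : set (pts (orbit_space v))) :
  [set y | exists2 A, U A & proj1_sig A y] = [set y | U (opt y)].
Proof.
apply/seteqP; split => y; first by move=> [A UA Ay] /=; rewrite -(opt_surj Ay).
by move=> Uy; exists (opt y).
Qed.

(** The closure of an orbit is invariant, so its complement is saturated and descends to an open set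
    of the orbit space. *)
Let closureE x y : sp_closure [set opt x] (opt y) <-> closure (orbit v x) y.
Proof.
split; last first.
  move=> cy U; rewrite /opens /= saturate => oU Uy.
  have [w [ow Uw]] := cy _ (open_nbhs_nbhs (conj oU Uy)).
  by exists (opt x); split => //; rewrite (opt_eq (orbit_eq ow)).
move=> h; apply: contrapT => ncy.
pose U : set (pts (orbit_space v)) := [set p | exists2 w, p = opt w & ~ closure (orbit v x) w].
have UE w : U (opt w) <-> ~ closure (orbit v x) w.
  split; last by exists w.
  move=> [w' E nw'] cw; apply: nw'.
  have : orbit v w w'.
    have : proj1_sig (opt w) w' by rewrite E.
    by move=> /= ->; exact: orbit_refl.
  by move=> [t _ <-]; exact: orbit_closure_flow.
have oU : @opens (orbit_space v) U.
  rewrite /opens /= saturate; have -> : [set y | U (opt y)] = ~` closure (orbit v x).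
    by apply/seteqP; split => w; rewrite /= UE.
  by apply: closed_openC; exact: closed_closure.
have [p [Up px]] := h U oU ((UE y).2 ncy).
rewrite /= in px; rewrite px in Up; move/UE: Up; apply; apply: subset_closure; exact: orbit_refl.
Qed.

(** By [closureE], two points of the orbit space have the same closure exactly when their orbits do,
    so the classes of the Kolmogorov quotient pull back to orbit classes. *)
Lemma S_half_orbit_space :
  S_half (orbit_space v) <->
  forall x, closed (orbit_class v x) \/ open (orbit_class v x).
Proof.
pose Rel (p q : pts (orbit_space v)) := sp_closure [set p] = sp_closure [set q].
have RelE x y : Rel (opt x) (opt y) <-> orbit_class v x y.
  rewrite /Rel /orbit_class /=; split => E.
    apply/seteqP; split => w /closureE; [rewrite E|rewrite -E] => /closureE//.
  apply/seteqP; split => p; have [w ->] := opt_ex p => /closureE h; apply/closureE.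
    by rewrite -E.
  by rewrite E.
have [h1 h2] := @T_half_quotient (orbit_space v) Rel (fun x => erefl)
  (fun x y E => funext (fun z => congr1 (fun A => A = sp_closure [set z]) E)).
have E x : (sp_closed (Rel (opt x)) <-> closed (orbit_class v x)) /\
    (@opens (orbit_space v) (Rel (opt x)) <-> open (orbit_class v x)).
  rewrite /sp_closed /opens /= !saturate -openC.
  have -> : [set y | Rel (opt x) (opt y)] = orbit_class v x.
    by apply/seteqP; split => y /RelE.
  by have -> : [set y | (~` Rel (opt x)) (opt y)] = ~` orbit_class v x
    by apply/seteqP; split => y /= h /RelE.
split; first by move=> /h1 h x; have [e1 e2] := E x; rewrite -e1 -e2.
move=> h; apply: h2 => p; have [x ->] := opt_ex p.
by have [e1 e2] := E x; rewrite e1 e2.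
Qed.

End QuotientSpaces.

Theorem theorem3p2 (R : realType) (S : topologicalType)
    (hS : surface R S) (hcpt : compact [set: S]) (hconn : connected [set: S])
    (v : R -> S -> S) (hv : flow v) :
  [/\ recurrent_flow v <-> (forall x : S, proper_orbit v x -> closed_orbit v x),
      recurrent_flow v <-> (forall x : S, closed_orbit v x \/ locally_dense v x),
      recurrent_flow v <-> T_half (orbit_class_space v) &
      recurrent_flow v <-> S_half (orbit_space v)].
Proof.
split.
- exact: recurrent_iff_no_proper hv hS.
- exact: recurrent_iff_locally_dense hv hS hcpt.
- by rewrite T_half_orbit_class_space; exact: recurrent_iff_classes.
- by rewrite S_half_orbit_space//; exact: recurrent_iff_classes.
Qed.
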